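(* Let $n=2$ and $\sigma\in(0,1]$. There exist a function $\Phi_0:[0,+\infty)\to[0,+\infty)$ which is nondecreasing, lower semicontinuous and satisfies $\lim_{t\to+\infty}\Phi_0(t)=+\infty$, and radii $R_0>r_0>0$, such that there is a minimizer $u$ of $$\mathcal{E}_\Omega(v):=\int_\Omega|\nabla v(x)|^2\,dx+\Phi_0\Big(\mathrm{Per}_\sigma\big(\{v>0\},\Omega\big)\Big)$$ in $\Omega=B_{R_0}$ whose restriction to $B_{r_0}$ is not a minimizer of $\mathcal{E}_\Omega$ in $\Omega=B_{r_0}$.
   Context: $B_r$ is the open ball of radius $r$ centered at the origin in $\mathbb{R}^n$. For $\sigma\in(0,1)$: $\mathrm{Per}_\sigma(E,\Omega):=\mathcal{S}_\sigma(E,E^c\cap\Omega)+\mathcal{S}_\sigma(E\cap\Omega,E^c\cap\Omega^c)$ with $E^c=\mathbb{R}^n\setminus E$ and $\mathcal{S}_\sigma(E,F):=\sigma(1-\sigma)\iint_{E\times F}|x-y|^{-n-\sigma}\,dx\,dy$; for $\sigma=1$, $\mathrm{Per}_1(E,\Omega)$ is the classical (De Giorgi) perimeter of $E$ in $\Omega$. A minimizer of $\mathcal{E}_\Omega$ in $\Omega$ is a function $u$ with $\mathcal{E}_\Omega(u)<\infty$ and $\mathcal{E}_\Omega(u)\le\mathcal{E}_\Omega(v)$ for every $v$ with $v-u\in H^1_0(\Omega)$ (for $\sigma\in(0,1)$ also $v=u$ outside $\Omega$). *)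

(* Defs.v *)
From HB Require Import structures.
From mathcomp Require Import all_boot all_order all_algebra.
From mathcomp Require Import all_classical all_reals all_analysis.
Set Implicit Arguments. Unset Strict Implicit. Unset Printing Implicit Defensive.
Import Order.TTheory GRing.Theory Num.Theory.
Import numFieldNormedType.Exports.
Local Open Scope classical_set_scope.
Local Open Scope ring_scope.

Definition pt (R : realType) := (R * R)%type.

Definition leb2 (R : realType) := (@lebesgue_measure R \x @lebesgue_measure R)%E.

Definition enorm (R : realType) (x : pt R) : R := Num.sqrt (x.1 ^+ 2 + x.2 ^+ 2).

Definition Ball (R : realType) (r : R) : set (pt R) := [set x | enorm x < r].


Definition edist (R : realType) (x y : pt R) : R := enorm (x - y).

Definition dir (R : realType) (b : bool) : pt R := if b then (1, 0) else (0, 1).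

Definition iterD (R : realType) (l : seq bool) (f : pt R -> R) : pt R -> R :=
  foldr (fun b g => fun x => 'D_(dir R b) g x) f l.

Definition smooth (R : realType) (f : pt R -> R) : Prop :=
  forall l : seq bool, continuous (iterD l f) /\
    forall (b : bool) (x : pt R), derivable (iterD l f) x (dir R b).

Definition testfun (R : realType) (Om : set (pt R)) (phi : pt R -> R) : Prop :=
  smooth phi /\ compact (closure [set x | phi x != 0]) /\
  closure [set x | phi x != 0] `<=` Om.

Definition loc_int (R : realType) (Om : set (pt R)) (f : pt R -> R) : Prop :=
  forall K, compact K -> K `<=` Om -> (@leb2 R).-integrable K (fun x => (f x)%:E).

Definition weak_grad (R : realType) (Om : set (pt R)) (u g1 g2 : pt R -> R) : Prop :=
  loc_int Om u /\ loc_int Om g1 /\ loc_int Om g2 /\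
  forall phi, testfun Om phi ->
    (\int[@leb2 R]_(x in Om) (u x * 'D_(dir R true) phi x)%:E =
       - \int[@leb2 R]_(x in Om) (g1 x * phi x)%:E)%E /\
    (\int[@leb2 R]_(x in Om) (u x * 'D_(dir R false) phi x)%:E =
       - \int[@leb2 R]_(x in Om) (g2 x * phi x)%:E)%E.

(* Dirichlet energy  int_Omega |grad v|^2 ; +oo if v has no weak gradient in Omega
   (the weak gradient is unique a.e., so the set below has at most one element) *)
Definition dirichlet (R : realType) (Om : set (pt R)) (v : pt R -> R) : \bar R :=
  ereal_inf [set e | exists g1 g2, weak_grad Om v g1 g2 /\
     e = (\int[@leb2 R]_(x in Om) (g1 x ^+ 2 + g2 x ^+ 2)%:E)%E].

Definition H10 (R : realType) (Om : set (pt R)) (w : pt R -> R) : Prop :=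
  exists g1 g2, weak_grad Om w g1 g2 /\
  (\int[@leb2 R]_(x in Om) (w x ^+ 2 + g1 x ^+ 2 + g2 x ^+ 2)%:E < +oo)%E /\
  exists phi : nat -> pt R -> R, (forall k, testfun Om (phi k)) /\
    (fun k : nat => \int[@leb2 R]_(x in Om)
       ((phi k x - w x) ^+ 2 + ('D_(dir R true) (phi k) x - g1 x) ^+ 2
        + ('D_(dir R false) (phi k) x - g2 x) ^+ 2)%:E)%E @ \oo --> (0 : \bar R).

Definition per1 (R : realType) (E Om : set (pt R)) : \bar R :=
  ereal_sup [set e | exists phi1 phi2, testfun Om phi1 /\ testfun Om phi2 /\
    (forall x, phi1 x ^+ 2 + phi2 x ^+ 2 <= 1) /\
    e = (\int[@leb2 R]_(x in E `&` Om) ('D_(dir R true) phi1 x + 'D_(dir R false) phi2 x)%:E)%E].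

Definition Ssig (R : realType) (sigma : R) (E F : set (pt R)) : \bar R :=
  ((sigma * (1 - sigma))%:E *
    \int[@leb2 R]_(x in E) \int[@leb2 R]_(y in F) (edist x y `^ (- 2 - sigma))%:E)%E.

Definition perfrac (R : realType) (sigma : R) (E Om : set (pt R)) : \bar R :=
  (Ssig sigma E (~` E `&` Om) + Ssig sigma (E `&` Om) (~` E `&` ~` Om))%E.

Definition Per (R : realType) (sigma : R) (E Om : set (pt R)) : \bar R :=
  if sigma == 1 then per1 E Om else perfrac sigma E Om.

(* Phi extended to [0, +oo]: Phi(+oo) = +oo (= lim_{t -> +oo} Phi t) *)
Definition Phi_ext (R : realType) (Phi : R -> R) (e : \bar R) : \bar R :=
  match e with
  | r%:E => (Phi r)%:E
  | +oo%E => +oo%E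
  | -oo%E => -oo%E
  end.

Definition energy (R : realType) (sigma : R) (Phi : R -> R) (Om : set (pt R))
  (v : pt R -> R) : \bar R :=
  (dirichlet Om v + Phi_ext Phi (Per sigma [set x | (0 < v x)%R] Om))%E.

Definition minimizer (R : realType) (sigma : R) (Phi : R -> R) (Om : set (pt R))
  (u : pt R -> R) : Prop :=
  measurable_fun setT u /\
  (energy sigma Phi Om u < +oo)%E /\
  forall v : pt R -> R, H10 Om (v - u) ->
    (sigma < 1 -> forall x, ~ Om x -> v x = u x) ->
    (energy sigma Phi Om u <= energy sigma Phi Om v)%E.

Definition admissible_Phi (R : realType) (Phi : R -> R) : Prop :=
  (forall t, 0 <= t -> 0 <= Phi t) /\
  (forall s t, 0 <= s -> s <= t -> Phi s <= Phi t) /\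
  (forall t, 0 <= t -> forall a, a < Phi t ->
     \forall s \near t, 0 <= s -> a < Phi s) /\
  (Phi x @[x --> +oo] --> +oo).

(* Main.v *)
(** The function u(x) = cos x1 * exp x2 is harmonic and its positivity set E0 is
    a union of vertical strips.  Cutting the box [-pi,pi] x [-b,b] out of E0, by
    multiplying u with a smooth cutoff, strictly lowers the perimeter when b is
    large; let p be the perimeter of the cut set in the small ball and M a bound
    for the Dirichlet energy of the cut function.  Let Phi vanish up to p and be
    at least M beyond p.  In the small ball the cut function has energy less
    than M while u pays at least M.  In a ball of radius R, a competitor v that
    beats u must have Dirichlet energy within M of that of u; since u is
    harmonic the excess is the energy of v - u, so by Poincare v - u has
    L^2-norm squared at most 16 R^2 M.  At height of order R, |u| is of size
    exp R away from the nodal lines, which beats the polynomial bound: there {v > 0}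
    agrees with the strips up to a small set, its perimeter in the large ball
    exceeds p, and v also pays M. *)
Require Import Defs.
From HB Require Import structures.
From mathcomp Require Import all_boot all_order all_algebra.
From mathcomp Require Import all_classical all_reals all_analysis.
From mathcomp Require Import measurable_realfun.
From mathcomp Require Import ring lra.
Set Implicit Arguments. Unset Strict Implicit. Unset Printing Implicit Defensive.
Import Order.TTheory GRing.Theory Num.Theory.
Import numFieldNormedType.Exports.
Local Open Scope classical_set_scope.
Local Open Scope ring_scope.

(** * Smooth functions and test functions *)

(** The nodal lines of u are vertical, so [E0] looks alike at every height while |u| grows
    exponentially: moving up lets the amplitude beat any polynomial bound without changing the
    geometry. A tall box is removed because the gain along its vertical sides is linear in b, while
    the cost at the two ends is bounded for sigma = 1 and of order b^(1 - sigma/2) for sigma < 1. In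
    the fractional case the removed piece also starts to interact with the other positive strips;
    each of them is a translate by pi of a negative strip nearer to the piece, whose interaction
    disappears. The constants are fixed in the order b, p, M, large radius, Q: p and M involve only
    the small ball, and the radius only p and M. The main obstacle is that a competitor in the large
    ball is merely close to u in L^2, so nothing is known about the boundary of its positivity set.
    For sigma = 1 its perimeter is bounded below with a single test field whose divergence is O(|cos
    x1|); at a point where the sign flips, |cos x1| exp x2 is at most |v - u|. For sigma < 1
    Chebyshev bounds the area of the bad set, and well separated pieces of opposite sign give the
    interaction. *)

Section smooth_calculus.
Context {R : realType}.

Section directions.
Context {V : normedModType R} {I : Type} (dirs : I -> V).

(** The family of directions is a parameter so that the same closure lemmas serve functions on the
    line (one direction) and on the plane (two). Continuity is required at every order because it
    does not follow from directional derivatives. *)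
Fixpoint Cn (n : nat) (f : V -> R) : Prop :=
  continuous f /\
  if n is m.+1 then forall i, (forall x, derivable f x (dirs i)) /\
    Cn m (fun x => 'D_(dirs i) f x)
  else True.

Definition Cinf (f : V -> R) := forall n, Cn n f.

Lemma CnS n f : Cn n.+1 f -> Cn n f.
Proof.
elim: n f => [|n IH] f [cf H]; first by split.
by split=> // i; have [dfi Hi] := H i; split => //; exact: IH.
Qed.

Lemma Cn_is_derive n f (df : I -> V -> R) :
  continuous f -> (forall i x, is_derive x (dirs i) f (df i x)) ->
  (forall i, Cn n (df i)) -> Cn n.+1 f.
Proof.
move=> cf H1 H2; split=> // i; split=> [x|].
  by have := H1 i x; case.
suff -> : (fun x => 'D_(dirs i) f x) = df i by [].
by apply/funext => x; have := H1 i x; case.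
Qed.

Lemma Cn_cst n (c : R) : Cn n (cst c).
Proof.
elim: n c => [|n IH] c; first by split=> // x; exact: cvg_cst.
apply: (@Cn_is_derive _ _ (fun _ => cst 0)) => //.
by move=> x; exact: cvg_cst.
Qed.

Lemma CnD n f g : Cn n f -> Cn n g -> Cn n (fun x => f x + g x).
Proof.
elim: n f g => [|n IH] f g [cf Hf] [cg Hg].
  by split=> // x; apply: cvgD; [exact: cf|exact: cg].
apply: (@Cn_is_derive _ _ (fun i x => 'D_(dirs i) f x + 'D_(dirs i) g x)).
- by move=> x; apply: cvgD; [exact: cf|exact: cg].
- move=> i x; have [df _] := Hf i; have [dg _] := Hg i.
  by apply: is_deriveD; apply: derivableP.
- by move=> i; apply: IH; [case: (Hf i)|case: (Hg i)].
Qed.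

Lemma CnM n f g : Cn n f -> Cn n g -> Cn n (fun x => f x * g x).
Proof.
elim: n f g => [|n IH] f g Hf0 Hg0; have [cf Hf] := Hf0; have [cg Hg] := Hg0.
  by split=> // x; apply: cvgM; [exact: cf|exact: cg].
apply: (@Cn_is_derive _ _ (fun i x => f x * 'D_(dirs i) g x + g x * 'D_(dirs i) f x)).
- by move=> x; apply: cvgM; [exact: cf|exact: cg].
- move=> i x; have [df _] := Hf i; have [dg _] := Hg i.
  by apply: is_deriveM; apply: derivableP.
- move=> i; apply: CnD; apply: IH; do ?exact: CnS.
  + by case: (Hg i).
  + by case: (Hf i).
Qed.

(** The derivative of 1/f is a product containing 1/f itself, one order lower; so the induction is
    on the order with f fixed. *)
Lemma CnV n f : (forall x, f x != 0) -> Cn n f -> Cn n (fun x => (f x)^-1).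
Proof.
move=> f0; elim: n => [|n IH] Hf0; have [cf Hf] := Hf0.
  by split=> // x; apply: cvgV => //; exact: cf.
apply: (@Cn_is_derive _ _ (fun i x => (-1 * ((f x)^-1 * (f x)^-1)) * 'D_(dirs i) f x)).
- by move=> x; apply: cvgV => //; exact: cf.
- move=> i x; have [df _] := Hf i.
  apply: DeriveDef; first exact: derivableV.
  by rewrite deriveV// /GRing.scale/= expr2 invfM mulN1r.
- move=> i; have HS := IH (CnS Hf0).
  apply: CnM; last by case: (Hf i).
  by apply: CnM; [exact: Cn_cst | exact: CnM].
Qed.

Lemma Cinf_cst c : Cinf (cst c). Proof. by move=> n; exact: Cn_cst. Qed.
Lemma CinfD f g : Cinf f -> Cinf g -> Cinf (fun x => f x + g x).
Proof. by move=> Hf Hg n; exact: CnD. Qed.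
Lemma CinfM f g : Cinf f -> Cinf g -> Cinf (fun x => f x * g x).
Proof. by move=> Hf Hg n; exact: CnM. Qed.
Lemma CinfV f : (forall x, f x != 0) -> Cinf f -> Cinf (fun x => (f x)^-1).
Proof. by move=> f0 Hf n; exact: CnV. Qed.
Lemma CinfZ c f : Cinf f -> Cinf (fun x => c * f x).
Proof. by move=> Hf; apply: CinfM => //; exact: Cinf_cst. Qed.
Lemma CinfN f : Cinf f -> Cinf (fun x => - f x).
Proof.
move=> Hf; suff -> : (fun x => - f x) = (fun x => (-1) * f x) by exact: CinfZ.
by apply/funext => x; rewrite mulN1r.
Qed.
Lemma CinfB f g : Cinf f -> Cinf g -> Cinf (fun x => f x - g x).
Proof. by move=> Hf Hg; apply: CinfD => //; exact: CinfN. Qed.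

Lemma Cinf_continuous f : Cinf f -> continuous f.
Proof. by move=> /(_ 0%N)[]. Qed.

Lemma Cinf_derivable f i x : Cinf f -> derivable f x (dirs i).
Proof. by move=> /(_ 1%N)[_ /(_ i)[]]. Qed.

Lemma Cinf_derive f i : Cinf f -> Cinf (fun x => 'D_(dirs i) f x).
Proof. by move=> Hf n; have [_ /(_ i)[]] := Hf n.+1. Qed.

End directions.

Definition Cinf1 := @Cinf R unit (fun _ => 1 : R).

Lemma Cinf1_derivable f x : Cinf1 f -> derivable f x 1.
Proof. by move=> Hf; have := @Cinf_derivable _ _ _ f tt x Hf. Qed.

Lemma Cinf1_derive f : Cinf1 f -> Cinf1 (fun x => 'D_1 f x).
Proof. by move=> Hf; have := @Cinf_derive _ _ _ f tt Hf. Qed.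

(** Restricted to the line h -> h v + x, the difference quotients become those of a function of one
    variable at 0, where the ordinary chain rule applies. *)
Lemma is_derive_comp_dir (V : normedModType R) (v x : V) (f : V -> R) (g : R -> R)
    (df dg : R) :
  is_derive x v f df -> is_derive (f x) 1 g dg ->
  is_derive x v (g \o f) (dg * df).
Proof.
move=> Hf Hg.
pose F (h : R) := f (h *: v + x).
have E (k : V -> R) : (fun h : R => h^-1 *: ((k \o shift x) (h *: v) - k x)) =
   (fun h : R => h^-1 *: (((fun t : R => k (t *: v + x)) \o shift 0) (h *: 1) - (fun t : R => k (t *: v + x)) 0)).
  by apply/funext => h /=; rewrite scale0r add0r addr0 [h *: 1]mulr1.
have HF : is_derive (0:R) 1 F df.
  have := Hf; case=> Hd Hv; split.
    by rewrite /derivable -E.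
  by rewrite /derive -E.
have F0 : F 0 = f x by rewrite /F scale0r add0r.
have HG : is_derive (F 0) 1 g dg by rewrite F0.
have [H1 H2] := is_derive1_comp HG HF; split.
  by rewrite /derivable E.
by rewrite /derive E -[RHS]H2.
Qed.

Lemma Cinf_comp (V : normedModType R) (I : Type) (dirs : I -> V) f (g : R -> R) :
  Cinf dirs f -> Cinf1 g -> Cinf dirs (g \o f).
Proof.
move=> Hf Hg n; elim: n g Hg => [|n IH] g Hg.
  by split=> //; move=> x; apply: continuous_comp;
     [exact: (Cinf_continuous Hf)|exact: (Cinf_continuous Hg)].
apply: (@Cn_is_derive _ _ _ _ _ (fun i x => 'D_1 g (f x) * 'D_(dirs i) f x)).
- by move=> x; apply: continuous_comp;
     [exact: (Cinf_continuous Hf)|exact: (Cinf_continuous Hg)].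
- move=> i x; apply: is_derive_comp_dir; apply: derivableP.
    exact: Cinf_derivable.
  exact: Cinf1_derivable.
- move=> i; apply: CnM.
    by apply: (IH (fun y => 'D_1 g y)); exact: Cinf1_derive.
  exact: (@Cinf_derive _ _ _ _ i Hf n).
Qed.

(** [Cn] peels off the derivative applied first, [iterD] the one applied last; decomposing the list
    from its right end reconciles them. *)
Lemma smoothE (f : pt R -> R) : smooth f <-> Cinf (@dir R) f.
Proof.
have itr l b (h : pt R -> R) : Defs.iterD (rcons l b) h = Defs.iterD l (fun x => 'D_(dir R b) h x).
  by rewrite /Defs.iterD -cats1 foldr_cat.
split=> [H n|].
  elim: n f H => [|n IH] f H.
    by split=> //; have [] := H [::].
  split; first by have [] := H [::].
  move=> b; split; first by have [_ /(_ b)] := H [::].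
  by apply: IH => l; rewrite -itr; exact: H.
move=> H l; elim/last_ind: l f H => [|l b IH] f H.
  split; first exact: (Cinf_continuous H).
  by move=> b x; exact: (Cinf_derivable H).
by rewrite itr; apply: IH; exact: Cinf_derive.
Qed.

Lemma Cinf1_id : Cinf1 (fun x => x).
Proof.
case=> [|n]; first by split=> // x; exact: cvg_id.
apply: (@Cn_is_derive _ _ _ _ _ (fun _ => cst 1)).
- by move=> x; exact: cvg_id.
- by move=> _; exact: Cn_cst.
Qed.

Lemma Cinf1_expR : Cinf1 (@expR R).
Proof.
elim=> [|n IH]; first by split=> //; exact: continuous_expR.
apply: (@Cn_is_derive _ _ _ _ _ (fun _ => @expR R)) => //.
exact: continuous_expR.
Qed.

Lemma Cinf1_cossin : Cinf1 (@cos R) /\ Cinf1 (@sin R).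
Proof.
suff H n : Cn (fun _ : unit => 1 : R) n (@cos R) /\ Cn (fun _ : unit => 1 : R) n (@sin R).
  by split=> n; have [] := H n.
elim: n => [|n [IHc IHs]].
  by split; split=> //; [exact: continuous_cos|exact: continuous_sin].
split.
  apply: (@Cn_is_derive _ _ _ _ _ (fun _ x => -1 * sin x)).
  - exact: continuous_cos.
  - by move=> _ x; rewrite mulN1r; exact: is_derive_cos.
  - by move=> _; apply: CnM => //; exact: Cn_cst.
apply: (@Cn_is_derive _ _ _ _ _ (fun _ => @cos R)) => //.
exact: continuous_sin.
Qed.

Lemma is_derive_fst b (x : pt R) : is_derive x (dir R b) fst (if b then 1 else 0 : R).
Proof.
have E : \forall h \near 0^', (if b then 1 else 0 : R) = h^-1 *: (((@fst R R) \o shift x) (h *: dir R b) - x.1).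
  near=> h; have h0 : h != 0 by near: h; exact: nbhs_dnbhs_neq.
  rewrite /= addrK /dir; case: b; rewrite /= /GRing.scale/= ?mulr1 ?mulr0 ?mulVf//.
have C : (fun h => h^-1 *: (((@fst R R) \o shift x) (h *: dir R b) - x.1)) @ 0^' --> (if b then 1 else 0 : R).
  apply: (@cvg_trans _ (cst (if b then 1 else 0 : R) @ 0^')); last exact: cvg_cst.
  by apply: near_eq_cvg; exact: E.
split; first by apply/cvg_ex; eexists; exact: C.
exact/cvg_lim.
Unshelve. all: by end_near. Qed.

Lemma is_derive_snd b (x : pt R) : is_derive x (dir R b) snd (if b then 0 else 1 : R).
Proof.
have E : \forall h \near 0^', (if b then 0 else 1 : R) = h^-1 *: (((@snd R R) \o shift x) (h *: dir R b) - x.2).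
  near=> h; have h0 : h != 0 by near: h; exact: nbhs_dnbhs_neq.
  rewrite /= addrK /dir; case: b; rewrite /= /GRing.scale/= ?mulr1 ?mulr0 ?mulVf//.
have C : (fun h => h^-1 *: (((@snd R R) \o shift x) (h *: dir R b) - x.2)) @ 0^' --> (if b then 0 else 1 : R).
  apply: (@cvg_trans _ (cst (if b then 0 else 1 : R) @ 0^')); last exact: cvg_cst.
  by apply: near_eq_cvg; exact: E.
split; first by apply/cvg_ex; eexists; exact: C.
exact/cvg_lim.
Unshelve. all: by end_near. Qed.

Lemma Cinf_fst : Cinf (@dir R) fst.
Proof.
case=> [|n]; first by split=> // x; exact: cvg_fst.
apply: (@Cn_is_derive _ _ _ _ _ (fun b => cst (if b then 1 else 0 : R))).
- by move=> x; exact: cvg_fst.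
- by move=> b x; exact: is_derive_fst.
- by move=> b; exact: Cn_cst.
Qed.

Lemma Cinf_snd : Cinf (@dir R) snd.
Proof.
case=> [|n]; first by split=> // x; exact: cvg_snd.
apply: (@Cn_is_derive _ _ _ _ _ (fun b => cst (if b then 0 else 1 : R))).
- by move=> x; exact: cvg_snd.
- by move=> b x; exact: is_derive_snd.
- by move=> b; exact: Cn_cst.
Qed.

End smooth_calculus.

(** * Smooth cutoff functions *)

Section cutoffs.
Context {R : realType}.

(** The powers of 1/t in front of exp(-1/t) make the family closed under differentiation, so
    smoothness follows by induction for all k at once. *)
Definition flat (k : nat) (t : R) : R :=
  if 0 < t then t^-1 ^+ k * expR (- t^-1) else 0.

Lemma flat_le0 k t : t <= 0 -> flat k t = 0.
Proof. by rewrite /flat leNgt; case: ifP. Qed.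

Lemma flat_gt0 k t : 0 < t -> 0 < flat k t.
Proof.
by move=> t0; rewrite /flat t0 mulr_gt0 ?expR_gt0// exprn_gt0// invr_gt0.
Qed.

Lemma flat_ge0 k t : 0 <= flat k t.
Proof. by case: (ltP 0 t) => [/(flat_gt0 k)/ltW//|/(flat_le0 k)->]. Qed.

(** With s = 1/t, this is exp s >= s^(k+1) / (k+1)!, a single term of the exponential series. *)
Lemma flat_bound k t : `|flat k t| <= k.+1`!%:R * `|t|.
Proof.
rewrite ger0_norm ?flat_ge0//; case: (ltP 0 t) => t0; last first.
  by rewrite flat_le0// mulr_ge0.
rewrite /flat t0 gtr0_norm// expRN.
have s0 : 0 < t^-1 by rewrite invr_gt0.
set s := t^-1 in s0 *.
have f0 : 0 < k.+1`!%:R :> R by rewrite ltr0n fact_gt0.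
have H : s ^+ k.+1 / k.+1`!%:R <= expR s.
  by have := expR_ge1Dxn k (ltW s0); set q := _ / _; lra.
rewrite ler_pdivrMr ?expR_gt0//.
apply: (@le_trans _ _ (k.+1`!%:R * t * (s ^+ k.+1 / k.+1`!%:R))).
  rewrite exprS /s; set a := _ ^+ k; set f := _%:R in f0 *.
  rewrite [leRHS](_ : _ = a)//; field; rewrite !gt_eqF//.
by rewrite ler_pM2l// mulr_gt0.
Qed.

Lemma is_derive_flat k t :
  is_derive t (1:R) (flat k) (- k%:R * flat k.+1 t + flat k.+2 t).
Proof.
have [t0|t0|->] := ltgtP t 0.
- rewrite !flat_le0 ?ltW// mulr0 addr0.
  apply: (@near_eq_is_derive _ _ _ (cst 0)).
  by near=> s; rewrite flat_le0// ltW//; near: s; exact: lt_nbhsl.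
- rewrite /flat t0.
  apply: (@near_eq_is_derive _ _ _ (fun s : R => s^-1 ^+ k * expR (- s^-1))).
    by near=> s; rewrite ifT//; near: s; exact: lt_nbhsr.
  have Hi : is_derive t 1 (fun s : R => s^-1) (- t^-1 ^+ 2).
    have := @is_deriveV _ (id : R -> R) t 1 1.
    by rewrite gt_eqF// => /(_ isT (is_derive_id _ _)); rewrite /GRing.scale/= mulr1 -exprVn.
  have He : is_derive t 1 (expR \o (fun s : R => - s^-1)) (expR (- t^-1) * (- - t^-1 ^+ 2)).
    by apply: is_derive1_comp; exact: is_deriveN.
  have fX (h : R -> R) n : h ^+ n = (fun s => h s ^+ n).
    elim: n => [|n IHn]; first by apply/funext => s; rewrite expr0.
    by apply/funext => s; rewrite exprS IHn fctE exprS.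
  have HM := is_deriveM (is_deriveX k Hi) He.
  rewrite (_ : (fun s => _) = (fun s : R => s^-1) ^+ k * (expR \o (fun s : R => - s^-1))); last first.
    by rewrite fX.
  apply: (is_derive_eq HM); rewrite !fX /GRing.scale/=.
  by case: k {HM} => [|k]; rewrite ?exprS ?expr0 /=; ring.
(* At 0 the difference quotient of [flat k] is [flat k.+1], which the linear bound squeezes to 0. *)
- rewrite !flat_le0// mulr0 addr0.
  have C : (fun h : R => h^-1 *: ((flat k \o shift 0) (h *: 1) - flat k 0)) @ 0^' --> (0 : R).
    apply: (@cvg_trans _ (flat k.+1 @ 0^')).
      apply: near_eq_cvg; near=> h.
      have h0 : h != 0 by near: h; exact: nbhs_dnbhs_neq.
      rewrite /= [h *: 1]mulr1 addr0 (flat_le0 k (lexx 0)) subr0 /flat; case: ifP => hp.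
        by rewrite exprS -mulrA.
      by rewrite scaler0.
    pose nf (h : R) : R := `|h|.
    have H0 : nf @ (0:R)^' --> (0 : R).
      by rewrite -[X in _ --> X](@normr0 R R); apply: cvg_norm; exact: cvg_within.
    have Hl : (k.+2`!%:R * nf h : R) @[h --> (0:R)^'] --> (k.+2`!%:R * 0 : R).
      exact: cvgMl_tmp.
    have Hn := cvgN Hl; rewrite mulr0 in Hl Hn; rewrite oppr0 in Hn.
    apply: (@squeeze_cvgr _ _ _ _ (fun h : R => - (k.+2`!%:R * nf h)) (fun h : R => k.+2`!%:R * nf h)) => //.
      by near=> h; rewrite -ler_norml; exact: flat_bound.
    exact: Hn.
  split; first by apply/cvg_ex; eexists; exact: C.
  exact/cvg_lim.
Unshelve. all: by end_near. Qed.

Lemma Cinf1_flat k : Cinf1 (flat k).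
Proof.
move=> n; elim: n k => [|n IH] k.
  split=> // x; have [d _] := is_derive_flat k x.
  exact/differentiable_continuous/derivable1_diffP.
apply: (@Cn_is_derive _ _ _ _ _ _ (fun _ x => - k%:R * flat k.+1 x + flat k.+2 x)).
- by move=> x; have [d _] := is_derive_flat k x; exact/differentiable_continuous/derivable1_diffP.
- by move=> _ x; exact: is_derive_flat.
- by move=> _; apply: CnD => //; apply: CnM => //; exact: Cn_cst.
Qed.

Definition cut (a d s : R) : R := flat 0 (d - s) / (flat 0 (d - s) + flat 0 (s - a)).

Lemma cut_den a d s : a < d -> 0 < flat 0 (d - s) + flat 0 (s - a).
Proof.
move=> ad; case: (ltP s d) => sd.
  by rewrite ltr_pwDl ?flat_ge0 ?flat_gt0// subr_gt0.
by rewrite ltr_wpDl ?flat_ge0 ?flat_gt0// subr_gt0 (lt_le_trans ad).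
Qed.

Lemma Cinf1_cut a d : a < d -> Cinf1 (cut a d).
Proof.
move=> ad.
have H1 : Cinf1 (fun s => flat 0 (d - s)).
  by apply: (@Cinf_comp _ _ _ _ (fun s => d - s)) (Cinf1_flat 0); apply: CinfB; [exact: Cinf_cst|exact: Cinf1_id].
have H2 : Cinf1 (fun s => flat 0 (s - a)).
  by apply: (@Cinf_comp _ _ _ _ (fun s => s - a)) (Cinf1_flat 0); apply: CinfB; [exact: Cinf1_id|exact: Cinf_cst].
apply: CinfM => //; apply: CinfV; last exact: CinfD.
by move=> x; rewrite gt_eqF// cut_den.
Qed.

Lemma cut01 a d s : a < d -> 0 <= cut a d s <= 1.
Proof.
move=> ad; apply/andP; split; first by apply: divr_ge0; rewrite ?flat_ge0// ltW// cut_den.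
by rewrite /cut ler_pdivrMr ?cut_den// mul1r lerDl flat_ge0.
Qed.

Lemma cut1 a d s : a < d -> s <= a -> cut a d s = 1.
Proof.
move=> ad sa; have := cut_den s ad; rewrite /cut (_ : flat 0 (s - a) = 0).
  by rewrite addr0 => h; rewrite divff// gt_eqF.
by rewrite flat_le0// subr_le0.
Qed.

Lemma cut_lt1 a d s : a < d -> a < s -> cut a d s < 1.
Proof.
move=> ad sa; rewrite /cut ltr_pdivrMr ?cut_den// mul1r ltrDl flat_gt0// subr_gt0//.
Qed.

Lemma cut0 a d s : d <= s -> cut a d s = 0.
Proof. by move=> ds; rewrite /cut flat_le0 ?mul0r// subr_le0. Qed.

(** Squares replace |t - c|, which is not smooth at c. *)
Definition cutx (c a d t : R) : R := cut (a ^+ 2) (d ^+ 2) ((t - c) ^+ 2).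

Lemma Cinf1_cutx c a d : 0 <= a -> a < d -> Cinf1 (cutx c a d).
Proof.
move=> a0 ad.
have H : Cinf1 (fun t => (t - c) ^+ 2).
  have H1 : Cinf1 (fun t => t - c) by apply: CinfB; [exact: Cinf1_id|exact: Cinf_cst].
  exact: (CinfM H1 H1).
by apply: Cinf_comp H _; apply: Cinf1_cut; rewrite ltr_sqr// ?nnegrE ltW// (le_lt_trans a0).
Qed.

Lemma cutx01 c a d t : 0 <= a -> a < d -> 0 <= cutx c a d t <= 1.
Proof. by move=> a0 ad; apply: cut01; rewrite ltr_sqr// ?nnegrE ltW// (le_lt_trans a0). Qed.

Lemma cutx1 c a d t : 0 <= a -> a < d -> `|t - c| <= a -> cutx c a d t = 1.
Proof.
move=> a0 ad ta; apply: cut1; first by rewrite ltr_sqr// ?nnegrE ltW// (le_lt_trans a0).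
by rewrite -real_normK ?num_real// ler_sqr ?nnegrE.
Qed.

(** Strictness right outside the plateau is what makes the positivity set of the cut function lose
    the box and nothing more. *)
Lemma cutx_lt1 c a d t : 0 <= a -> a < d -> a < `|t - c| -> cutx c a d t < 1.
Proof.
move=> a0 ad ta; apply: cut_lt1; first by rewrite ltr_sqr// ?nnegrE ltW// (le_lt_trans a0).
by rewrite -(real_normK (num_real (t - c))) ltr_sqr ?nnegrE.
Qed.

Lemma cutx0 c a d t : 0 <= d -> d <= `|t - c| -> cutx c a d t = 0.
Proof.
move=> d0 dt; apply: cut0.
by rewrite -(real_normK (num_real (t - c))) ler_sqr ?nnegrE.
Qed.

End cutoffs.

(** * Test functions and their derivatives *)

Section test_functions.
Context {R : realType}.
Implicit Types (Om : set (pt R)) (f g phi : pt R -> R).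

Definition rect (a b c d : R) : set (pt R) := `[a, b] `*` `[c, d].

Lemma compact_rect a b c d : compact (rect a b c d).
Proof. by apply: compact_setX; exact: segment_compact. Qed.

Lemma testfun_compact Om K f : Cinf (@dir R) f -> compact K -> K `<=` Om ->
  (forall x, ~ K x -> f x = 0) -> testfun Om f.
Proof.
move=> sf cK KO f0; split; first exact/smoothE.
have H : closure [set x | f x != 0] `<=` K.
  rewrite [X in _ `<=` X](iffLR (closure_id K)); last by apply: compact_closed => //; exact: norm_hausdorff.
  apply: closure_subset => x /= fx; apply: contrapT => /f0 /eqP.
  by rewrite (negbTE fx).
split; last exact: subset_trans KO.
by apply: subclosed_compact cK H; exact: closed_closure.
Qed.

Lemma testfun_Cinf Om phi : testfun Om phi -> Cinf (@dir R) phi.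
Proof. by case=> /smoothE. Qed.

Lemma testfun_supp Om phi : testfun Om phi ->
  exists K, [/\ compact K, K `<=` Om & forall x, ~ K x -> phi x = 0].
Proof.
move=> [_ [cK KO]]; exists (closure [set x | phi x != 0]); split=> // x Kx.
by apply/eqP; apply: contra_notT Kx => h; exact: subset_closure.
Qed.

Lemma testfunD Om f g : testfun Om f -> testfun Om g -> testfun Om (fun x => f x + g x).
Proof.
move=> Hf Hg; have [K [cK KO K0]] := testfun_supp Hf; have [L [cL LO L0]] := testfun_supp Hg.
apply: (@testfun_compact _ (K `|` L)).
- by apply: CinfD; [exact: testfun_Cinf Hf|exact: testfun_Cinf Hg].
- exact: compactU.
- by move=> x [/KO|/LO].
- by move=> x /not_orP[/K0 -> /L0 ->]; rewrite addr0.
Qed.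

Lemma testfunM Om f g : Cinf (@dir R) f -> testfun Om g -> testfun Om (fun x => f x * g x).
Proof.
move=> Hf Hg; have [L [cL LO L0]] := testfun_supp Hg.
apply: (@testfun_compact _ L) => //; first by apply: CinfM => //; exact: testfun_Cinf Hg.
by move=> x /L0 ->; rewrite mulr0.
Qed.

Lemma testfun_derive Om f b : testfun Om f -> testfun Om (fun x => 'D_(dir R b) f x).
Proof.
move=> Hf; have sf := testfun_Cinf Hf.
apply: (@testfun_compact _ (closure [set x | f x != 0])); [exact: Cinf_derive|by case: Hf => _ []|by case: Hf => _ []|].
move=> x Kx; rewrite -(derive_cst (0:R) x (dir R b)).
apply: near_eq_derive.
have : (~` closure [set x | f x != 0]) x by [].
rewrite -interiorC /interior /=; apply: filterS => y /=.
by move/negP; rewrite negbK => /eqP.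
Qed.

Lemma testfun0 Om : testfun Om (fun=> 0).
Proof.
apply: (@testfun_compact _ set0) => //; [exact: Cinf_cst|exact: compact0].
Qed.

Lemma testfunS Om1 Om2 f : Om1 `<=` Om2 -> testfun Om1 f -> testfun Om2 f.
Proof. by move=> H [? [? h]]; split=> //; split => //; exact: subset_trans H. Qed.

Lemma Cinf_prod (f1 f2 : R -> R) : Cinf1 f1 -> Cinf1 f2 -> Cinf (@dir R) (fun x => f1 x.1 * f2 x.2).
Proof.
move=> H1 H2; apply: CinfM.
  by apply: (@Cinf_comp _ _ _ _ fst f1) => //; exact: Cinf_fst.
by apply: (@Cinf_comp _ _ _ _ snd f2) => //; exact: Cinf_snd.
Qed.

Lemma derive_prod1 (f1 f2 : R -> R) (x : pt R) : Cinf1 f1 -> 'D_(dir R true) (fun x => f1 x.1 * f2 x.2) x = 'D_1 f1 x.1 * f2 x.2.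
Proof.
move=> H1.
have C : (fun h => h^-1 *: (((fun x : pt R => f1 x.1 * f2 x.2) \o shift x) (h *: dir R true) - f1 x.1 * f2 x.2)) @ 0^' --> ('D_1 f1 x.1 * f2 x.2).
  rewrite (_ : (fun h => _) = (fun h : R => (h^-1 *: ((f1 \o shift x.1) (h *: 1) - f1 x.1)) * f2 x.2)); last first.
    apply/funext => h /=; rewrite /dir/= scaler0 add0r -mulrBl.
    by rewrite /GRing.scale/= mulrA.
  apply: cvgMl; exact: (Cinf1_derivable (x:=x.1) H1).
exact/cvg_lim.
Qed.

Lemma derive_prod2 (f1 f2 : R -> R) (x : pt R) : Cinf1 f2 -> 'D_(dir R false) (fun x => f1 x.1 * f2 x.2) x = f1 x.1 * 'D_1 f2 x.2.
Proof.
move=> H1.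
have C : (fun h => h^-1 *: (((fun x : pt R => f1 x.1 * f2 x.2) \o shift x) (h *: dir R false) - f1 x.1 * f2 x.2)) @ 0^' --> (f1 x.1 * 'D_1 f2 x.2).
  rewrite (_ : (fun h => _) = (fun h : R => f1 x.1 * (h^-1 *: ((f2 \o shift x.2) (h *: 1) - f2 x.2)))); last first.
    apply/funext => h /=; rewrite /dir/= scaler0 add0r -mulrBr.
    by rewrite /GRing.scale/= mulrCA.
  apply: cvgMr; exact: (Cinf1_derivable (x:=x.2) H1).
exact/cvg_lim.
Qed.

Lemma deriveM_pt f g b x : Cinf (@dir R) f -> Cinf (@dir R) g ->
  'D_(dir R b) (fun x => f x * g x) x = f x * 'D_(dir R b) g x + g x * 'D_(dir R b) f x.
Proof.
move=> Hf Hg; rewrite (deriveM (Cinf_derivable Hf) (Cinf_derivable Hg)) //.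
Qed.

End test_functions.

Notation PT R := (measurableTypeR R * measurableTypeR R)%type.

(** * Integration in the plane *)

Section plane_measure.
Context {R : realType}.
Local Notation mu := (@lebesgue_measure R).
Local Notation leb := (@leb2 R).
Local Open Scope ereal_scope.

(** The plane carries the product sigma-algebra, so an open set is written as the countable union of
    the rational boxes it contains. *)
Lemma open_measurable_pt (A : set (pt R)) : open A -> measurable (A : set (PT R)).
Proof.
move=> oA.
pose I (q : rat * rat * rat * rat) : set (pt R) :=
  `](ratr q.1.1.1:R), ratr q.1.1.2[ `*` `](ratr q.1.2:R), ratr q.2[.
pose F (q : rat * rat * rat * rat) : set (pt R) := if `[< I q `<=` A >] then I q else set0.
rewrite (_ : A = \bigcup_q F q).
  apply: countable_bigcupT_measurable; first exact: countableP.
  move=> q; rewrite /F; case: asboolP => // _.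
  by apply: measurableX; exact: measurable_itv.
apply/seteqP; split=> [x Ax|x [q _]]; last by rewrite /F; case: asboolP => // h /h.
move: oA; rewrite openE => /(_ _ Ax); rewrite /interior -nbhs_ballE => -[e /= e0 He].
have H (t : R) : exists a b : rat, [/\ (t - e < ratr a)%R, (ratr a < t)%R, (t < ratr b)%R & (ratr b < t + e)%R].
  have ta : (t - e < t)%R by rewrite ltrBlDr ltrDl.
  have tb : (t < t + e)%R by rewrite ltrDl.
  have [a] := rat_in_itvoo ta; have [b] := rat_in_itvoo tb.
  by rewrite !in_itv/= => /andP[? ?] /andP[? ?]; exists a, b.
have [a1 [b1 [h1 h2 h3 h4]]] := H x.1; have [a2 [b2 [h5 h6 h7 h8]]] := H x.2.
exists (a1, b1, a2, b2) => //; rewrite /F; case: asboolP => [_|[]].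
  by split; rewrite /= in_itv/= ?h2 ?h3 ?h6 ?h7.
move=> y []; rewrite /= !in_itv/= => /andP[k1 k2] /andP[k3 k4]; apply: He.
by split; rewrite /ball/= ltr_norml; apply/andP; split; lra.
Qed.

Lemma continuous_measurable_pt (f : pt R -> R) : continuous f -> measurable_fun (setT : set (PT R)) f.
Proof.
move=> cf; apply: (measurability _ (RGenOpens.measurableE R)).
move=> _ [_ [a [b ->]] <-]; rewrite setTI; apply: open_measurable_pt.
by move/continuousP : cf; apply; exact: interval_open.
Qed.

Lemma leb2E (A B : set R) : measurable A -> measurable B -> leb (A `*` B) = mu A * mu B.
Proof. by move=> mA mB; rewrite /leb2 product_measure1E. Qed.

Lemma leb2_rect a b c d : (a <= b)%R -> (c <= d)%R -> leb (rect a b c d) = ((b - a) * (d - c))%:E.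
Proof.
move=> ab cd; rewrite /rect leb2E; [|exact: measurable_itv|exact: measurable_itv].
rewrite !lebesgue_measure_itv /= !lte_fin.
by case: ltP => ab'; case: ltP => cd' //=; rewrite -?EFinD -?EFinM ?mul0e ?mule0//; congr (_%:E); nra.
Qed.

Lemma measurable_rect a b c d : measurable (rect a b c d : set (PT R)).
Proof. by apply: measurableX; exact: measurable_itv. Qed.

Lemma leb2_rect_lty a b c d : leb (rect a b c d) < +oo.
Proof.
have [ab|ab] := leP a b; last first.
  rewrite (_ : rect a b c d = set0) /leb2; first by rewrite measure0 ltry.
  by apply/seteqP; split=> // x [] /=; rewrite !in_itv/= => /andP[? ?] /andP[? ?]; lra.
have [cd|cd] := leP c d; first by rewrite leb2_rect// ltry.
rewrite (_ : rect a b c d = set0) /leb2; first by rewrite measure0 ltry.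
by apply/seteqP; split=> // x [] /=; rewrite !in_itv/= => /andP[? ?] /andP[? ?]; lra.
Qed.

Lemma compact_measurable_pt (K : set (pt R)) : compact K -> measurable (K : set (PT R)).
Proof.
move=> cK; rewrite -(setCK K); apply: measurableC; apply: open_measurable_pt.
by apply: closed_openC; apply: compact_closed => //; exact: norm_hausdorff.
Qed.

Lemma compact_sub_rect (K : set (pt R)) : compact K -> exists2 M : R, (0 < M)%R & K `<=` rect (- M) M (- M) M.
Proof.
move=> /compact_bounded [N [Nr HN]].
exists (`|N| + 1)%R; first by rewrite ltr_wpDl.
move=> x Kx.
have := HN (`|N| + 1)%R; rewrite ltr_pwDr ?ler_norm// => /(_ isT x Kx).
have E : (`|x| = Num.max `|x.1| `|x.2|)%R by [].
rewrite /= E ge_max => /andP[h1 h2].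
by split; rewrite /= in_itv /= -ler_norml.
Qed.

Lemma bounded_integrable (A : set (PT R)) (f : pt R -> R) (C : R) :
  measurable A -> leb A < +oo -> measurable_fun A f -> (forall x, A x -> (`|f x| <= C)%R) ->
  leb.-integrable A (EFin \o f).
Proof.
move=> mA lA mf H; apply: measurable_bounded_integrable => //.
exists C; split; first by rewrite num_real.
by move=> M CM x Ax /=; apply: le_trans (H x Ax) _; exact: ltW.
Qed.

Lemma continuous_bound (K : set (pt R)) (f : pt R -> R) : compact K -> continuous f ->
  exists2 C : R, (0 <= C)%R & forall x, K x -> (`|f x| <= C)%R.
Proof.
move=> cK cf; have := @continuous_compact _ _ f K (continuous_subspaceT cf) cK.
move=> /compact_bounded [N [Nr HN]].
exists (`|N| + 1)%R; first by rewrite addr_ge0.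
move=> x Kx; have := HN (`|N| + 1)%R; rewrite ltr_pwDr ?ler_norm// => /(_ isT (f x)).
by apply; exists x.
Qed.

Lemma continuous_integrable_sub (f : pt R -> R) (A : set (pt R)) a b c d :
  continuous f -> measurable (A : set (PT R)) -> A `<=` rect a b c d -> leb.-integrable A (EFin \o f).
Proof.
move=> cf mA AR; have [C _ HC] := continuous_bound (@compact_rect _ a b c d) cf.
apply: (@bounded_integrable _ _ C) => //.
- apply: le_lt_trans (leb2_rect_lty a b c d); apply: le_measure => //; rewrite inE//; exact: measurable_rect.
- by apply: measurable_funTS; exact: continuous_measurable_pt.
- by move=> x /AR; exact: HC.
Qed.

Lemma continuous_integrable_compact (f : pt R -> R) (K : set (pt R)) :
  continuous f -> compact K -> leb.-integrable K (EFin \o f).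
Proof.
move=> cf cK; have [M _ KM] := compact_sub_rect cK.
by apply: continuous_integrable_sub KM => //; exact: compact_measurable_pt.
Qed.

(** Fubini with the first variable innermost, the order needed to integrate a derivative along it;
    [integral_rect_xy] serves the other direction. *)
Lemma integral_rect_yx (g : pt R -> R) a b c d : continuous g ->
  \int[leb]_(x in rect a b c d) (g x)%:E = \int[mu]_(y in `[c, d]) \int[mu]_(x in `[a, b]) (g (x, y))%:E.
Proof.
move=> cg; have ig := continuous_integrable_sub cg (measurable_rect a b c d) (@subset_refl _ _).
rewrite integral_mkcond.
have ig' : leb.-integrable setT ((EFin \o g) \_ (rect a b c d)).
  by apply: (@integrable_restrict _ _ _ _ _ (measurable_rect a b c d) _ measurableT _).1; rewrite setTI.
rewrite -(@integral21_prod_meas1 _ _ _ _ R mu mu _ ig').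
rewrite [RHS]integral_mkcond; apply: eq_integral => y _ /=.
rewrite /fubini_G patchE; case: ifPn => [/set_mem yc|yc].
  rewrite [RHS]integral_mkcond; apply: eq_integral => x _.
  rewrite !patchE; congr (if _ then _ else _).
  apply/idP/idP => [/set_mem[h1 h2]|/set_mem h]; apply/mem_set => //; by split.
apply: integral0_eq => x _; rewrite patchE memNset// => -[_ h].
by move/negP : yc; apply; exact/mem_set.
Qed.

Lemma integral_rect_xy (g : pt R -> R) a b c d : continuous g ->
  \int[leb]_(x in rect a b c d) (g x)%:E = \int[mu]_(x in `[a, b]) \int[mu]_(y in `[c, d]) (g (x, y))%:E.
Proof.
move=> cg; have ig := continuous_integrable_sub cg (measurable_rect a b c d) (@subset_refl _ _).
rewrite integral_mkcond.
have ig' : leb.-integrable setT ((EFin \o g) \_ (rect a b c d)).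
  by apply: (@integrable_restrict _ _ _ _ _ (measurable_rect a b c d) _ measurableT _).1; rewrite setTI.
rewrite -(@integral12_prod_meas1 _ _ _ _ R mu mu _ ig').
rewrite [RHS]integral_mkcond; apply: eq_integral => y _ /=.
rewrite /fubini_F patchE; case: ifPn => [/set_mem yc|yc].
  rewrite [RHS]integral_mkcond; apply: eq_integral => x _.
  rewrite !patchE; congr (if _ then _ else _).
  apply/idP/idP => [/set_mem[h1 h2]|/set_mem h]; apply/mem_set => //; by split.
apply: integral0_eq => x _; rewrite patchE memNset// => -[h _].
by move/negP : yc; apply; exact/mem_set.
Qed.

Lemma integral_derive1 (F f : R -> R) a b : (a <= b)%R -> continuous f ->
  (forall x, is_derive x (1:R)%R F (f x)) ->
  \int[mu]_(x in `[a, b]) (f x)%:E = (F b - F a)%:E.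
Proof.
rewrite le_eqVlt => /predU1P[->|ab] cf dF.
  by rewrite set_itv1 integral_set1 subrr.
have cF x : {for x, continuous F}.
  by have [d _] := dF x; exact/differentiable_continuous/derivable1_diffP.
rewrite (@continuous_FTC2 _ f F)//.
- exact: continuous_subspaceT.
- split=> [x _||]; first by have [] := dF x.
  + by apply: cvg_at_right_filter; exact: cF.
  + by apply: cvg_at_left_filter; exact: cF.
- by move=> x _; rewrite derive1E; have [] := dF x.
Qed.

Lemma is_derive_slice1 (f : pt R -> R) (x y df : R) :
  is_derive (x, y) (dir R true) f df -> is_derive x (1:R)%R (fun t => f (t, y)) df.
Proof.
have E : (fun h : R => (h^-1 *: ((f \o shift (x, y)) (h *: dir R true) - f (x, y)))%R) =
  (fun h : R => (h^-1 *: (((fun t => f (t, y)) \o shift x) (h *: (1:R)) - f (x, y)))%R).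
  apply/funext => h /=; congr (_ *: (f _ - _))%R.
  by rewrite -[LHS]/(h *: 1 + x, h *: 0 + y)%R scaler0 add0r.
by move=> [d v]; split; [rewrite /derivable -E|rewrite /derive -E].
Qed.

Lemma is_derive_slice2 (f : pt R -> R) (x y df : R) :
  is_derive (x, y) (dir R false) f df -> is_derive y (1:R)%R (fun t => f (x, t)) df.
Proof.
have E : (fun h : R => (h^-1 *: ((f \o shift (x, y)) (h *: dir R false) - f (x, y)))%R) =
  (fun h : R => (h^-1 *: (((fun t => f (x, t)) \o shift y) (h *: (1:R)) - f (x, y)))%R).
  apply/funext => h /=; congr (_ *: (f _ - _))%R.
  by rewrite -[LHS]/(h *: 0 + x, h *: 1 + y)%R scaler0 add0r.
by move=> [d v]; split; [rewrite /derivable -E|rewrite /derive -E].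
Qed.

Lemma slice1_continuous (g : pt R -> R) y : continuous g -> continuous (fun x => g (x, y)).
Proof.
move=> cg x; apply: (@continuous_comp _ _ _ (fun x : R => (x, y) : pt R) g); last exact: cg.
apply/cvg_ballP => e e0; exists e => //= t xt; split => //=; exact: ballxx.
Qed.

Lemma slice2_continuous (g : pt R -> R) x : continuous g -> continuous (fun y => g (x, y)).
Proof.
move=> cg y; apply: (@continuous_comp _ _ _ (fun y : R => (x, y) : pt R) g); last exact: cg.
apply/cvg_ballP => e e0; exists e => //= t xt; split => //=; exact: ballxx.
Qed.

Lemma rect_FTC1 (f : pt R -> R) a b c d : Cinf (@dir R) f -> (a <= b)%R ->
  \int[leb]_(x in rect a b c d) ('D_(dir R true) f x)%:E =
  \int[mu]_(y in `[c, d]) (f (b, y) - f (a, y))%:E.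
Proof.
move=> sf ab; have cg : continuous (fun x => 'D_(dir R true) f x) by apply: Cinf_continuous (Cinf_derive true sf).
rewrite integral_rect_yx//; apply: eq_integral => y _.
apply: (@integral_derive1 (fun x => f (x, y)) (fun x => 'D_(dir R true) f (x, y))) => //.
  exact: (slice1_continuous (g := fun x => 'D_(dir R true) f x)).
by move=> x; apply: is_derive_slice1; apply: derivableP; exact: Cinf_derivable.
Qed.

Lemma rect_FTC2 (f : pt R -> R) a b c d : Cinf (@dir R) f -> (c <= d)%R ->
  \int[leb]_(x in rect a b c d) ('D_(dir R false) f x)%:E =
  \int[mu]_(x in `[a, b]) (f (x, d) - f (x, c))%:E.
Proof.
move=> sf ab; have cg : continuous (fun x => 'D_(dir R false) f x) by apply: Cinf_continuous (Cinf_derive false sf).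
rewrite integral_rect_xy//; apply: eq_integral => x _.
apply: (@integral_derive1 (fun y => f (x, y)) (fun y => 'D_(dir R false) f (x, y))) => //.
  exact: (slice2_continuous (g := fun x => 'D_(dir R false) f x)).
by move=> y; apply: is_derive_slice2; apply: derivableP; exact: Cinf_derivable.
Qed.

Lemma integral_supp (Om : set (pt R)) (K : set (pt R)) (f : pt R -> \bar R) :
  (forall x, ~ K x -> f x = 0) -> K `<=` Om ->
  \int[leb]_(x in Om) f x = \int[leb]_(x in K) f x.
Proof.
move=> f0 KO; rewrite integral_mkcond [RHS]integral_mkcond; apply: eq_integral => x _.
rewrite !patchE; case: ifPn => xO; case: ifPn => xK //.
  by rewrite f0// => Kx; move/negP: xK; apply; exact: mem_set.
by move/negP: xO => []; apply/mem_set/KO/set_mem.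
Qed.

Lemma testfun_rect Om (f : pt R -> R) : testfun Om f -> exists M : R, [/\ (0 < M)%R,
  forall x, ~ rect (- M) M (- M) M x -> f x = 0%R, forall y, f (M, y) = 0%R /\ f (- M, y)%R = 0%R &
  forall x, f (x, M) = 0%R /\ f (x, - M)%R = 0%R].
Proof.
move=> tf; have [K [cK KO K0]] := testfun_supp tf; have [M M0 KM] := compact_sub_rect cK.
have H x : ~ rect (- M) M (- M) M x -> f x = 0%R by move=> h; apply: K0 => /KM.
(* One unit of margin makes the function vanish on the sides of the square, not only outside it. *)
exists (M + 1)%R; split.
- by rewrite addr_gt0.
- move=> x h; apply: H => -[]; rewrite /= !in_itv/= => /andP[? ?] /andP[? ?]; apply: h; split; rewrite /= in_itv/=; apply/andP; split; lra.
- by move=> y; split; apply: H => -[]; rewrite /= !in_itv/= => /andP[? ?] /andP[? ?]; lra.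
- by move=> y; split; apply: H => -[]; rewrite /= !in_itv/= => /andP[? ?] /andP[? ?]; lra.
Qed.

Lemma integral_derive_testfun Om (f : pt R -> R) b : testfun Om f ->
  \int[leb]_(x in Om) ('D_(dir R b) f x)%:E = 0.
Proof.
move=> tf; have sf := testfun_Cinf tf.
have [M [M0 f0 f1 f2]] := testfun_rect tf.
have [K [cK KO K0]] := testfun_supp (testfun_derive b tf).
have E : \int[leb]_(x in Om) ('D_(dir R b) f x)%:E = \int[leb]_(x in setT) ('D_(dir R b) f x)%:E.
  rewrite (@integral_supp _ K) => [|x /K0 -> //|//].
  by rewrite [RHS](@integral_supp _ K) => [|x /K0 -> //|//].
have tT : testfun setT f by apply: testfunS tf.
have [K' [_ _ K'0]] := testfun_supp (testfun_derive b tT).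
have [N [N0 g0 g1 g2]] := testfun_rect (testfun_derive b tT).
(* The function and its derivative come with different squares; on the larger one the boundary terms
   of the fundamental theorem vanish. *)
pose L := Num.max M N.
have fL x : ~ rect (- L) L (- L) L x -> ('D_(dir R b) f x)%:E = 0.
  move=> h; rewrite g0// => -[]; rewrite /= !in_itv/= => /andP[? ?] /andP[? ?].
  have NL : (N <= L)%R by rewrite le_max lexx orbT.
  by apply: h; split; rewrite /= in_itv/=; apply/andP; split; lra.
have fb (x : pt R) : ((L < `|x.1|) \/ (L < `|x.2|) \/ (`|x.1| = L) \/ (`|x.2| = L))%R -> f x = 0%R.
  have ML : (M <= L)%R by rewrite le_max lexx.
  move=> h; have [hM|hM] := eqVneq L M; last first.
    apply: f0 => -[]; rewrite /= !in_itv/= -!ler_norml => h1 h2.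
    have MlL : (M < L)%R by rewrite lt_neqAle eq_sym hM.
    by case: h => [|[|[|]]] h; lra.
  case: h => [|[|[|]]] h.
  - by apply: f0 => -[]; rewrite /= !in_itv/= -!ler_norml => h1 h2; lra.
  - by apply: f0 => -[]; rewrite /= !in_itv/= -!ler_norml => h1 h2; lra.
  - case: x h => x1 x2 /= h; have [x0|x0] := leP 0%R x1.
      by rewrite (_ : x1 = M) ?(f1 _).1//; rewrite ger0_norm// in h; lra.
    by rewrite (_ : x1 = - M)%R ?(f1 _).2//; rewrite ltr0_norm// in h; lra.
  - case: x h => x1 x2 /= h; have [x0|x0] := leP 0%R x2.
      by rewrite (_ : x2 = M) ?(f2 _).1//; rewrite ger0_norm// in h; lra.
    by rewrite (_ : x2 = - M)%R ?(f2 _).2//; rewrite ltr0_norm// in h; lra.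
have L0 : (0 < L)%R by rewrite lt_max M0.
rewrite E (@integral_supp _ (rect (- L) L (- L) L))//.
have LL : (- L <= L)%R by lra.
case: b {E K'0 g0 g1 g2 fL K0} => [|]; [rewrite rect_FTC1//|rewrite rect_FTC2//].
  by apply: integral0_eq => y _; rewrite !fb ?subrr//=; right; right; left; rewrite ?normrN gtr0_norm.
by apply: integral0_eq => y _; rewrite !fb ?subrr//=; right; right; right; rewrite ?normrN gtr0_norm.
Qed.

Lemma testfun_integrable (Om : set (pt R)) (f : pt R -> R) : testfun Om f -> measurable (Om : set (PT R)) -> leb.-integrable Om (EFin \o f).
Proof.
move=> tf mO; have [K [cK KO K0]] := testfun_supp tf.
have mK := compact_measurable_pt cK.
have ik := continuous_integrable_compact (Cinf_continuous (testfun_Cinf tf)) cK.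
rewrite (_ : EFin \o f = (EFin \o f) \_ K).
  by apply: (@integrable_restrict _ _ _ _ _ mK _ mO _).1; rewrite setIidr.
apply/funext => x; rewrite patchE; case: ifPn => // /negP xK.
by rewrite /= K0// => Kx; apply: xK; exact: mem_set.
Qed.

(** The product of f and phi is again a test function, so the integral of its derivative is 0; the
    product rule does the rest. *)
Lemma integral_by_parts_testfun (Om : set (pt R)) (f phi : pt R -> R) b : measurable (Om : set (PT R)) ->
  Cinf (@dir R) f -> testfun Om phi ->
  \int[leb]_(x in Om) (f x * 'D_(dir R b) phi x)%:E =
  - \int[leb]_(x in Om) ('D_(dir R b) f x * phi x)%:E.
Proof.
move=> mO sf tp; have := integral_derive_testfun b (testfunM sf tp).
have sp := testfun_Cinf tp.
under eq_integral do rewrite deriveM_pt//.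
have i1 := testfun_integrable (testfunM sf (testfun_derive b tp)) mO.
have i2 := testfun_integrable (testfunM (Cinf_derive b sf) tp) mO.
under eq_integral do rewrite [X in (_ + X)%R]mulrC EFinD.
rewrite integralD//.
have f1 := integrable_fin_num mO i1; have f2 := integrable_fin_num mO i2.
rewrite -(fineK f1) -(fineK f2) => -[h]; rewrite -EFinN; congr (_%:E); lra.
Qed.

End plane_measure.

(** * Real-valued integrals over planar sets *)

Section integrable_calculus.
Context {R : realType}.
Local Notation leb := (@leb2 R).

(** Integrals are handled as real numbers, with integrability as a separate side condition, so that
    estimates can be closed by linear arithmetic instead of extended-real reasoning. *)
Definition ok (A : set (PT R)) (f : pt R -> R) : Prop := leb.-integrable A (EFin \o f).
Definition I (A : set (PT R)) (f : pt R -> R) : R := \int[leb]_(x in A) f x.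

Variable (A : set (PT R)).
Hypothesis mA : measurable A.
Implicit Types f g : pt R -> R.

Lemma okD f g : ok A f -> ok A g -> ok A (fun x => f x + g x).
Proof. by move=> h1 h2; have := @integrableD _ _ _ _ _ mA _ _ h1 h2. Qed.

Lemma okZ c f : ok A f -> ok A (fun x => c * f x).
Proof. by move=> h; have := @integrableZl _ _ _ _ _ mA c _ h. Qed.

Lemma okN f : ok A f -> ok A (fun x => - f x).
Proof. by move=> h; have := @integrableN _ _ _ _ _ _ h. Qed.

Lemma okB f g : ok A f -> ok A g -> ok A (fun x => f x - g x).
Proof. by move=> h1 h2; apply: okD => //; exact: okN. Qed.

Lemma ok_le f g : measurable_fun A f -> (forall x, A x -> `|f x| <= g x) -> ok A g -> ok A f.
Proof.
move=> mf h; apply: le_integrable => //; first exact/measurable_EFinP.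
by move=> x Ax; rewrite /= lee_fin (le_trans (h x Ax)) ?ler_norm.
Qed.

Lemma ok_ge0 f : measurable_fun A f -> (forall x, A x -> 0 <= f x) ->
  (\int[leb]_(x in A) (f x)%:E < +oo)%E -> ok A f.
Proof.
move=> mf f0 h; apply/integrableP; split; first exact/measurable_EFinP.
suff -> : (\int[leb]_(x in A) `|(EFin \o f) x| = \int[leb]_(x in A) (f x)%:E)%E by [].
by apply: eq_integral => x /set_mem Ax; rewrite /= ger0_norm// f0.
Qed.

Lemma EFin_I f : ok A f -> (\int[leb]_(x in A) (f x)%:E)%E = (I A f)%:E.
Proof. by move=> h; rewrite /I /Rintegral fineK//; exact: (integrable_fin_num mA h). Qed.

Lemma ID f g : ok A f -> ok A g -> I A (fun x => f x + g x) = I A f + I A g.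
Proof. exact: (RintegralD mA). Qed.

Lemma IB f g : ok A f -> ok A g -> I A (fun x => f x - g x) = I A f - I A g.
Proof. exact: (RintegralB mA). Qed.

Lemma IZ c f : ok A f -> I A (fun x => c * f x) = c * I A f.
Proof. exact: (RintegralZl c mA). Qed.

Lemma eq_I f g : (forall x, A x -> f x = g x) -> I A f = I A g.
Proof. by move=> h; apply: eq_Rintegral => x /set_mem; exact: h. Qed.

Lemma I_le f g : ok A f -> ok A g -> (forall x, A x -> f x <= g x) -> I A f <= I A g.
Proof. exact: (le_Rintegral mA). Qed.

Lemma I_ge0 f : (forall x, A x -> 0 <= f x) -> 0 <= I A f.
Proof. exact: Rintegral_ge0. Qed.

Lemma okS (B : set (PT R)) f : measurable B -> B `<=` A -> ok A f -> ok B f.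
Proof. by move=> mB BA; exact: integrableS. Qed.

Lemma I_null f : leb A = 0%E -> ok A f -> I A f = 0.
Proof.
move=> A0 oA; suff : (\int[leb]_(x in A) (f x)%:E = 0)%E by rewrite EFin_I// => -[].
by apply: null_set_integral => //; exact: measurable_int oA.
Qed.

Lemma I_setU (B : set (PT R)) f : measurable B -> [disjoint A & B] -> ok (A `|` B) f ->
  I (A `|` B) f = I A f + I B f.
Proof. by move=> mB dAB o; exact: Rintegral_setU. Qed.

Lemma I_abs_le f g : ok A f -> ok A g -> (forall x, A x -> `|f x| <= g x) -> `|I A f| <= I A g.
Proof.
move=> h1 h2 fg; have E : - I A g = I A (fun x => -1 * g x) by rewrite IZ// mulN1r.
rewrite ler_norml E; apply/andP; split.
  apply: (I_le (okZ (-1) h2) h1) => x /fg.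
  by rewrite ler_norml mulN1r => /andP[].
by apply: (I_le h1 h2) => x /fg; rewrite ler_norml => /andP[].
Qed.

End integrable_calculus.

Section integrable_subset.
Context {R : realType}.
Local Notation leb := (@leb2 R).
Implicit Types (A B : set (PT R)) (f : pt R -> R).

Lemma I_subset_null A B f : measurable A -> measurable B -> A `<=` B -> leb (B `\` A) = 0%E ->
  ok B f -> I B f = I A f.
Proof.
move=> mA mB AB BA0 oB; have mD := measurableD mB mA.
have E : B = A `|` (B `\` A) by rewrite setDUK.
rewrite E I_setU//; last 2 first.
- by rewrite disj_set2E setDIK.
- by rewrite -E.
by rewrite (I_null mD) ?addr0//; exact: (okS mB mD _ oB).
Qed.

Lemma I_setI_sub A B f : (forall x, A x -> ~ B x -> f x = 0) -> B `<=` A -> I A f = I B f.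
Proof.
move=> h BA; rewrite /I Rintegral_mkcond [RHS]Rintegral_mkcond; apply: eq_Rintegral => x _.
rewrite !patchE; case: ifPn => xA; case: ifPn => // xB.
  by apply: h; [exact: set_mem|move/negP : xB => h1 /mem_set].
by move/negP : xA => []; apply/mem_set/BA/set_mem.
Qed.

Lemma I_restrict A B f : I (A `&` B) f = I A (f \_ B).
Proof. by rewrite /I Rintegral_mkcondr. Qed.

Lemma ok_restrict A B f : measurable A -> measurable B -> ok A f -> ok A (f \_ B).
Proof.
move=> mA mB o; rewrite /ok -restrict_EFin.
apply: (@integrable_restrict _ _ _ _ _ mB _ mA _).1.
by apply: (okS mA) o; [exact: measurableI|exact: subIsetl].
Qed.

Lemma leb2_vline a c d : leb (rect a a c d) = 0%E.
Proof.
have [cd|cd] := leP c d; first by rewrite leb2_rect// subrr mul0r.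
rewrite (_ : rect a a c d = set0) /leb2 ?measure0//.
by apply/seteqP; split=> // x [] /=; rewrite !in_itv/= => /andP[? ?] /andP[? ?]; lra.
Qed.

Lemma leb2_sub0 A B : measurable A -> measurable B -> A `<=` B -> leb B = 0%E -> leb A = 0%E.
Proof.
move=> mA mB AB B0; apply/eqP; rewrite eq_le -{1}B0 /leb2 measure_ge0 andbT.
by apply: le_measure; rewrite ?inE.
Qed.

Lemma leb2_U0 A B : measurable A -> measurable B -> leb A = 0%E -> leb B = 0%E -> leb (A `|` B) = 0%E.
Proof.
move=> mA mB A0 B0; apply/eqP; rewrite eq_le /leb2 measure_ge0 andbT.
apply: le_trans (measureU2 _ mA mB) _.
by rewrite [X in (X + _)%E]A0 [X in (_ + X)%E]B0 adde0.
Qed.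

End integrable_subset.

(** * Integrals over segments, and derivatives integrated over rectangles *)

Section line_integrals.
Context {R : realType}.
Local Notation mu := (@lebesgue_measure R).
Local Notation leb := (@leb2 R).
Implicit Types (a b c d : R) (f g : R -> R).

Definition J a b f : R := \int[mu]_(x in `[a, b]) f x.

Lemma J_ok a b f : continuous f -> mu.-integrable `[a, b] (EFin \o f).
Proof.
by move=> cf; apply: continuous_compact_integrable; [exact: segment_compact|exact: continuous_subspaceT].
Qed.

Lemma EFin_J a b f : continuous f -> (\int[mu]_(x in `[a, b]) (f x)%:E)%E = (J a b f)%:E.
Proof.
by move=> cf; rewrite /J /Rintegral fineK//; exact: (integrable_fin_num _ (J_ok a b cf)).
Qed.

Lemma J_le a b f g : continuous f -> continuous g -> (forall x, a <= x <= b -> f x <= g x) -> J a b f <= J a b g.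
Proof.
move=> cf cg fg; apply: le_Rintegral; [exact: measurable_itv|exact: J_ok|exact: J_ok|].
by move=> x /=; rewrite in_itv/=; exact: fg.
Qed.

Lemma J_cst a b c : a <= b -> J a b (fun=> c) = c * (b - a).
Proof.
move=> ab; rewrite /J Rintegral_cst; last exact: measurable_itv.
have E : mu `[a, b]%classic = (b - a)%:E.
  rewrite lebesgue_measure_itv/= lte_fin; case: ltP => //= h.
  by have -> : a = b; [apply/eqP; rewrite eq_le ab h|rewrite subrr].
by congr (_ * _); rewrite -[RHS]/(fine (b - a)%:E) -E.
Qed.

Lemma JD a b f g : continuous f -> continuous g -> J a b (fun x => f x + g x) = J a b f + J a b g.
Proof. by move=> cf cg; apply: RintegralD; [exact: measurable_itv|exact: J_ok..]. Qed.

Lemma JZ a b c f : continuous f -> J a b (fun x => c * f x) = c * J a b f.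
Proof. by move=> cf; apply: RintegralZl; [exact: measurable_itv|exact: J_ok]. Qed.

Lemma J_abs_le a b c f : a <= b -> continuous f -> (forall x, a <= x <= b -> `|f x| <= c) -> J a b f <= c * (b - a).
Proof.
move=> ab cf h; rewrite -J_cst//; apply: J_le => //; first by move=> x; exact: cvg_cst.
by move=> x /h; rewrite ler_norml => /andP[].
Qed.

Lemma J_subset a b a' b' f : continuous f -> a <= a' -> b' <= b -> (forall x, 0 <= f x) -> J a' b' f <= J a b f.
Proof.
move=> cf aa bb f0; rewrite -lee_fin -!EFin_J//; apply: ge0_subset_integral; do ?exact: measurable_itv.
- by apply/measurable_EFinP/measurable_funTS; exact: continuous_measurable_fun.
- by move=> x _; rewrite lee_fin.
- by move=> x /=; rewrite !in_itv/= => /andP[? ?]; apply/andP; split; lra.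
Qed.

Lemma slice1_Dp (f : pt R -> R) (t : R) : Cinf (@dir R) f -> continuous (fun y => f (t, y)).
Proof. by move=> sf; apply: slice2_continuous; exact: Cinf_continuous sf. Qed.

Lemma slice2_Dp (f : pt R -> R) (t : R) : Cinf (@dir R) f -> continuous (fun y => f (y, t)).
Proof. by move=> sf; apply: slice1_continuous; exact: Cinf_continuous sf. Qed.

Lemma continuous_ok_rect a b c d (f : pt R -> R) : continuous f -> ok (rect a b c d) f.
Proof. by move=> cf; apply: continuous_integrable_sub (@subset_refl _ _) => //; exact: measurable_rect. Qed.

Lemma I_rect_D1 (f : pt R -> R) a b c d : Cinf (@dir R) f -> a <= b ->
  I (rect a b c d) (fun x => 'D_(dir R true) f x) = J c d (fun y => f (b, y) - f (a, y)).
Proof.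
move=> sf ab; have c1 : continuous (fun y => f (b, y) - f (a, y)).
  by move=> y; apply: cvgB; exact: slice1_Dp.
have := rect_FTC1 c d sf ab; rewrite EFin_J// EFin_I; last 2 first.
- exact: measurable_rect.
- apply: continuous_ok_rect; exact: Cinf_continuous (Cinf_derive true sf).
by case.
Qed.

Lemma I_rect_D2 (f : pt R -> R) a b c d : Cinf (@dir R) f -> c <= d ->
  I (rect a b c d) (fun x => 'D_(dir R false) f x) = J a b (fun x => f (x, d) - f (x, c)).
Proof.
move=> sf ab; have c1 : continuous (fun y => f (y, d) - f (y, c)).
  by move=> y; apply: cvgB; exact: slice2_Dp.
have := rect_FTC2 a b sf ab; rewrite EFin_J// EFin_I; last 2 first.
- exact: measurable_rect.
- apply: continuous_ok_rect; exact: Cinf_continuous (Cinf_derive false sf).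
by case.
Qed.

End line_integrals.

(** * Balls, their exhaustion by disks, weak gradients *)

Section balls.
Context {R : realType}.
Local Notation leb := (@leb2 R).
Implicit Types (r : R) (f : pt R -> R).

Definition q2 (x : pt R) : R := x.1 ^+ 2 + x.2 ^+ 2.

Lemma Cinf_q2 : Cinf (@dir R) q2.
Proof. by apply: CinfD; apply: CinfM; do ?exact: Cinf_fst; exact: Cinf_snd. Qed.

Lemma q2_ge0 x : 0 <= q2 x.
Proof. by rewrite addr_ge0 ?sqr_ge0. Qed.

Lemma enorm_sqr (x : pt R) : enorm x ^+ 2 = q2 x.
Proof. by rewrite /enorm sqr_sqrtr// q2_ge0. Qed.

Lemma enorm_ge0 (x : pt R) : 0 <= enorm x. Proof. exact: sqrtr_ge0. Qed.

Lemma enorm_lt (x : pt R) r : 0 <= r -> (enorm x < r) = (q2 x < r ^+ 2).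
Proof. by move=> r0; rewrite -enorm_sqr ltr_sqr ?nnegrE ?enorm_ge0. Qed.

Lemma enorm_le (x : pt R) r : 0 <= r -> (enorm x <= r) = (q2 x <= r ^+ 2).
Proof. by move=> r0; rewrite -enorm_sqr ler_sqr ?nnegrE ?enorm_ge0. Qed.

Lemma BallE r : 0 <= r -> Ball r = [set x | q2 x < r ^+ 2].
Proof. by move=> r0; apply/funext => x /=; rewrite /Ball/= enorm_lt. Qed.

Lemma Ball_open r : 0 <= r -> open (Ball r).
Proof.
move=> r0; rewrite BallE//.
rewrite (_ : [set x | _] = q2 @^-1` `]-oo, r ^+ 2[%classic); last first.
  by apply/seteqP; split=> x /=; rewrite in_itv.
by have /continuousP := Cinf_continuous Cinf_q2; apply; exact: interval_open.
Qed.

Lemma measurable_Ball r : 0 <= r -> measurable (Ball r : set (PT R)).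
Proof. by move=> r0; apply: open_measurable_pt; exact: Ball_open. Qed.

Lemma Ball_rect r : 0 <= r -> Ball r `<=` rect (- r) r (- r) r.
Proof.
move=> r0 x; rewrite BallE// /q2 => /= h; split; rewrite /= in_itv/=; apply/andP; split; nra.
Qed.

Lemma rect_Ball a b r : 0 <= r -> 0 <= a -> 0 <= b -> a ^+ 2 + b ^+ 2 < r ^+ 2 -> rect (- a) a (- b) b `<=` Ball r.
Proof.
move=> r0 a0 b0 ab x []; rewrite BallE//= !in_itv/= /q2 => /andP[? ?] /andP[? ?].
by apply: le_lt_trans ab; nra.
Qed.

Definition disk (s : R) : set (pt R) := [set x | q2 x <= s].

Lemma compact_disk s : compact (disk s).
Proof.
(* The half-side 1 + s^2 bounds each coordinate through |t| <= (1 + t^2) / 2, with neither a square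
   root nor a sign condition on s. *)
apply: (@subclosed_compact _ _ (rect (- (1 + s ^+ 2)) (1 + s ^+ 2) (- (1 + s ^+ 2)) (1 + s ^+ 2))).
- rewrite (_ : disk s = q2 @^-1` `]-oo, s]%classic); last first.
    by apply/seteqP; split=> x /=; rewrite /disk/= in_itv.
  have /continuous_closedP := Cinf_continuous Cinf_q2; apply; exact: interval_closed.
- exact: compact_rect.
- move=> x; rewrite /disk/= /q2 => h.
  have := (sqr_ge0 (x.1 - 1), sqr_ge0 (x.1 + 1), sqr_ge0 (x.2 - 1), sqr_ge0 (x.2 + 1), sqr_ge0 (s - 1)).
  have := (sqr_ge0 x.1, sqr_ge0 x.2).
  by move=> [? ?] [[[[? ?] ?] ?] ?]; split; rewrite /= in_itv/=; apply/andP; split; nra.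
Qed.

Lemma Ball_bigcup r : 0 < r -> Ball r = \bigcup_n disk (r ^+ 2 - n.+1%:R^-1).
Proof.
move=> r0; rewrite BallE ?ltW//; apply/seteqP; split=> [x /= h|x [n _]].
  have d0 : 0 < r ^+ 2 - q2 x by rewrite subr_gt0.
  have [n _ hn] := (near_infty_natSinv_lt (PosNum d0)).
  exists n => //; rewrite /disk /=.
  have hn' : n.+1%:R^-1 < r ^+ 2 - q2 x := hn n (leqnn n).
  by rewrite lerBrDr addrC -lerBrDr ltW.
rewrite /disk/= => h; apply: (le_lt_trans h).
by rewrite ltrBlDr ltrDl invr_gt0.
Qed.

(** Local integrability speaks of compact sets only; the closed disks exhaust the open ball
    countably and carry measurability over to it. *)
Lemma loc_int_measurable r f : 0 < r -> loc_int (Ball r) f -> measurable_fun (Ball r : set (PT R)) f.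
Proof.
move=> r0 h; rewrite Ball_bigcup//.
have mD n : measurable (disk (r ^+ 2 - n.+1%:R^-1) : set (PT R)).
  by apply: compact_measurable_pt; exact: compact_disk.
apply/measurable_fun_bigcup => // n.
have hs : disk (r ^+ 2 - n.+1%:R^-1) `<=` Ball r by rewrite Ball_bigcup// => x; exists n.
by have /integrableP[/measurable_EFinP] := h _ (@compact_disk _) hs.
Qed.

Lemma loc_int_mul (Om : set (pt R)) f psi : measurable (Om : set (PT R)) -> loc_int Om f -> testfun Om psi ->
  ok Om (fun x => f x * psi x).
Proof.
move=> mO lf tp; have [K [cK KO K0]] := testfun_supp tp.
have mK := compact_measurable_pt cK.
have cp := Cinf_continuous (testfun_Cinf tp).
have [C C0 HC] := continuous_bound cK cp.
have ik : ok K (fun x => f x * psi x).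
  apply: (@integrableMl _ _ _ _ _ mK _ psi (lf K cK KO)).
    by apply: measurable_funTS; exact: continuous_measurable_pt.
  exists C; split; first by rewrite num_real.
  by move=> M CM x Kx /=; apply: le_trans (HC x Kx) _; exact: ltW.
rewrite /ok (_ : EFin \o _ = (EFin \o (fun x => f x * psi x)) \_ K).
  by apply: (@integrable_restrict _ _ _ _ _ mK _ mO _).1; rewrite setIidr.
apply/funext => x; rewrite patchE; case: ifPn => // /negP xK.
by rewrite /= K0 ?mulr0// => Kx; apply: xK; exact: mem_set.
Qed.

Lemma ok_testfun (Om : set (pt R)) psi : measurable (Om : set (PT R)) -> testfun Om psi -> ok Om psi.
Proof. by move=> mO tp; exact: testfun_integrable. Qed.

Lemma ok0 (Om : set (pt R)) : ok Om (fun=> 0).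
Proof. exact: integrable0. Qed.

Lemma loc_int_continuous (Om : set (pt R)) f : continuous f -> loc_int Om f.
Proof. by move=> cf K cK _; exact: continuous_integrable_compact. Qed.

Definition Dp (b : bool) f (x : pt R) : R := 'D_(dir R b) f x.

Lemma DpE b f x : 'D_(dir R b) f x = Dp b f x.
Proof. by []. Qed.

Lemma I_rect_Dp1 (f : pt R -> R) a b c d : Cinf (@dir R) f -> a <= b ->
  I (rect a b c d) (Dp true f) = J c d (fun y => f (b, y) - f (a, y)).
Proof. exact: I_rect_D1. Qed.

Lemma I_rect_Dp2 (f : pt R -> R) a b c d : Cinf (@dir R) f -> c <= d ->
  I (rect a b c d) (Dp false f) = J a b (fun x => f (x, d) - f (x, c)).
Proof. exact: I_rect_D2. Qed.

Lemma Dp_cst b (c : R) x : Dp b (fun _ : pt R => c) x = 0.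
Proof. exact: derive_cst. Qed.

Lemma Dp_near b f g x : (\near x, f x = g x) -> Dp b f x = Dp b g x.
Proof. exact: near_eq_derive. Qed.

Lemma per1_le (E Om : set (pt R)) C : measurable (E : set (PT R)) -> measurable (Om : set (PT R)) ->
  (forall phi1 phi2, testfun Om phi1 -> testfun Om phi2 -> (forall x, phi1 x ^+ 2 + phi2 x ^+ 2 <= 1) ->
    I (E `&` Om) (fun x => Dp true phi1 x + Dp false phi2 x) <= C) -> (per1 E Om <= C%:E)%E.
Proof.
move=> mE mO h; apply: ge_ereal_sup => _ [phi1 [phi2 [t1 [t2 [le1 ->]]]]].
have mI := measurableI _ _ mE mO.
have o : ok (E `&` Om) (fun x => Dp true phi1 x + Dp false phi2 x).
  apply: (okS mO mI); first exact: subIsetr.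
  by apply: okD => //; apply: testfun_integrable => //; exact: testfun_derive.
by rewrite (EFin_I mI o) lee_fin; exact: h.
Qed.

Lemma per1_ge (E Om : set (pt R)) phi1 phi2 : measurable (E `&` Om : set (PT R)) -> measurable (Om : set (PT R)) ->
  testfun Om phi1 -> testfun Om phi2 -> (forall x, phi1 x ^+ 2 + phi2 x ^+ 2 <= 1) ->
  ((I (E `&` Om) (fun x => Dp true phi1 x + Dp false phi2 x))%:E <= per1 E Om)%E.
Proof.
move=> mI mO t1 t2 h; apply: ereal_sup_ubound; exists phi1, phi2; split=> //; split=> //; split => //.
rewrite -EFin_I//.
apply: (okS mO mI); first exact: subIsetr.
by apply: okD => //; apply: testfun_integrable => //; exact: testfun_derive.
Qed.

Lemma testfun_Dp b (Om : set (pt R)) f : testfun Om f -> testfun Om (Dp b f).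
Proof. exact: testfun_derive. Qed.

Lemma Cinf_Dp b f : Cinf (@dir R) f -> Cinf (@dir R) (Dp b f).
Proof. exact: Cinf_derive. Qed.

Lemma DpM b f g x : Cinf (@dir R) f -> Cinf (@dir R) g ->
  Dp b (fun x => f x * g x) x = f x * Dp b g x + g x * Dp b f x.
Proof. exact: deriveM_pt. Qed.

Lemma Dp_prod1 (f1 f2 : R -> R) (x : pt R) : Cinf1 f1 ->
  Dp true (fun x => f1 x.1 * f2 x.2) x = 'D_1 f1 x.1 * f2 x.2.
Proof. exact: derive_prod1. Qed.

Lemma Dp_prod2 (f1 f2 : R -> R) (x : pt R) : Cinf1 f2 ->
  Dp false (fun x => f1 x.1 * f2 x.2) x = f1 x.1 * 'D_1 f2 x.2.
Proof. exact: derive_prod2. Qed.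

Lemma Dp_fst x : Dp true fst x = 1.
Proof. by have [_] := is_derive_fst true x. Qed.

Lemma weak_grad_I (Om : set (pt R)) f g1 g2 phi : measurable (Om : set (PT R)) ->
  weak_grad Om f g1 g2 -> testfun Om phi ->
  I Om (fun x => f x * Dp true phi x) = - I Om (fun x => g1 x * phi x) /\
  I Om (fun x => f x * Dp false phi x) = - I Om (fun x => g2 x * phi x).
Proof.
move=> mO [lf [l1 [l2 H]]] tp; have [E1 E2] := H _ tp.
have o1 := loc_int_mul mO lf (testfun_derive true tp).
have o2 := loc_int_mul mO lf (testfun_derive false tp).
have o3 := loc_int_mul mO l1 tp; have o4 := loc_int_mul mO l2 tp.
split.
  by move: E1; rewrite (EFin_I mO o1) (EFin_I mO o3) -EFinN => -[].
by move: E2; rewrite (EFin_I mO o2) (EFin_I mO o4) -EFinN => -[].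
Qed.

Lemma weak_grad_Cinf (Om : set (pt R)) f : measurable (Om : set (PT R)) -> Cinf (@dir R) f ->
  weak_grad Om f (Dp true f) (Dp false f).
Proof.
move=> mO sf; do 3 (split; first by apply: loc_int_continuous; do ?exact: (Cinf_continuous sf); exact: (Cinf_continuous (Cinf_derive _ sf))).
by move=> phi tp; split; exact: integral_by_parts_testfun.
Qed.

Lemma continuous_ok_Ball r f : 0 <= r -> continuous f -> ok (Ball r) f.
Proof.
move=> r0 cf; apply: continuous_integrable_sub (Ball_rect r0) => //.
exact: measurable_Ball.
Qed.

Definition bump (a d : R) (x : pt R) : R := cut a d (q2 x).

Lemma testfun_bump a d r : 0 <= r -> a < d -> d < r ^+ 2 -> testfun (Ball r) (bump a d).
Proof.
move=> r0 ad dr; apply: (@testfun_compact _ _ (disk d)).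
- by apply: Cinf_comp Cinf_q2 _; exact: Cinf1_cut.
- exact: compact_disk.
- by move=> x; rewrite BallE// /disk/= => /le_lt_trans; apply.
- by move=> x /negP; rewrite -ltNge => /ltW; exact: cut0.
Qed.

(** Cutoffs equal to 1 on growing disks tend to 1 pointwise in the ball, and |f| dominates the
    integrand. The gradient of u is not compactly supported, so it needs such a cutoff before it can
    enter a test field. *)
Lemma cutoff_approx r f e : 0 < r -> continuous f -> 0 < e -> exists chi,
  [/\ testfun (Ball r) chi, forall x, 0 <= chi x <= 1 & I (Ball r) (fun x => (1 - chi x) ^+ 2 * f x) <= e].
Proof.
move=> r0 cf e0.
pose a n : R := r ^+ 2 - n.+1%:R^-1; pose d n : R := r ^+ 2 - n.+2%:R^-1.
have ad n : a n < d n by rewrite ltrD2l ltrN2 ltf_pV2 ?posrE// ltr_nat.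
have dr n : d n < r ^+ 2 by rewrite ltrBlDr ltrDl.
have T n := testfun_bump (ltW r0) (ad n) (dr n).
have mB := measurable_Ball (ltW r0).
pose F n (x : PT R) := ((1 - bump (a n) (d n) x) ^+ 2 * f x)%:E.
have cF n : continuous (fun x => (1 - bump (a n) (d n) x) ^+ 2 * f x).
  move=> x; apply: cvgM; last exact: cf.
  apply: (@continuous_comp _ _ _ (fun x => 1 - bump (a n) (d n) x) (fun t => t ^+ 2)).
    by apply: cvgB; [exact: cvg_cst|exact: (Cinf_continuous (testfun_Cinf (T n)))].
  exact: exprn_continuous.
have mF n : measurable_fun (Ball r : set (PT R)) (F n).
  by apply/measurable_EFinP/measurable_funTS; exact: continuous_measurable_pt.
have b01 n x : 0 <= bump (a n) (d n) x <= 1 by exact: cut01.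
have H1 : {ae leb, forall x, Ball r x -> F ^~ x @ \oo --> 0%E}.
  apply: aeW => x; rewrite BallE ?ltW//= => Bx; apply: cvg_near_cst.
  have d0 : 0 < r ^+ 2 - q2 x by rewrite subr_gt0.
  have := near_infty_natSinv_lt (PosNum d0); apply: filterS => n /= hn.
  have hn' : n.+1%:R^-1 < r ^+ 2 - q2 x := hn.
  by rewrite /F /bump cut1// ?subrr ?expr0n/= ?mul0r// /a lerBrDr addrC -lerBrDr ltW.
have ig : leb.-integrable (Ball r : set (PT R)) (fun x => `|f x|%:E).
  by apply: continuous_ok_Ball; rewrite ?ltW// => x; apply: cvg_norm; exact: cf.
have H2 : {ae leb, forall x n, Ball r x -> (`|F n x| <= `|f x|%:E)%E}.
  apply: aeW => x n _; rewrite /F /= lee_fin normrM ler_piMl//.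
  have /andP[? ?] := b01 n x; rewrite ger0_norm ?sqr_ge0//; nra.
have [_ _ C] := @dominated_convergence _ _ _ _ _ mB F (cst 0%E) (fun x => `|f x|%:E) mF
  (measurable_cst _) H1 ig H2.
rewrite integral0 in C.
have /fine_cvgP[_ /cvgrPdist_lt /(_ _ e0) [n _ hn]] := C.
exists (bump (a n) (d n)); split => //.
have := hn n (leqnn n); rewrite /= sub0r normrN => /ltW.
by apply: le_trans; exact: ler_norm.
Qed.

End balls.

Global Opaque ok I Dp.

(** * Dirichlet energy *)

Section dirichlet_energy.
Context {R : realType}.
Local Notation leb := (@leb2 R).
Implicit Types (r : R) (u v w f : pt R -> R).
Local Notation D1 := (Dp true).
Local Notation D2 := (Dp false).

(* Integrate the derivative of x1 * phi^2 along x1. *)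
Lemma poincare r phi : 0 < r -> testfun (Ball r) phi ->
  I (Ball r) (fun x => phi x ^+ 2) <= 4 * r ^+ 2 * I (Ball r) (fun x => D1 phi x ^+ 2).
Proof.
move=> r0 tp; have mB := measurable_Ball (ltW r0).
have sp := testfun_Cinf tp; have sd := Cinf_Dp true sp.
have tpp := testfunM sp tp.
have [E _] := weak_grad_I mB (weak_grad_Cinf mB (@Cinf_fst R)) tpp.
have o1 : ok (Ball r) (fun x => phi x ^+ 2) by apply: ok_testfun.
have o2 : ok (Ball r) (fun x => D1 phi x ^+ 2).
  by apply: ok_testfun => //; apply: testfunM => //; exact: testfun_Dp.
have o3 : ok (Ball r) (fun x => x.1 * (phi x * D1 phi x)).
  apply: ok_testfun => //; apply: testfunM; first exact: Cinf_fst.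
  by apply: testfunM => //; exact: testfun_Dp.
have E1 : I (Ball r) (fun x => x.1 * D1 (fun x => phi x * phi x) x) = 2 * I (Ball r) (fun x => x.1 * (phi x * D1 phi x)).
  rewrite -IZ//; apply: eq_I => // x _; rewrite DpM//; ring.
have E2 : I (Ball r) (fun x => D1 fst x * (phi x * phi x)) = I (Ball r) (fun x => phi x ^+ 2).
  by apply: eq_I => // x _; rewrite Dp_fst mul1r.
rewrite E1 E2 in E.
(* Young's inequality with weights 1/2 and 2, and |x1| <= r: half of the integral of phi^2 is
   absorbed on the left, which yields the constant 4 r^2. *)
have : - (2 * I (Ball r) (fun x => x.1 * (phi x * D1 phi x))) <=
    2^-1 * I (Ball r) (fun x => phi x ^+ 2) + 2 * r ^+ 2 * I (Ball r) (fun x => D1 phi x ^+ 2).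
  rewrite -mulNr -!IZ// -ID//; [|exact: okZ..].
  apply: I_le => //; [exact: okZ|by apply: okD => //; exact: okZ|].
  move=> x /(Ball_rect (ltW r0))[] /=; rewrite !in_itv/= => /andP[h1 h2] _.
  set p := phi x; set q := Dp true phi x.
  have := sqr_ge0 (p + 2 * x.1 * q).
  have h : x.1 ^+ 2 <= r ^+ 2 by nra.
  have := ler_wpM2r (sqr_ge0 q) h; nra.
rewrite E opprK; clear.
by move: (I _ _) (I _ _) => b c h; lra.
Qed.

(** Integrating by parts in both directions moves the derivatives onto u, where they add up to its
    Laplacian. *)
Lemma harmonic_orth (Om : set (pt R)) u phi : measurable (Om : set (PT R)) -> Cinf (@dir R) u ->
  (forall x, D1 (D1 u) x + D2 (D2 u) x = 0) -> testfun Om phi ->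
  I Om (fun x => D1 u x * D1 phi x + D2 u x * D2 phi x) = 0.
Proof.
move=> mO su hu tp.
have s1 := Cinf_Dp true su; have s2 := Cinf_Dp false su.
have [E1 _] := weak_grad_I mO (weak_grad_Cinf mO s1) tp.
have [_ E2] := weak_grad_I mO (weak_grad_Cinf mO s2) tp.
have o1 : ok Om (fun x => D1 u x * D1 phi x).
  by apply: ok_testfun => //; apply: testfunM => //; exact: testfun_Dp.
have o2 : ok Om (fun x => D2 u x * D2 phi x).
  by apply: ok_testfun => //; apply: testfunM => //; exact: testfun_Dp.
have o3 : ok Om (fun x => D1 (D1 u) x * phi x).
  by apply: ok_testfun => //; apply: testfunM => //; exact: Cinf_Dp.
have o4 : ok Om (fun x => D2 (D2 u) x * phi x).
  by apply: ok_testfun => //; apply: testfunM => //; exact: Cinf_Dp.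
rewrite (ID mO o1 o2) E1 E2 -opprD -(ID mO o3 o4).
rewrite (_ : I _ _ = I Om (fun=> 0 * 0)); last first.
  by apply: eq_I => // x _; rewrite -mulrDl hu mul0r mul0r.
by rewrite IZ ?mul0r ?oppr0//; exact: ok0.
Qed.

Definition grad2 f x : R := D1 f x ^+ 2 + D2 f x ^+ 2.

Lemma ok_grad2 r f : 0 <= r -> Cinf (@dir R) f -> ok (Ball r) (grad2 f).
Proof.
move=> r0 sf; apply: continuous_ok_Ball => //; apply: Cinf_continuous.
by apply: CinfD; apply: CinfM; exact: Cinf_Dp.
Qed.

Lemma dirichlet_Cinf r f : 0 <= r -> Cinf (@dir R) f -> (dirichlet (Ball r) f <= (I (Ball r) (grad2 f))%:E)%E.
Proof.
move=> r0 sf; have mB := measurable_Ball r0; apply: ereal_inf_lbound.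
exists (D1 f), (D2 f); split; first exact: weak_grad_Cinf.
by rewrite -EFin_I//; exact: ok_grad2.
Qed.

Lemma H10_testfun r f : 0 <= r -> testfun (Ball r) f -> H10 (Ball r) f.
Proof.
move=> r0 tf; have sf := testfun_Cinf tf; have mB := measurable_Ball r0.
exists (D1 f), (D2 f); split; first exact: weak_grad_Cinf.
split.
  have o : ok (Ball r) (fun x => f x ^+ 2 + D1 f x ^+ 2 + D2 f x ^+ 2).
    apply: ok_testfun => //.
    by apply: testfunD; [apply: testfunD|]; apply: testfunM; do ?exact: Cinf_Dp; do ?exact: testfun_Dp.
  by rewrite EFin_I// ltry.
exists (fun _ => f); split => //.
rewrite [X in X @ _](_ : _ = cst 0%E); first exact: cvg_cst.
by apply/funext => k; apply: integral0_eq => x _; rewrite !subrr expr0n/= !addr0.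
Qed.

(** Read U as grad u, H as the gradient of v - u, P as that of a test function, c as a cutoff, and
    psi = c U + P. The right side is |U + H|^2 - |U + H - psi|^2. The cross term U.H is traded for
    U.P, since only a test gradient is known to be orthogonal to U after integration; Young's
    inequality with parameter [de] pays for the exchange. *)
Lemma gap_pointwise (de U1 U2 H1 H2 P1 P2 c : R) : 0 < de ->
  U1 ^+ 2 + U2 ^+ 2 + (H1 ^+ 2 + H2 ^+ 2) + 2 * (U1 * P1 + U2 * P2)
  - (2 * de * (U1 ^+ 2 + U2 ^+ 2) + (2 + (2 * de)^-1) * ((P1 - H1) ^+ 2 + (P2 - H2) ^+ 2)
     + 2 * ((1 - c) ^+ 2 * (U1 ^+ 2 + U2 ^+ 2))) <=
  2 * (U1 * (U1 * c + P1) + H1 * (U1 * c + P1) + (U2 * (U2 * c + P2) + H2 * (U2 * c + P2)))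
  - ((U1 * c + P1) ^+ 2 + (U2 * c + P2) ^+ 2).
Proof.
move=> de0.
have K a b : 0 <= 2 * de * a ^+ 2 + (2 * de)^-1 * b ^+ 2 - 2 * (a * b).
  rewrite (_ : _ - _ = (2 * de)^-1 * (2 * de * a - b) ^+ 2); first by rewrite mulr_ge0 ?sqr_ge0// invr_ge0 mulr_ge0// ltW.
  by field; rewrite gt_eqF.
have := (K U1 (P1 - H1), K U2 (P2 - H2), sqr_ge0 ((1 - c) * U1 + (P1 - H1)), sqr_ge0 ((1 - c) * U2 + (P2 - H2))).
by move: (2 * de)^-1 => z [[[k1 k2] k3] k4]; lra.
Qed.

Lemma gap_arith (e a b c G h g : R) : 0 < e -> a <= e / 4 -> b <= e / 4 -> c <= e / 8 ->
  G + h - (a + b + 2 * c) <= g -> G + h <= g + e.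
Proof. lra. Qed.

(* For test fields psi one has |g|^2 >= 2 g.psi - |psi|^2, and g acts on psi as grad u + h does;
   psi = chi grad u + grad phi_k approximates grad u + h in L^2. *)
Lemma dirichlet_gap r u v g1 g2 h1 h2 (phi : nat -> pt R -> R) : 0 < r ->
  Cinf (@dir R) u -> (forall x, D1 (D1 u) x + D2 (D2 u) x = 0) ->
  weak_grad (Ball r) v g1 g2 -> weak_grad (Ball r) (v - u) h1 h2 ->
  ok (Ball r) (fun x => g1 x ^+ 2 + g2 x ^+ 2) ->
  ok (Ball r) (fun x => h1 x ^+ 2 + h2 x ^+ 2) ->
  (forall k, testfun (Ball r) (phi k)) ->
  (forall e, 0 < e -> exists k, ok (Ball r) (fun x => (D1 (phi k) x - h1 x) ^+ 2 + (D2 (phi k) x - h2 x) ^+ 2) /\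
     I (Ball r) (fun x => (D1 (phi k) x - h1 x) ^+ 2 + (D2 (phi k) x - h2 x) ^+ 2) < e) ->
  I (Ball r) (grad2 u) + I (Ball r) (fun x => h1 x ^+ 2 + h2 x ^+ 2) <=
  I (Ball r) (fun x => g1 x ^+ 2 + g2 x ^+ 2).
Proof.
move=> r0 su hu wv ww og oh tphi Hk.
have mB := measurable_Ball (ltW r0).
have ogu := ok_grad2 (ltW r0) su.
have G0 : 0 <= I (Ball r) (grad2 u) by apply: I_ge0 => x _; rewrite addr_ge0 ?sqr_ge0.
set Gu := I _ (grad2 u) in G0 *.
apply/ler_addgt0Pr => e e0.
(* This makes 2 [de] [Gu] at most e / 4; the + 1 covers [Gu] = 0. *)
pose de := e / (8 * (Gu + 1)).
have de0 : 0 < de by rewrite divr_gt0// mulr_gt0//; lra.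
have c0 : 0 < 2 + (2 * de)^-1 by rewrite addr_gt0// invr_gt0 mulr_gt0.
have e1 : 0 < e / 4 / (2 + (2 * de)^-1) by rewrite divr_gt0// divr_gt0.
have [p [tp [ok_k Ik]]] : exists p, testfun (Ball r) p /\
    (ok (Ball r) (fun x => (D1 p x - h1 x) ^+ 2 + (D2 p x - h2 x) ^+ 2) /\
     I (Ball r) (fun x => (D1 p x - h1 x) ^+ 2 + (D2 p x - h2 x) ^+ 2) < e / 4 / (2 + (2 * de)^-1)).
  by have [k Hk'] := Hk _ e1; exists (phi k).
clear Hk tphi.
have e4 : 0 < e / 8 by rewrite divr_gt0.
have sg : continuous (grad2 u) by apply: Cinf_continuous; apply: CinfD; apply: CinfM; exact: Cinf_Dp.
have [chi [tchi chi01 Ichi]] := cutoff_approx r0 sg e4.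
have [psi1 psi1E] : exists f, f = fun x => D1 u x * chi x + D1 p x by exists (fun x => D1 u x * chi x + D1 p x).
have [psi2 psi2E] : exists f, f = fun x => D2 u x * chi x + D2 p x by exists (fun x => D2 u x * chi x + D2 p x).
have t1 : testfun (Ball r) psi1.
  by rewrite psi1E; apply: testfunD; [apply: testfunM => //; exact: Cinf_Dp|exact: testfun_Dp].
have t2 : testfun (Ball r) psi2.
  by rewrite psi2E; apply: testfunD; [apply: testfunM => //; exact: Cinf_Dp|exact: testfun_Dp].
have wu := weak_grad_Cinf mB su.
have lv := wv.1; have lw := ww.1; have lu := wu.1.
have [_ [lg1 [lg2 _]]] := wv; have [_ [lh1 [lh2 _]]] := ww; have [_ [lu1 [lu2 _]]] := wu.
have Ev x : v x = u x + (v - u) x by rewrite -[(v - u) x]/(v x - u x) addrC subrK.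
(* That g equals grad u + h almost everywhere is not at hand; additivity is only needed against test
   functions, where the defining identities of the three weak gradients give it. *)
have E1 : I (Ball r) (fun x => g1 x * psi1 x) = I (Ball r) (fun x => D1 u x * psi1 x) + I (Ball r) (fun x => h1 x * psi1 x).
  have [a1 _] := weak_grad_I mB wv t1; have [b1 _] := weak_grad_I mB ww t1; have [c1 _] := weak_grad_I mB wu t1.
  apply: oppr_inj; rewrite opprD -a1 -b1 -c1 -ID//; [|exact: loc_int_mul lu (testfun_Dp _ t1)|exact: loc_int_mul lw (testfun_Dp _ t1)].
  by apply: eq_I => // x _; rewrite -mulrDl -Ev.
have E2 : I (Ball r) (fun x => g2 x * psi2 x) = I (Ball r) (fun x => D2 u x * psi2 x) + I (Ball r) (fun x => h2 x * psi2 x).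
  have [_ a1] := weak_grad_I mB wv t2; have [_ b1] := weak_grad_I mB ww t2; have [_ c1] := weak_grad_I mB wu t2.
  apply: oppr_inj; rewrite opprD -a1 -b1 -c1 -ID//; [|exact: loc_int_mul lu (testfun_Dp _ t2)|exact: loc_int_mul lw (testfun_Dp _ t2)].
  by apply: eq_I => // x _; rewrite -mulrDl -Ev.
have og1 := loc_int_mul mB lg1 t1; have og2 := loc_int_mul mB lg2 t2.
have oh1 := loc_int_mul mB lh1 t1; have oh2 := loc_int_mul mB lh2 t2.
have ou1 := loc_int_mul mB lu1 t1; have ou2 := loc_int_mul mB lu2 t2.
have opsi : ok (Ball r) (fun x => psi1 x ^+ 2 + psi2 x ^+ 2).
  apply: (okD mB); apply: (ok_testfun mB).
    exact: testfunM (testfun_Cinf t1) t1.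
  exact: testfunM (testfun_Cinf t2) t2.
have oup : ok (Ball r) (fun x => D1 u x * D1 p x + D2 u x * D2 p x).
  by apply: (okD mB); apply: (ok_testfun mB); apply: testfunM; do ?exact: Cinf_Dp; exact: testfun_Dp.
have ochi : ok (Ball r) (fun x => (1 - chi x) ^+ 2 * grad2 u x).
  apply: continuous_ok_Ball; first exact: ltW.
  apply: Cinf_continuous; apply: CinfM; last by apply: CinfD; apply: CinfM; exact: Cinf_Dp.
  by apply: CinfM; (apply: CinfB; [exact: Cinf_cst|exact: testfun_Cinf tchi]).
have oA1 := okD mB ou1 oh1; have oA2 := okD mB ou2 oh2.
have oA := okZ mB 2 (okD mB oA1 oA2).
have oS := okB mB oA opsi.
have oG := okZ mB 2 (okD mB og1 og2).
set S := (fun x => _) in oS.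
have step1 : I (Ball r) S <= I (Ball r) (fun x => g1 x ^+ 2 + g2 x ^+ 2).
  have E : I (Ball r) S = I (Ball r) (fun x => 2 * (g1 x * psi1 x + g2 x * psi2 x) - (psi1 x ^+ 2 + psi2 x ^+ 2)).
    rewrite (IB mB oA opsi) (IB mB oG opsi); congr (_ - _).
    rewrite (IZ mB 2 (okD mB oA1 oA2)) (IZ mB 2 (okD mB og1 og2)); congr (_ * _).
    by rewrite (ID mB oA1 oA2) (ID mB og1 og2) (ID mB ou1 oh1) (ID mB ou2 oh2) E1 E2.
  rewrite E; apply: (I_le mB (okB mB oG opsi) og) => x _.
  have := (sqr_ge0 (g1 x - psi1 x), sqr_ge0 (g2 x - psi2 x)).
  by move: (g1 x) (g2 x) (psi1 x) (psi2 x) => a b c d; clear => -[]; nra.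
have oT1 := okZ mB (2 * de) ogu.
have oT2 := okZ mB (2 + (2 * de)^-1) ok_k.
have oT12 := okD mB oT1 oT2.
have oT3 := okZ mB 2 ochi.
have oT123 := okD mB oT12 oT3.
have oT4 := okD mB ogu oh.
have oT5 := okZ mB 2 oup.
have oT45 := okD mB oT4 oT5.
have oT := okB mB oT45 oT123.
set T := (fun x => _) in oT.
have step2 : I (Ball r) T <= I (Ball r) S.
  apply: (I_le mB oT oS) => x _; rewrite /T /S psi1E psi2E /grad2.
  exact: gap_pointwise.
have IT : I (Ball r) T = Gu + I (Ball r) (fun x => h1 x ^+ 2 + h2 x ^+ 2) -
  (2 * de * Gu + (2 + (2 * de)^-1) * I (Ball r) (fun x => (D1 p x - h1 x) ^+ 2 + (D2 p x - h2 x) ^+ 2)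
    + 2 * I (Ball r) (fun x => (1 - chi x) ^+ 2 * grad2 u x)).
  rewrite (IB mB oT45 oT123) (ID mB oT4 oT5) (IZ mB 2 oup) (harmonic_orth mB su hu tp) mulr0 addr0.
  rewrite (ID mB ogu oh) (ID mB oT12 oT3) (ID mB oT1 oT2) (IZ mB (2 * de) ogu).
  by rewrite (IZ mB (2 + (2 * de)^-1) ok_k) (IZ mB 2 ochi).
have b1 : 2 * de * Gu <= e / 4.
  have G1 : Gu + 1 != 0 by rewrite gt_eqF// ltr_wpDl.
  rewrite /de (_ : 2 * _ * _ = e / 4 * (Gu / (Gu + 1))); last by field.
  by rewrite ler_piMr ?divr_ge0 ?(ltW e0)// ler_pdivrMr ?mul1r ?lerDl// ltr_wpDl.
have b2 : (2 + (2 * de)^-1) * I (Ball r) (fun x => (D1 p x - h1 x) ^+ 2 + (D2 p x - h2 x) ^+ 2) <= e / 4.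
  by rewrite mulrC -ler_pdivlMr// ltW.
by move: (le_trans step2 step1); rewrite IT => st; exact: (gap_arith e0 b1 b2 Ichi st).
Qed.

Lemma competitor_arith1 (G a b g M : R) : G + (a + b) <= g -> 0 <= b -> g < G + M -> a <= M.
Proof. lra. Qed.

Lemma sqr_split (w p : R) : w ^+ 2 <= 2 * p ^+ 2 + 2 * (p - w) ^+ 2.
Proof. by have := sqr_ge0 (2 * p - w); lra. Qed.

Lemma sqr_split' (p h : R) : p ^+ 2 <= 2 * h ^+ 2 + 2 * (p - h) ^+ 2.
Proof. by have := sqr_ge0 (2 * h - p); lra. Qed.

(** The 16 is 4 from Poincare times 2 for each of the two passages between the limit and its
    approximation, at the level of functions and of gradients. *)
Lemma competitor_arith2 (r H M W P D e1 e2 e3 e : R) : H <= M -> P <= 4 * r ^+ 2 * D ->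
  W <= 2 * P + 2 * e1 -> D <= 2 * H + 2 * e2 -> 0 <= e1 -> 0 <= e2 -> 0 <= e3 ->
  (e1 + e2 + e3) * (16 * r ^+ 2 + 2) < e -> W <= 16 * r ^+ 2 * M + e.
Proof.
move=> hM hP hW hD p1 p2 p3 he.
have r2 : 0 <= r ^+ 2 by exact: sqr_ge0.
have := ler_wpM2l r2 hD; have := ler_wpM2l r2 hM.
have := (mulr_ge0 r2 p1, mulr_ge0 r2 p2, mulr_ge0 r2 p3) => -[[? ?] ?].
by lra.
Qed.

(** [H10] gives finiteness of one integral of three squares and an extended-real limit; the
    estimates to come need each square integrable by itself and real integrals. *)
Lemma H10_data r w : 0 < r -> H10 (Ball r) w -> exists h1 h2 (phi : nat -> pt R -> R),
  [/\ weak_grad (Ball r) w h1 h2,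
   [/\ measurable_fun (Ball r : set (PT R)) w, ok (Ball r) (fun x => w x ^+ 2), ok (Ball r) (fun x => h1 x ^+ 2) & ok (Ball r) (fun x => h2 x ^+ 2)],
   forall k, testfun (Ball r) (phi k) &
   forall e, 0 < e -> exists k, [/\
     ok (Ball r) (fun x => (phi k x - w x) ^+ 2),
     ok (Ball r) (fun x => (D1 (phi k) x - h1 x) ^+ 2), ok (Ball r) (fun x => (D2 (phi k) x - h2 x) ^+ 2) &
     I (Ball r) (fun x => (phi k x - w x) ^+ 2) + I (Ball r) (fun x => (D1 (phi k) x - h1 x) ^+ 2)
       + I (Ball r) (fun x => (D2 (phi k) x - h2 x) ^+ 2) < e]].
Proof.
move=> r0 [h1 [h2 [ww [fin [phi [tphi cphi]]]]]].
have mB := measurable_Ball (ltW r0).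
have mw := loc_int_measurable r0 ww.1.
have mh1 := loc_int_measurable r0 ww.2.1.
have mh2 := loc_int_measurable r0 ww.2.2.1.
have split3 (a b c : pt R -> R) : measurable_fun (Ball r : set (PT R)) a -> measurable_fun (Ball r : set (PT R)) b ->
    measurable_fun (Ball r : set (PT R)) c ->
    (\int[leb]_(x in Ball r) (a x ^+ 2 + b x ^+ 2 + c x ^+ 2)%:E < +oo)%E ->
    [/\ ok (Ball r) (fun x => a x ^+ 2), ok (Ball r) (fun x => b x ^+ 2) & ok (Ball r) (fun x => c x ^+ 2)].
  move=> ma mb mc fi.
  have o : ok (Ball r) (fun x => a x ^+ 2 + b x ^+ 2 + c x ^+ 2).
    apply: (ok_ge0 _ _ fi); last by move=> x _; rewrite !addr_ge0 ?sqr_ge0.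
    by apply: measurable_funD; [apply: measurable_funD|]; exact: measurable_funX.
  split; apply: (ok_le mB _ _ o); do ?exact: measurable_funX.
  - by move=> x _; rewrite ger0_norm ?sqr_ge0// -addrA lerDl addr_ge0 ?sqr_ge0.
  - by move=> x _; rewrite ger0_norm ?sqr_ge0// addrAC lerDr addr_ge0 ?sqr_ge0.
  - by move=> x _; rewrite ger0_norm ?sqr_ge0// lerDr addr_ge0 ?sqr_ge0.
have [ow oh1 oh2] := split3 _ _ _ mw mh1 mh2 fin.
exists h1, h2, phi; split => // e e0.
have /fine_cvgP[[n1 _ hn1] /cvgrPdist_lt /(_ _ e0) [n2 _ hn2]] := cphi.
exists (maxn n1 n2).
have f1 := hn1 (maxn n1 n2) (leq_maxl _ _).
have f2 := hn2 (maxn n1 n2) (leq_maxr _ _).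
set k := maxn n1 n2 in f1 f2 *.
have sk := testfun_Cinf (tphi k).
have mc f : Cinf (@dir R) f -> measurable_fun (Ball r : set (PT R)) f.
  by move=> sf; apply: measurable_funTS; apply: continuous_measurable_pt; exact: Cinf_continuous sf.
have m1 : measurable_fun (Ball r : set (PT R)) (fun x => phi k x - w x).
  by apply: measurable_funB => //; exact: mc.
have m2 : measurable_fun (Ball r : set (PT R)) (fun x => D1 (phi k) x - h1 x).
  by apply: measurable_funB => //; apply: mc; exact: Cinf_Dp.
have m3 : measurable_fun (Ball r : set (PT R)) (fun x => D2 (phi k) x - h2 x).
  by apply: measurable_funB => //; apply: mc; exact: Cinf_Dp.
have fk : (\int[leb]_(x in Ball r) ((phi k x - w x) ^+ 2 + (D1 (phi k) x - h1 x) ^+ 2 + (D2 (phi k) x - h2 x) ^+ 2)%:E < +oo)%E.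
  by move: f1; rewrite fin_numE => /andP[_]; rewrite ltey.
have [q1 q2 q3] := split3 _ _ _ m1 m2 m3 fk.
split => //; rewrite -(ID mB q1 q2) -(ID mB (okD mB q1 q2) q3).
have o123 := okD mB (okD mB q1 q2) q3.
move: f2; rewrite /= sub0r normrN => f2.
have E : fine (\int[leb]_(x in Ball r) ((phi k x - w x) ^+ 2 + (D1 (phi k) x - h1 x) ^+ 2 + (D2 (phi k) x - h2 x) ^+ 2)%:E)%E =
  I (Ball r) (fun x => (phi k x - w x) ^+ 2 + (D1 (phi k) x - h1 x) ^+ 2 + (D2 (phi k) x - h2 x) ^+ 2) by rewrite (EFin_I mB o123).
rewrite -E; apply: le_lt_trans f2; exact: ler_norm.
Qed.

(** The first half is the Dirichlet principle. For the second, the excess controls the gradient of v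
    - u, and Poincare, available for test functions, is applied to the approximants and passed to
    the limit. *)
Lemma competitor_L2 r u v M : 0 < r -> Cinf (@dir R) u ->
  (forall x, D1 (D1 u) x + D2 (D2 u) x = 0) -> H10 (Ball r) (v - u) ->
  ((I (Ball r) (grad2 u))%:E <= dirichlet (Ball r) v)%E /\
  ((dirichlet (Ball r) v < (I (Ball r) (grad2 u) + M)%:E)%E ->
   [/\ measurable_fun (Ball r : set (PT R)) (v - u), ok (Ball r) (fun x => (v - u) x ^+ 2) &
    I (Ball r) (fun x => (v - u) x ^+ 2) <= 16 * r ^+ 2 * M]).
Proof.
move=> r0 su hu Hw.
have mB := measurable_Ball (ltW r0).
have [h1 [h2 [phi [ww [mw ow oh1 oh2] tphi Hk]]]] := H10_data r0 Hw.
have oh := okD mB oh1 oh2.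
have key g1 g2 : weak_grad (Ball r) v g1 g2 -> ok (Ball r) (fun x => g1 x ^+ 2 + g2 x ^+ 2) ->
    I (Ball r) (grad2 u) + I (Ball r) (fun x => h1 x ^+ 2 + h2 x ^+ 2) <= I (Ball r) (fun x => g1 x ^+ 2 + g2 x ^+ 2).
  move=> wv og; apply: (dirichlet_gap r0 su hu wv ww og oh tphi) => e e0.
  have [k [k1 k2 k3 k4]] := Hk e e0; exists k; split; first exact: (okD mB k2 k3).
  rewrite (ID mB k2 k3); apply: le_lt_trans k4; rewrite -addrA lerDr.
  by apply: I_ge0 => x _; exact: sqr_ge0.
have meas g1 g2 : weak_grad (Ball r) v g1 g2 ->
    measurable_fun (Ball r : set (PT R)) (fun x => g1 x ^+ 2 + g2 x ^+ 2).
  move=> [_ [/(loc_int_measurable r0) m1 [/(loc_int_measurable r0) m2 _]]].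
  by apply: measurable_funD; exact: measurable_funX.
have h0 : 0 <= I (Ball r) (fun x => h1 x ^+ 2 + h2 x ^+ 2).
  by apply: I_ge0 => x _; rewrite addr_ge0 ?sqr_ge0.
split.
  apply: le_ereal_inf_tmp => _ [g1 [g2 [wv ->]]].
  (* For a weak gradient of infinite energy the bound is trivial; [dirichlet_gap] needs an
     integrable one. *)
  have [fin|] := ltP (\int[leb]_(x in Ball r) (g1 x ^+ 2 + g2 x ^+ 2)%:E)%E +oo%E; last first.
    by rewrite leye_eq => /eqP ->; rewrite leey.
  have og : ok (Ball r) (fun x => g1 x ^+ 2 + g2 x ^+ 2).
    by apply: (ok_ge0 _ _ fin); [exact: meas wv|move=> x _; rewrite addr_ge0 ?sqr_ge0].
  rewrite (EFin_I mB og) lee_fin; apply: le_trans (key _ _ wv og).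
  by rewrite lerDl.
move=> /ereal_inf_lt[_ [g1 [g2 [wv ->]]] lt]; split => //.
have fin := lt_trans lt (ltry _).
have og : ok (Ball r) (fun x => g1 x ^+ 2 + g2 x ^+ 2).
  by apply: (ok_ge0 _ _ fin); [exact: meas wv|move=> x _; rewrite addr_ge0 ?sqr_ge0].
rewrite (EFin_I mB og) lte_fin in lt.
have hM : I (Ball r) (fun x => h1 x ^+ 2) <= M.
  have k1 := key _ _ wv og; rewrite (ID mB oh1 oh2) in k1.
  have k2 : 0 <= I (Ball r) (fun x => h2 x ^+ 2) by apply: I_ge0 => x _; exact: sqr_ge0.
  move: k1 k2 lt; exact: competitor_arith1.
apply/ler_addgt0Pr => e e0.
have c0 : 0 < 16 * r ^+ 2 + 2 by rewrite addr_gt0// mulr_gt0// exprn_gt0.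
have [k [k1 k2 k3 k4]] := Hk _ (divr_gt0 e0 c0).
have P := poincare r0 (tphi k).
have tp := tphi k; have sp := testfun_Cinf tp.
have op : ok (Ball r) (fun x => phi k x ^+ 2) by apply: (ok_testfun mB); exact: testfunM sp tp.
have oD : ok (Ball r) (fun x => D1 (phi k) x ^+ 2).
  by apply: (ok_testfun mB); apply: testfunM; [exact: Cinf_Dp|exact: testfun_Dp].
have a1 : I (Ball r) (fun x => (v - u) x ^+ 2) <= 2 * I (Ball r) (fun x => phi k x ^+ 2) + 2 * I (Ball r) (fun x => (phi k x - (v - u) x) ^+ 2).
  rewrite -(IZ mB 2 op) -(IZ mB 2 k1) -(ID mB (okZ mB 2 op) (okZ mB 2 k1)).
  apply: (I_le mB ow (okD mB (okZ mB 2 op) (okZ mB 2 k1))) => x _; exact: sqr_split.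
have a2 : I (Ball r) (fun x => D1 (phi k) x ^+ 2) <= 2 * I (Ball r) (fun x => h1 x ^+ 2) + 2 * I (Ball r) (fun x => (D1 (phi k) x - h1 x) ^+ 2).
  rewrite -(IZ mB 2 oh1) -(IZ mB 2 k2) -(ID mB (okZ mB 2 oh1) (okZ mB 2 k2)).
  apply: (I_le mB oD (okD mB (okZ mB 2 oh1) (okZ mB 2 k2))) => x _; exact: sqr_split'.
have b1 : 0 <= I (Ball r) (fun x => (phi k x - (v - u) x) ^+ 2) by apply: I_ge0 => x _; exact: sqr_ge0.
have b2 : 0 <= I (Ball r) (fun x => (D1 (phi k) x - h1 x) ^+ 2) by apply: I_ge0 => x _; exact: sqr_ge0.
have b3 : 0 <= I (Ball r) (fun x => (D2 (phi k) x - h2 x) ^+ 2) by apply: I_ge0 => x _; exact: sqr_ge0.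
rewrite ltr_pdivlMr// in k4.
exact: competitor_arith2 hM P a1 a2 b1 b2 b3 k4.
Qed.

End dirichlet_energy.

(** * The classical perimeter *)

Section strips.
Context {R : realType}.
Local Notation mu := (@lebesgue_measure R).
Local Notation leb := (@leb2 R).

Definition u0 (x : pt R) : R := cos x.1 * expR x.2.

Lemma Cinf_u0 : Cinf (@dir R) u0.
Proof. by apply: Cinf_prod; [exact: (@Cinf1_cossin R).1|exact: Cinf1_expR]. Qed.

Lemma u0_harmonic x : Dp true (Dp true u0) x + Dp false (Dp false u0) x = 0.
Proof.
have [cc cs] := @Cinf1_cossin R; have ce := @Cinf1_expR R.
have dc t : 'D_1 (@cos R) t = - sin t by rewrite derive_val.
have ds t : 'D_1 (@sin R) t = cos t by rewrite derive_val.
have de t : 'D_1 (@expR R) t = expR t by rewrite derive_val.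
have E1 : Dp true u0 = fun x => (fun t => - sin t) x.1 * expR x.2.
  by apply/funext => y; rewrite Dp_prod1// dc.
have E2 : Dp false u0 = u0.
  by apply/funext => y; rewrite Dp_prod2// de.
rewrite E1 !E2 (@Dp_prod1 _ (fun t => - sin t) expR); last exact: CinfN.
have -> : 'D_1 (fun t : R => - sin t) x.1 = - cos x.1 by rewrite deriveN ?derive_val//; exact: derivable_sin.
by rewrite /u0 mulNr addNr.
Qed.

Definition E0 : set (pt R) := [set x | 0 < u0 x].

Lemma E0E : E0 = [set x | 0 < cos x.1].
Proof. by apply/funext => x; rewrite /E0 /u0 /= pmulr_lgt0// expR_gt0. Qed.

Lemma measurable_gt0 (f : pt R -> R) : continuous f -> measurable ([set x | 0 < f x] : set (PT R)).
Proof.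
move=> cf; apply: open_measurable_pt.
rewrite (_ : [set x | _] = f @^-1` `]0, +oo[%classic); last first.
  by apply/seteqP; split=> x /=; rewrite in_itv/= andbT.
by move/continuousP : cf; apply; exact: interval_open.
Qed.

Lemma measurable_E0 : measurable (E0 : set (PT R)).
Proof. by apply: measurable_gt0; apply: Cinf_continuous Cinf_u0. Qed.

Lemma pi_lt4 : pi < 4 :> R.
Proof. by have := pihalf_lt2 R; lra. Qed.

(** Translating by 2 pi N - pi k brings t into (-pi/2, pi/2); each half period contributes a
    sign. *)
Lemma cos_strip (N k : nat) (t : R) : - (pi / 2) - pi *+ 2 *+ N + pi *+ k < t < - (pi / 2) - pi *+ 2 *+ N + pi *+ k.+1 ->
  if odd k then cos t < 0 else 0 < cos t.
Proof.
rewrite [pi *+ k.+1]mulrS => /andP[h1 h2].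
have hs : 0 < cos (t + pi *+ 2 *+ N - pi *+ k).
  apply: cos_gt0_pihalf; move: h1 h2; move: (pi *+ 2 *+ N) (pi *+ k) => a b h1 h2.
  by apply/andP; split; lra.
have E : cos t = (-1) ^+ k * cos (t + pi *+ 2 *+ N - pi *+ k).
  rewrite -(alternatingn (@cosDpi R)) subrK.
  by rewrite (periodicn (@cosD2pi R)).
by rewrite E -signr_odd; case: (odd k); rewrite ?expr1 ?mulN1r ?oppr_lt0 ?expr0 ?mul1r.
Qed.

Lemma cos_le0_strip (t : R) : pi / 2 <= `|t| <= pi -> cos t <= 0.
Proof.
move=> /andP[h1 h2]; rewrite -cos_norm -(cos_pihalf R).
have p0 := pi_gt0 R.
have i1 : `|t| \in `[0, (pi:R)] by rewrite in_itv/= normr_ge0.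
have i2 : (pi:R) / 2 \in `[0, (pi:R)] by rewrite in_itv/=; apply/andP; split; lra.
move: h1; rewrite le_eqVlt => /predU1P[->//|h1].
by apply: ltW; rewrite ltr_cos.
Qed.

Lemma E0_near (x : pt R) : `|x.1| <= pi -> E0 x <-> `|x.1| < pi / 2.
Proof.
rewrite E0E /= => h; split => [c|].
  by rewrite ltNge; apply/negP => h2; have := @cos_le0_strip x.1; rewrite h h2 => /(_ isT); rewrite leNgt c.
by rewrite ltr_norml => h2; exact: cos_gt0_pihalf.
Qed.

Lemma setU_setD (T : Type) (A B : set T) : A `|` (B `\` A) = A `|` B.
Proof.
apply/seteqP; split=> x [Ax|Bx]; [by left|by right; case: Bx|by left|].
by have [Ax|nAx] := pselect (A x); [left|right].
Qed.

(** Listed next to each other the two rectangles overlap in a vertical line, which is null. *)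
Lemma I_rect_split (E : set (PT R)) a b c d e (f : pt R -> R) : measurable E -> a <= b -> b <= e ->
  continuous f ->
  I (E `&` rect a e c d) f = I (E `&` rect a b c d) f + I (E `&` rect b e c d) f.
Proof.
move=> mE ab be cf.
have mR x y : measurable (E `&` rect x y c d) by apply: measurableI => //; exact: measurable_rect.
have oR x y : ok (E `&` rect x y c d) f.
  exact: (okS (measurable_rect x y c d) (mR x y) (@subIsetr _ _ _) (continuous_ok_rect _ _ _ _ cf)).
set P := E `&` rect a b c d; set Q := E `&` rect b e c d.
have mD : measurable (Q `\` P) := measurableD (mR b e) (mR a b).
have U : E `&` rect a e c d = P `|` (Q `\` P).
  rewrite setU_setD; apply/seteqP; split=> x.
    move=> [Ex [/= x1 x2]]; move: x1; rewrite in_itv/= => /andP[h1 h2].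
    have [h|h] := leP x.1 b; first by left; split=> //; split => //=; rewrite in_itv/= h1.
    by right; split=> //; split=> //=; rewrite in_itv/= h2 ltW.
  move=> [[Ex [/= x1 x2]]|[Ex [/= x1 x2]]]; split => //; split=> //=; move: x1; rewrite !in_itv/= => /andP[h1 h2].
    by rewrite h1 (le_trans h2).
  by rewrite h2 (le_trans ab).
have dPQ : [disjoint P & Q `\` P] by rewrite disj_set2E setDIK.
have oU : ok (P `|` (Q `\` P)) f by rewrite -U.
rewrite U (I_setU (mR a b) mD dPQ oU); congr (_ + _).
apply/esym; apply: (I_subset_null mD (mR b e) _ _ (oR b e)); first exact: subDsetl.
apply: (leb2_sub0 _ (measurable_rect b b c d) _ (leb2_vline b c d)).
  exact: measurableD (mR b e) mD.
move=> x [h1 h2]; have [[_ [/= x1 x2]] [_ [/= y1 _]]] : P x /\ Q x.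
  by split=> //; apply: contrapT => h3; apply: h2.
split => //=; move: x1 y1; rewrite !in_itv/= => /andP[_ h3] /andP[h4 _].
by rewrite h3 h4.
Qed.

(* E0 occupies every second strip, up to vertical lines. *)
Lemma I_strip (N k : nat) c d (f : pt R -> R) : continuous f ->
  let s := - (pi / 2) - pi *+ 2 *+ N in
  I (E0 `&` rect (s + pi *+ k) (s + pi *+ k.+1) c d) f =
  if odd k then 0 else I (rect (s + pi *+ k) (s + pi *+ k.+1) c d) f.
Proof.
move=> cf s; set a := s + pi *+ k; set b := s + pi *+ k.+1.
have mE := measurable_E0; have mR := measurable_rect a b c d.
have mI : measurable (E0 `&` rect a b c d : set (PT R)) by exact: measurableI.
have oR := continuous_ok_rect a b c d cf.
have oI := okS mR mI (@subIsetr _ _ _) oR.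
pose V := rect a a c d `|` rect b b c d : set (PT R).
have mV : measurable V by apply: measurableU; exact: measurable_rect.
have V0 : leb V = 0%E by apply: leb2_U0; do ?exact: measurable_rect; exact: leb2_vline.
have H x : rect a b c d x -> ~ V x -> a < x.1 < b.
  move=> [/= + x2] nV; rewrite in_itv/= => /andP[h1 h2]; rewrite !lt_neqAle h1 h2 !andbT.
  apply/andP; split; apply/eqP => h; apply: nV; [left|right]; split => //=; rewrite in_itv/= -?h ?h lexx//.
case: ifPn => ok_k.
  apply: I_null => //; apply: (leb2_sub0 mI mV _ V0) => x [Ex Rx]; apply: contrapT => nV.
  have := cos_strip (H _ Rx nV); rewrite ok_k.
  by move: Ex; rewrite E0E /= => /lt_trans h /h; rewrite ltxx.
apply/esym; apply: I_subset_null => //.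
apply: (leb2_sub0 _ mV _ V0); first exact: measurableD.
move=> x [Rx nI]; apply: contrapT => nV; apply: nI; split=> //.
by have := cos_strip (H _ Rx nV); rewrite (negbTE ok_k) E0E.
Qed.

Lemma I_rect_divE (phi1 phi2 : pt R -> R) a b c d : Cinf (@dir R) phi1 -> Cinf (@dir R) phi2 ->
  a <= b -> c <= d ->
  I (rect a b c d) (fun x => Dp true phi1 x + Dp false phi2 x) =
  J c d (fun y => phi1 (b, y) - phi1 (a, y)) + J a b (fun x => phi2 (x, d) - phi2 (x, c)).
Proof.
move=> s1 s2 ab cd; have mR := measurable_rect a b c d.
have o1 := continuous_ok_rect a b c d (Cinf_continuous (Cinf_Dp true s1)).
have o2 := continuous_ok_rect a b c d (Cinf_continuous (Cinf_Dp false s2)).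
by rewrite (ID mR o1 o2) I_rect_Dp1// I_rect_Dp2.
Qed.

(** Divergence theorem on a rectangle: opposite sides contribute a difference of two numbers in
    [-1, 1]. *)
Lemma I_rect_div (phi1 phi2 : pt R -> R) a b c d : Cinf (@dir R) phi1 -> Cinf (@dir R) phi2 ->
  (forall x, phi1 x ^+ 2 + phi2 x ^+ 2 <= 1) -> a <= b -> c <= d ->
  I (rect a b c d) (fun x => Dp true phi1 x + Dp false phi2 x) <= 2 * (d - c) + 2 * (b - a).
Proof.
move=> s1 s2 h ab cd.
have n1 x : `|phi1 x| <= 1.
  by have := h x; have := sqr_ge0 (phi2 x); rewrite ler_norml => ? ?; apply/andP; split; nra.
have n2 x : `|phi2 x| <= 1.
  by have := h x; have := sqr_ge0 (phi1 x); rewrite ler_norml => ? ?; apply/andP; split; nra.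
have le2 (s t : R) : `|s| <= 1 -> `|t| <= 1 -> `|s - t| <= 2.
  by rewrite !ler_norml => /andP[? ?] /andP[? ?]; apply/andP; split; lra.
rewrite I_rect_divE//; apply: lerD; apply: J_abs_le => //.
- by move=> y; apply: cvgB; exact: slice1_Dp.
- by move=> y _; exact: le2.
- by move=> y; apply: cvgB; exact: slice2_Dp.
- by move=> y _; exact: le2.
Qed.

Lemma I_E0_rect c d (f : pt R -> R) : continuous f ->
  I (E0 `&` rect (- pi) pi c d) f = I (rect (- (pi / 2)) (pi / 2) c d) f.
Proof.
move=> cf; have p0 := pi_gt0 R.
have mR := measurable_rect (- (pi / 2)) (pi / 2 : R) c d.
have mI : measurable (E0 `&` rect (- pi) pi c d : set (PT R)).
  by apply: measurableI; [exact: measurable_E0|exact: measurable_rect].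
apply/esym; apply: I_subset_null => //; last exact: continuous_ok_rect.
  move=> x [Ex [/= x1 x2]]; split => //=; move: x1; rewrite !in_itv/= -!ler_norml => h.
  by have /(E0_near h)/ltW := Ex.
pose V := rect (- (pi / 2)) (- (pi / 2)) c d `|` rect (pi / 2) (pi / 2) c d : set (PT R).
apply: (@leb2_sub0 _ _ V).
- exact: measurableD.
- by apply: measurableU; exact: measurable_rect.
- move=> x [[/= x1 x2] nI]; move: x1; rewrite in_itv/= => /andP[h1 h2].
  apply: contrapT => nV; apply: nI.
  have hx : `|x.1| <= pi by rewrite ler_norml; apply/andP; split; lra.
  split; last by split => //=; rewrite in_itv/= -ler_norml.
  apply/(E0_near hx); rewrite ltr_norml !lt_neqAle h1 h2 !andbT.
  by apply/andP; split; apply/eqP => h; apply: nV; [left|right]; split => //=; rewrite in_itv/= -?h ?h lexx.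
- by apply: leb2_U0; do ?exact: measurable_rect; exact: leb2_vline.
Qed.

(** The 4N + 1 strips reach from -(2 pi N + pi/2) to 2 pi N + pi/2, and N > r. *)
Lemma strips_cover (N : nat) (r : R) : r < N%:R ->
  let s := - (pi / 2) - pi *+ 2 *+ N in s <= - r /\ r <= s + pi *+ (4 * N).+1.
Proof.
move=> rN; have p2 := pi_ge2 R.
have N0 : 0 <= N%:R :> R by [].
have Np := ler_wpM2l N0 p2.
have -> : pi *+ (4 * N).+1 = N%:R * (pi : R) * 4 + pi.
  by rewrite mulrSr -[pi *+ (4 * N)]mulr_natl natrM; congr (_ + _); rewrite [4 * _]mulrC -!mulrA [4 * _]mulrC.
have -> : pi *+ 2 *+ N = N%:R * (pi : R) * 2.
  by rewrite -[_ *+ N]mulr_natl -[pi *+ 2]mulr_natr mulrA.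
move=> s; rewrite /s; clear s; move: Np rN p2 N0; move: (N%:R * pi) => x ? ? ? ?; split; lra.
Qed.

Lemma per1_E0_finite r : 0 < r -> (per1 E0 (Ball r) < +oo)%E.
Proof.
move=> r0; have p0 := pi_gt0 R; have p2 := pi_ge2 R.
have [N rN] : exists N : nat, r < N%:R by exists (Num.bound r); apply: archi_boundP; exact: ltW.
have [sr rs] := strips_cover rN; move: sr rs; set s := (X in X <= _) => sr rs.
pose K : R := 2 * (r - - r) + 2 * pi.
have K0 : 0 <= K by rewrite /K; lra.
have mB := measurable_Ball (ltW r0).
pose n := (4 * N).+1.
apply: (@le_lt_trans _ _ (n%:R * K)%:E); last exact: ltry.
apply: per1_le => //; first exact: measurable_E0.
move=> phi1 phi2 t1 t2 h.
set F := fun x => _.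
have cF : continuous F.
  by apply: Cinf_continuous; apply: CinfD; apply: Cinf_Dp; [exact: testfun_Cinf t1|exact: testfun_Cinf t2].
have tF : testfun (Ball r) F by apply: testfunD; exact: testfun_Dp.
have [Kc [cK KO F0]] := testfun_supp tF.
have sub : E0 `&` Ball r `<=` E0 `&` rect s (s + pi *+ n) (- r) r.
  apply: setIS => x /(Ball_rect (ltW r0))[/= x1 x2]; split => //=; move: x1; rewrite !in_itv/= => /andP[? ?].
  by apply/andP; split; [exact: (le_trans sr)|exact: (le_trans _ rs)].
(* The divergence vanishes off the ball, so the ball may be replaced by a rectangle cut into whole
   strips. *)
rewrite -(I_setI_sub _ sub); last first.
  by move=> x [Ex _] nx; apply: F0 => Kx; apply: nx; split => //; exact: KO.
(* Induction on the number of strips: a positive one adds at most K, a negative one nothing. *)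
move: (n) => m {rs sub n}; elim: m => [|m IH].
  rewrite mul0r mulr0n addr0.
  have mV : measurable (E0 `&` rect s s (- r) r : set (PT R)).
    by apply: measurableI; [exact: measurable_E0|exact: measurable_rect].
  rewrite I_null//.
    by apply: (leb2_sub0 mV (measurable_rect _ _ _ _) _ (leb2_vline s (- r) r)); exact: subIsetr.
  exact: (okS (measurable_rect _ _ _ _) mV (@subIsetr _ _ _) (continuous_ok_rect _ _ _ _ cF)).
have le1 : s <= s + pi *+ m by rewrite lerDl mulrn_wge0// ltW.
have le2 : s + pi *+ m <= s + pi *+ m.+1 by rewrite lerD2l mulrSr lerDl ltW.
rewrite (I_rect_split _ _ measurable_E0 le1 le2 cF) -natr1 mulrDl mul1r; apply: lerD => //.
rewrite I_strip//; case: ifP => // _.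
have rr : - r <= r by lra.
apply: le_trans (I_rect_div (testfun_Cinf t1) (testfun_Cinf t2) h le2 rr) _.
by rewrite /K mulrSr; lra.
Qed.

(** Convexity of the unit disk, applied to (a, b) and (s, 0). *)
Lemma mix_le1 (c a b s : R) : 0 <= c <= 1 -> a ^+ 2 + b ^+ 2 <= 1 -> s ^+ 2 <= 1 ->
  ((1 - c) * a + c * s) ^+ 2 + ((1 - c) * b) ^+ 2 <= 1.
Proof.
move=> /andP[c0 c1] h hs.
have as1 : a * s <= 1.
  by have := (sqr_ge0 (a - s), sqr_ge0 b) => -[]; nra.
have d0 : 0 <= 1 - c by rewrite subr_ge0.
have e1 := ler_wpM2l (mulr_ge0 d0 d0) h.
have e2 := ler_wpM2l (mulr_ge0 c0 d0) as1.
have e3 := ler_wpM2l (mulr_ge0 c0 c0) hs.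
by lra.
Qed.

Lemma near_norm1 (x : pt R) a : a < `|x.1| -> \forall y \near x, a < `|y.1|.
Proof.
move=> h; have c : {for x, continuous (fun y : pt R => `|y.1|)}.
  by apply: cvg_norm; exact: cvg_fst.
exact: (c (fun t => a < t) (lt_nbhsr h)).
Qed.

Lemma near_norm2 (x : pt R) a : a < `|x.2| -> \forall y \near x, a < `|y.2|.
Proof.
move=> h; have c : {for x, continuous (fun y : pt R => `|y.2|)}.
  by apply: cvg_norm; exact: cvg_snd.
exact: (c (fun t => a < t) (lt_nbhsr h)).
Qed.

Definition E1 b : set (pt R) := E0 `\` rect (- pi) pi (- b) b.

(** The vertical sides give at least 4 * 2(b - 1) - 4b = 4b - 8, the ends at worst -2q > -8, with q
    standing for pi. At b = 5 this leaves 12 - 8, well above 1. *)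
Lemma drop_arith (b j1 j2 k q : R) : 5 <= b -> q < 4 ->
  4 * k - 2 * (b - - b) <= j1 -> (b - 1 - - (b - 1)) <= k -> - 2 * (q / 2 - - (q / 2)) <= j2 -> 1 <= j1 + j2.
Proof. lra. Qed.

Lemma J_lower (b : R) (k g : R -> R) : - b <= b -> continuous k -> continuous g ->
  (forall y, 4 * k y - 2 <= g y) -> 4 * J (- b) b k - 2 * (b - - b) <= J (- b) b g.
Proof.
move=> bb ck cg h.
have c4 : continuous (fun y => 4 * k y) by move=> y; apply: cvgM; [exact: cvg_cst|exact: ck].
have c2 : continuous (fun _ : R => -2 : R) by move=> y; exact: cvg_cst.
rewrite -mulNr -(J_cst (-2) bb) -JZ// -JD//; apply: J_le => // y.
by apply: cvgD; [exact: c4|exact: c2].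
Qed.

Lemma drop_flux b (phi1 phi2 psi1 psi2 : pt R -> R) : 5 <= b ->
  Cinf (@dir R) psi1 -> Cinf (@dir R) psi2 ->
  (forall x, phi1 x ^+ 2 + phi2 x ^+ 2 <= 1) ->
  let chi x := cutx 0 (pi / 2) pi x.1 * cutx 0 (b - 1) b x.2 in
  (forall x, psi1 x = (1 - chi x) * phi1 x + chi x * sin x.1) ->
  (forall x, psi2 x = (1 - chi x) * phi2 x) ->
  1 <= J (- b) b (fun y => psi1 (pi / 2, y) - psi1 (- (pi / 2), y)) +
       J (- (pi / 2)) (pi / 2) (fun x => psi2 (x, b) - psi2 (x, - b)).
Proof.
move=> b5 sp1 sp2 h chi psi1E psi2E; have p0 := pi_gt0 R; have p4 := pi_lt4.
have le1 : - (pi / 2) <= (pi : R) / 2 by lra.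
have le2 : - b <= b by lra.
have le3 : - (b - 1) <= b - 1 by lra.
have q0 : 0 <= (pi : R) / 2 by lra.
have q1 : (pi : R) / 2 < pi by lra.
have b0 : 0 <= b - 1 by lra.
have b1 : b - 1 < b by lra.
have [k1 k1E] : exists f, f = cutx 0 (pi / 2) (pi : R) by eexists.
have [k2 k2E] : exists f, f = cutx 0 (b - 1) b by eexists.
have sk2 : Cinf1 k2 by rewrite k2E; exact: Cinf1_cutx.
have k201 t : 0 <= k2 t <= 1 by rewrite k2E; exact: cutx01.
have {}psi1E x : psi1 x = (1 - k1 x.1 * k2 x.2) * phi1 x + k1 x.1 * k2 x.2 * sin x.1.
  by rewrite psi1E /chi k1E k2E.
have {}psi2E x : psi2 x = (1 - k1 x.1 * k2 x.2) * phi2 x.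
  by rewrite psi2E /chi k1E k2E.
have n1 x : -1 <= phi1 x <= 1.
  by have := h x; have := sqr_ge0 (phi2 x); move: (phi1 x) (phi2 x); clear => s t ? ?; apply/andP; split; nra.
have n2 x : -1 <= phi2 x <= 1.
  by have := h x; have := sqr_ge0 (phi1 x); move: (phi1 x) (phi2 x); clear => s t ? ?; apply/andP; split; nra.
have ck2 : continuous k2 := Cinf_continuous sk2.
have J1 : 4 * J (- b) b k2 - 2 * (b - - b) <= J (- b) b (fun y => psi1 (pi / 2, y) - psi1 (- (pi / 2), y)).
  apply: J_lower => //.
  - by move=> y; apply: cvgB; exact: slice1_Dp.
  (* On the lines x1 = pi/2 and x1 = -pi/2 the horizontal cutoff is 1 and the sine is 1 and -1, so
     with k = [k2 y] the jump is at least 2k - 2(1 - k). *)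
  - move=> y; rewrite !psi1E/= sinN sin_pihalf k1E.
    rewrite (@cutx1 _ 0 _ _ (pi / 2)) ?subr0 ?(ger0_norm q0)// (@cutx1 _ 0 _ _ (- (pi / 2))) ?subr0 ?normrN ?(ger0_norm q0)// !mul1r.
    have := n1 (pi / 2, y); have := n1 (- (pi / 2), y); have := k201 y.
    move: (phi1 _) (phi1 _) (k2 y); clear => s t k /andP[? ?] /andP[? ?] /andP[? ?]; nra.
have J2 : b - 1 - - (b - 1) <= J (- b) b k2.
  apply: (@le_trans _ _ (J (- (b - 1)) (b - 1) k2)); last first.
    by apply: J_subset => //; [lra|lra|move=> x; have /andP[] := k201 x].
  rewrite -[leLHS]mul1r -J_cst//; apply: J_le => //; first by move=> y; exact: cvg_cst.
  by move=> y hy; rewrite k2E cutx1// subr0 ler_norml.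
have J3 : - 2 * (pi / 2 - - (pi / 2)) <= J (- (pi / 2)) (pi / 2) (fun x => psi2 (x, b) - psi2 (x, - b)).
  rewrite -J_cst//; apply: J_le; first by move=> y; exact: cvg_cst.
    by move=> y; apply: cvgB; exact: slice2_Dp.
  (* At the ends of the box the vertical cutoff is 0, so the field there is still the given one. *)
  move=> t _; have z (s : R) : b <= `|s| -> k2 s = 0 by move=> bs; rewrite k2E (@cutx0 _ 0 _ b) ?subr0 ?(le_trans b0 (ltW b1)).
  rewrite !psi2E/= !z ?normrN ?ler_norm// !mulr0 !subr0 !mul1r.
  have := n2 (t, b); have := n2 (t, - b); move: (phi2 _) (phi2 _); clear => s1 s2 /andP[? ?] /andP[? ?]; lra.
exact: (drop_arith b5 p4 J1 J2 J3).
Qed.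

(* On the box, replace a test field of E1 by (sin x1, 0): this field has unit flux
   through both vertical sides of the removed strip. *)
Lemma per1_drop b r : 5 <= b -> 0 < r -> rect (- pi) pi (- b) b `<=` Ball r ->
  (per1 (E1 b) (Ball r) + 1 <= per1 E0 (Ball r))%E.
Proof.
move=> b5 r0 RB; have p0 := pi_gt0 R; have p4 := pi_lt4.
have le1 : - (pi / 2) <= (pi : R) / 2 by lra.
have le2 : - b <= b by lra.
have le3 : - (b - 1) <= b - 1 by lra.
have q0 : 0 <= (pi : R) / 2 by lra.
have q1 : (pi : R) / 2 < pi by lra.
have b0 : 0 <= b - 1 by lra.
have b1 : b - 1 < b by lra.
have mB := measurable_Ball (ltW r0).
have mE := measurable_E0; have mR := measurable_rect (- pi) (pi : R) (- b) b.
have mE1 : measurable (E1 b : set (PT R)) by exact: measurableD.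
(* The perimeter must be finite to be moved to the other side of the inequality; the zero field
   shows that it is nonnegative. *)
have fin : per1 E0 (Ball r) \is a fin_num.
  rewrite ge0_fin_numE; first exact: per1_E0_finite.
  have mI := measurableI _ _ mE mB.
  have := @per1_ge _ E0 (Ball r) (fun=> 0) (fun=> 0) mI mB (testfun0 _) (testfun0 _).
  rewrite expr0n/= addr0 => /(_ (fun _ => ler01)); apply: le_trans.
  rewrite (_ : I _ _ = 0)//.
  have z b' : Dp b' (fun _ : pt R => 0 : R) = fun=> 0.
    by apply/funext => x; exact: Dp_cst.
  rewrite !z -[RHS](mul0r (I (E0 `&` Ball r) (fun=> 0))) -IZ//; last exact: ok0.
  by apply: eq_I => // x _; rewrite addr0 mul0r.
rewrite -(fineK fin) -leeBrDr// -EFinB; set P := fine _.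
apply: per1_le => // phi1 phi2 t1 t2 h.
have [k1 k1E] : exists f, f = cutx 0 (pi / 2) (pi : R) by eexists.
have [k2 k2E] : exists f, f = cutx 0 (b - 1) b by eexists.
have sk1 : Cinf1 k1 by rewrite k1E; exact: Cinf1_cutx.
have sk2 : Cinf1 k2 by rewrite k2E; exact: Cinf1_cutx.
have k101 t : 0 <= k1 t <= 1 by rewrite k1E; exact: cutx01.
have k201 t : 0 <= k2 t <= 1 by rewrite k2E; exact: cutx01.
have [chi chiE] : exists f, f = fun x : pt R => k1 x.1 * k2 x.2 by eexists.
have schi : Cinf (@dir R) chi by rewrite chiE; exact: Cinf_prod.
have chi01 x : 0 <= chi x <= 1.
  rewrite chiE; have /andP[h1 h2] := k101 x.1; have /andP[h3 h4] := k201 x.2.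
  by rewrite mulr_ge0//= mulr_ile1.
have chi0 x : pi <= `|x.1| \/ b <= `|x.2| -> chi x = 0.
  rewrite chiE k1E k2E => -[hx|hx].
    by rewrite (@cutx0 _ 0 _ pi) ?mul0r ?subr0// ltW.
  by rewrite (@cutx0 _ 0 _ b) ?mulr0 ?subr0//; lra.
have tchi : testfun (Ball r) chi.
  apply: (@testfun_compact _ _ (rect (- pi) pi (- b) b)) => //; first exact: compact_rect.
  move=> x nx; apply: chi0; apply: contrapT => /not_orP[/negP h1 /negP h2]; apply: nx.
  move: h1 h2; rewrite -!ltNge => /ltW h1 /ltW h2; split; rewrite /= in_itv/= -ler_norml//.
have s1 := testfun_Cinf t1; have s2 := testfun_Cinf t2.
have ss : Cinf (@dir R) (fun x : pt R => sin x.1).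
  by apply: Cinf_comp (@Cinf_fst R) _; exact: (@Cinf1_cossin R).2.
have [psi1 psi1E] : exists f, f = fun x => (1 - chi x) * phi1 x + chi x * sin x.1 by eexists.
have [psi2 psi2E] : exists f, f = fun x => (1 - chi x) * phi2 x by eexists.
have s1chi : Cinf (@dir R) (fun x => 1 - chi x) by apply: CinfB => //; exact: Cinf_cst.
have tp1 : testfun (Ball r) psi1.
  rewrite psi1E; apply: testfunD; first exact: testfunM.
  rewrite (_ : (fun x => _) = (fun x => sin x.1 * chi x)); first exact: testfunM.
  by apply/funext => x; rewrite mulrC.
have tp2 : testfun (Ball r) psi2 by rewrite psi2E; exact: testfunM.
have hpsi x : psi1 x ^+ 2 + psi2 x ^+ 2 <= 1.
  have hs : sin x.1 ^+ 2 <= 1.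
    by have := cos2Dsin2 x.1; have := sqr_ge0 (cos x.1); clear; move: (cos _ ^+ 2) (sin _ ^+ 2) => c t; lra.
  by rewrite psi1E psi2E; exact: (mix_le1 (chi01 x) (h x) hs).
have sp1 := testfun_Cinf tp1; have sp2 := testfun_Cinf tp2.
pose F x := Dp true psi1 x + Dp false psi2 x.
have oD1 := ok_testfun mB (testfun_Dp true tp1).
have oD2 := ok_testfun mB (testfun_Dp false tp2).
have oF : ok (Ball r) F := okD mB oD1 oD2.
have mIE := measurableI _ _ mE mB.
have mIE1 := measurableI _ _ mE1 mB.
have mA : measurable (E0 `&` rect (- pi) pi (- b) b : set (PT R)) := measurableI _ _ mE mR.
have leP : I (E0 `&` Ball r) F <= P.
  rewrite -lee_fin /P (fineK fin); have := per1_ge mIE mB tp1 tp2 hpsi; rewrite /F; apply.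
have U : E0 `&` Ball r = (E1 b `&` Ball r) `|` (E0 `&` rect (- pi) pi (- b) b).
  apply/seteqP; split=> x.
    by move=> [Ex Bx]; have [Rx|nRx] := pselect (rect (- pi) pi (- b) b x); [right|left].
  by move=> [[[Ex _] Bx]|[Ex /RB Bx]].
have dU : [disjoint E1 b `&` Ball r & E0 `&` rect (- pi) pi (- b) b].
  by apply/eqP/seteqP; split=> // x [[[_ nR] _] [_ Rx]].
have oIE : ok (E0 `&` Ball r) F := okS mB mIE (@subIsetr _ _ _) oF.
have oU : ok ((E1 b `&` Ball r) `|` (E0 `&` rect (- pi) pi (- b) b)) F by rewrite -U.
rewrite U (I_setU mIE1 mA dU oU) in leP.
(* A point of [E1 b] is off the closed box, so the cutoff vanishes in a whole neighbourhood and the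
   new field has the same derivatives there as the given one. *)
have nearE x : E1 b x -> \forall y \near x, chi y = 0.
  move=> [_ nR].
  have [h1|h1] := ltP pi `|x.1|.
    by apply: filterS (near_norm1 h1) => y /ltW hy; apply: chi0; left.
  have [h2|h2] := ltP b `|x.2|.
    by apply: filterS (near_norm2 h2) => y /ltW hy; apply: chi0; right.
  by exfalso; apply: nR; split; rewrite /= in_itv/= -ler_norml.
have EI : I (E1 b `&` Ball r) F = I (E1 b `&` Ball r) (fun x => Dp true phi1 x + Dp false phi2 x).
  apply: eq_I => // x [Ex _]; rewrite /F; congr (_ + _); apply: Dp_near; apply: filterS (nearE x Ex) => y hy.
    by rewrite psi1E hy subr0 mul1r mul0r addr0.
  by rewrite psi2E hy subr0 mul1r.
rewrite EI in leP.
have cF : continuous F by apply: Cinf_continuous; apply: CinfD; exact: Cinf_Dp.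
have EA : I (E0 `&` rect (- pi) pi (- b) b) F =
    J (- b) b (fun y => psi1 (pi / 2, y) - psi1 (- (pi / 2), y)) + J (- (pi / 2)) (pi / 2) (fun x => psi2 (x, b) - psi2 (x, - b)).
  by rewrite (I_E0_rect _ _ cF); exact: (I_rect_divE sp1 sp2 le1 le2).
have fl : 1 <= J (- b) b (fun y => psi1 (pi / 2, y) - psi1 (- (pi / 2), y)) + J (- (pi / 2)) (pi / 2) (fun x => psi2 (x, b) - psi2 (x, - b)).
  apply: (drop_flux b5 sp1 sp2 h) => x; rewrite ?psi1E ?psi2E chiE k1E k2E//.
move: leP; rewrite EA; move: fl; clear; move: (_ + J _ _ _) (I _ _) => u v; lra.
Qed.

(** For t >= 1 the quadratic term is at most K t^2, and exp t >= t^3 / 6; so t >= 6K / e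
    suffices. *)
Lemma exp_beats_sqr (a b d e t0 : R) : 0 <= a -> 0 <= b -> 0 <= d -> 0 < e ->
  exists t, [/\ t0 <= t, 0 <= t & expR (- t) * (a + b * (t + d) ^+ 2) <= e].
Proof.
move=> a0 b0 d0 e0.
pose K := a + b * (1 + d) ^+ 2.
have K0 : 0 <= K by rewrite addr_ge0// mulr_ge0// sqr_ge0.
pose t := 1 + `|t0| + 6 * K / e.
have q0 : 0 <= 6 * K / e by apply: divr_ge0; [exact: mulr_ge0|exact: ltW].
have t1 : 1 <= t by rewrite /t -addrA lerDl addr_ge0.
have tt0 : t0 <= t by rewrite /t; have := ler_norm t0; move: q0; move: (6 * K / e) => q; lra.
exists t; split=> //; first exact: le_trans t1.
have tK : 6 * K <= e * t.
  have -> : e * t = e * (1 + `|t0|) + 6 * K by rewrite /t mulrDr; congr (_ + _); rewrite mulrC divfK// gt_eqF.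
  by rewrite lerDr mulr_ge0 ?addr_ge0// ltW.
have P : a + b * (t + d) ^+ 2 <= K * t ^+ 2.
  have t2 : 1 <= t ^+ 2 by rewrite -[leLHS](expr1n _ 2) ler_sqr ?nnegrE; lra.
  have e1 : a <= a * t ^+ 2 by rewrite ler_peMr.
  have e2 : (t + d) ^+ 2 <= (1 + d) ^+ 2 * t ^+ 2.
    rewrite -exprMn ler_sqr ?nnegrE; [nra|lra|nra].
  have e3 := ler_wpM2l b0 e2.
  by rewrite /K mulrDl; move: e1 e3; rewrite mulrA; lra.
rewrite expRN mulrC ler_pdivrMr ?expR_gt0//.
apply: le_trans P _.
have tg0 : 0 <= t by lra.
have := expR_ge1Dxn 2 tg0.
rewrite (_ : 3`!%:R = 6 :> R)// => hexp.
have t3 : t ^+ 3 / 6 <= expR t by lra.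
apply: (@le_trans _ _ (e * (t ^+ 3 / 6))); last by rewrite ler_pM2l.
have := ler_wpM2r (sqr_ge0 t) tK.
rewrite !exprS expr0; lra.
Qed.

(** For |t| < 3 pi/4, which includes the nodal lines at pi/2 and -pi/2, the function is the sine and
    its derivative exactly cos. The cutoff acts only for 3 pi/4 <= |t| <= pi, where |cos| is bounded
    below and a crude bound on the derivative is enough. *)
Lemma theta_bound : exists C : R, 0 < C /\ forall t : R,
  `|t| <= pi -> `|'D_1 (fun t => sin t * cutx 0 (3 * pi / 4) pi t) t| <= C * `|cos t|.
Proof.
have p0 := pi_gt0 R.
have q0 : 0 <= 3 * (pi : R) / 4 by lra.
have q1 : 3 * (pi : R) / 4 < pi by lra.
pose th (t : R) := sin t * cutx 0 (3 * pi / 4) pi t; rewrite -/th.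
have sth : Cinf1 th by apply: CinfM; [exact: (@Cinf1_cossin R).2|exact: Cinf1_cutx].
have [C' C0 HC] : exists2 C : R, 0 <= C & forall x, `|x| <= pi -> `|'D_1 th x| <= C.
  have c : {within `[(- pi : R), pi], continuous (fun x => 'D_1 th x)}.
    by apply: continuous_subspaceT; exact: Cinf_continuous (Cinf1_derive sth).
  have [N [Nr HN]] := compact_bounded (continuous_compact c (@segment_compact _ _ _)).
  exists (`|N| + 1); first by rewrite addr_ge0.
  move=> x hx; have := HN (`|N| + 1); rewrite ltr_pwDr ?ler_norm// => /(_ isT ('D_1 th x)); apply.
  by exists x => //=; rewrite in_itv/= -ler_norml.
have c4 : 0 < cos ((pi : R) / 4) by apply: cos_gt0_pihalf; apply/andP; split; lra.
have cC : 0 <= C' / cos (pi / 4) by apply: divr_ge0 => //; exact: ltW.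
exists (1 + C' / cos (pi / 4)); split; first by rewrite ltr_pwDl.
move=> t ht; have [h|h] := ltP `|t| (3 * pi / 4).
  have -> : 'D_1 th t = cos t.
    rewrite -[RHS](@derive_val _ _ _ _ _ _ _ (is_derive_sin t)); apply: near_eq_derive.
    have c : {for t, continuous (fun y : R => `|y|)} by apply: cvg_norm; exact: cvg_id.
    near=> y; have hy : `|y| < 3 * pi / 4 by near: y; exact: (c _ (lt_nbhsl h)).
    by rewrite /th cutx1 ?mulr1// subr0 ltW.
  by rewrite ler_peMl// lerDl.
have hc : cos (pi / 4) <= `|cos t|.
  rewrite -[in leRHS]cos_norm -normrN; apply: le_trans (ler_norm _).
  have -> : - cos `|t| = cos (pi - `|t|) by rewrite cosB cospi sinpi mul0r addr0 mulN1r.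
  have [<-//|ne] := eqVneq (pi / 4) (pi - `|t|).
  rewrite ltW// ltr_cos ?in_itv/=; do ?[by apply/andP; split; lra].
  by rewrite lt_neqAle eq_sym ne/=; lra.
apply: le_trans (HC _ ht) _.
rewrite mulrDl mul1r -[leLHS]add0r; apply: lerD; first exact: normr_ge0.
by rewrite mulrAC ler_pdivlMr// ler_wpM2l.
Unshelve. all: by end_near. Qed.

End strips.

(** * Lower bound for the classical perimeter in a large ball *)

Section lower1.
Context {R : realType}.
Local Notation mu := (@lebesgue_measure R).
Local Notation leb := (@leb2 R).

Lemma sign_flip (c e w : R) : 0 < e -> (0 < c * e) != (0 < c * e + w) -> `|c| * e <= `|w|.
Proof.
move=> e0; have -> : `|c| * e = `|c * e| by rewrite normrM (gtr0_norm e0).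
move: (c * e) => d h.
have [d0|d0] := ltP 0 d.
  rewrite (gtr0_norm d0) -normrN; apply: le_trans (ler_norm _).
  by move: h; rewrite d0 /=; have [//|h _] := ltP 0 (d + w); lra.
rewrite (ler0_norm d0); apply: le_trans (ler_norm _).
move: h; rewrite [0 < d]ltNge d0 /=; have [h _|//] := ltP 0 (d + w); lra.
Qed.

Lemma measurable_gt0_on (B : set (PT R)) (f : pt R -> R) : measurable B -> measurable_fun B f ->
  measurable ([set x | 0 < f x] `&` B : set (PT R)).
Proof.
move=> mB mf; rewrite setIC; have := mf mB _ (measurable_itv `]0, +oo[).
by rewrite (_ : f @^-1` _ = [set x | 0 < f x])//; apply/seteqP; split=> x /=; rewrite in_itv/= andbT.
Qed.

Lemma theta_off (t : R) : pi < `|t| -> 'D_1 (fun t => sin t * cutx 0 (3 * pi / 4) pi t) t = 0.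
Proof.
move=> h; have p0 := pi_gt0 R.
rewrite -[RHS](derive_cst (0 : R) (1 : R) t); apply: near_eq_derive.
have c : {for t, continuous (fun y : R => `|y|)} by apply: cvg_norm; exact: cvg_id.
near=> y; have hy : pi < `|y| by near: y; exact: (c _ (lt_nbhsr h)).
by rewrite cutx0 ?mulr0 ?subr0// ltW.
Unshelve. all: by end_near. Qed.

(** With c = |cos x1|, v = |w| and e = exp x2, a flipped sign gives c <= eta v; then v <= 1 + v^2
    brings in the L^2 norm, in place of Cauchy-Schwarz. *)
Lemma weight_le (C eta c v e : R) : 0 <= C -> 0 < e -> e^-1 <= eta -> c * e <= v -> 0 <= c ->
  C * c <= C * eta * (1 + v ^+ 2).
Proof.
move=> C0 e0 ee h c0; rewrite -mulrA ler_wpM2l//.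
have i0 : 0 < e^-1 by rewrite invr_gt0.
have h1 : c <= v * e^-1 by rewrite ler_pdivlMr.
have v0 : 0 <= v by apply: le_trans h; rewrite mulr_ge0// ltW.
have h2 := ler_wpM2l v0 ee.
have h3 : v <= 1 + v ^+ 2 by have := sqr_ge0 (v - 1); nra.
have h4 := ler_wpM2l (le_trans (ltW i0) ee) h3.
lra.
Qed.

(** Here a^2 <= 16 and b <= t + 2L + 2, so the radius exceeds the height by at least 9 and its
    square by at least 81. *)
Lemma window_lt (t L q a b : R) : 0 <= t -> 0 <= L -> 0 < q -> q < 4 -> - q <= a <= q ->
  t + L + 1 - (L + 1) <= b <= t + L + 1 + (L + 1) -> a ^+ 2 + b ^+ 2 < (t + (2 * L + 11)) ^+ 2.
Proof.
move=> t0 L0 q0 q4 /andP[a1 a2] /andP[b1 b2].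
have a16 : a ^+ 2 <= 16 by nra.
have b0 : 0 <= b by lra.
have bb : b <= t + 2 * L + 2 by lra.
have b3 : b ^+ 2 <= (t + 2 * L + 2) ^+ 2 by rewrite ler_sqr ?nnegrE; lra.
clear -t0 L0 a16 b3; nra.
Qed.

(** The field is 1 on one side of the strip and -1 on the other, along a plateau of length 2L. *)
Lemma flux_lower (h L : R) (th k : R -> R) : 0 <= L ->
  th = (fun t => sin t * cutx 0 (3 * pi / 4) pi t) -> k = cutx h L (L + 1) ->
  4 * L <= J (h - (L + 1)) (h + (L + 1)) (fun y => th (pi / 2) * k y - th (- (pi / 2)) * k y).
Proof.
move=> L0 thE kE; have p0 := pi_gt0 R.
have q0 : 0 <= 3 * (pi : R) / 4 by lra.
have q1 : 3 * (pi : R) / 4 < pi by lra.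
have q2 : (pi : R) / 2 <= 3 * pi / 4 by lra.
have q3 : 0 <= (pi : R) / 2 by lra.
have LS : L < L + 1 by rewrite ltrDl.
have sk : Cinf1 k by rewrite kE; exact: Cinf1_cutx.
have k01 s : 0 <= k s <= 1 by rewrite kE; exact: cutx01.
have -> : (fun y => th (pi / 2) * k y - th (- (pi / 2)) * k y) = fun y => 2 * k y.
  apply/funext => y; rewrite thE sinN sin_pihalf !cutx1 ?subr0 ?normrN ?ger0_norm//; lra.
have ck : continuous (fun y => 2 * k y).
  by move=> y; apply: cvgM; [exact: cvg_cst|exact: Cinf_continuous sk y].
apply: (@le_trans _ _ (J (h - L) (h + L) (fun y => 2 * k y))); last first.
  apply: J_subset => //; [lra|lra|by move=> y; have /andP[a _] := k01 y; rewrite mulr_ge0].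
have hL : h - L <= h + L by lra.
have -> : 4 * L = 2 * (h + L - (h - L)) by lra.
rewrite -(J_cst 2 hL); apply: J_le => //; first by move=> y; exact: cvg_cst.
by move=> y /andP[h1 h2]; rewrite kE cutx1 ?mulr1// ler_norml; apply/andP; split; lra.
Qed.

Lemma I_rect_cst1 (a b c d : R) : a <= b -> c <= d -> I (rect a b c d) (fun=> 1) = (b - a) * (d - c).
Proof.
move=> ab cd; have mR := measurable_rect a b c d.
have o : ok (rect a b c d) (fun=> 1 : R) by apply: continuous_ok_rect => x; exact: cvg_cst.
by apply: EFin_inj; rewrite -EFin_I// integral_cst// mul1e; exact: leb2_rect.
Qed.

(* Test with the field (sin x1, 0) cut off around height h; its divergence vanishes
   with cos x1, so it is small wherever the perturbation w can flip the sign of u0. *)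
Lemma per1_lower (p M rmin : R) : 0 <= M -> exists2 r, rmin < r & 0 < r /\
  forall w : pt R -> R, measurable_fun (Ball r : set (PT R)) w -> ok (Ball r) (fun x => w x ^+ 2) ->
    I (Ball r) (fun x => w x ^+ 2) <= 16 * r ^+ 2 * M ->
    (p%:E < per1 [set x : pt R | (0 < u0 x + w x)%R] (Ball r))%E.
Proof.
move=> M0; have p0 := pi_gt0 R; have p4 := pi_lt4 (R := R).
have [C [C0 HC]] := @theta_bound R.
(* The flux for [E0] is at least 4L = 4|p| + 4, and the sign flips will cost at most 1. *)
have [L LE] : exists L : R, L = `|p| + 1 by eexists.
have L0 : 0 <= L by rewrite LE addr_ge0.
have LS : L < L + 1 by rewrite ltrDl.
have a0 : 0 <= 4 * pi * (L + 1) by clear -p0 L0; nra.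
have b0 : 0 <= 16 * M by clear -M0; lra.
have d0 : 0 <= 2 * L + 11 by clear -L0; lra.
have C1 : 0 < C^-1 by rewrite invr_gt0.
(* The constant term is the area of the window, 2 pi times 2(L + 1); the quadratic one is the L^2
   bound for the radius t + 2L + 11; C comes from [theta_bound]. *)
have [t [t1 t0 ht]] := exp_beats_sqr rmin a0 b0 d0 C1.
have [r rE] : exists r : R, r = t + (2 * L + 11) by eexists.
have [h hE] : exists h : R, h = t + L + 1 by eexists.
have r0 : 0 < r by rewrite rE; clear -t0 L0; lra.
exists r; first by rewrite rE; clear -t1 L0; lra.
split=> // w mw ow Iw.
have mB := measurable_Ball (ltW r0).
have [th thE] : exists f : R -> R, f = fun t => sin t * cutx 0 (3 * pi / 4) pi t by eexists.
have [k2 k2E] : exists f : R -> R, f = cutx h L (L + 1) by eexists.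
have q0 : 0 <= 3 * (pi : R) / 4 by clear -p0; lra.
have q1 : 3 * (pi : R) / 4 < pi by clear -p0; lra.
have L1 : 0 <= L + 1 by rewrite addr_ge0.
have sth : Cinf1 th by rewrite thE; apply: CinfM; [exact: (@Cinf1_cossin R).2|exact: Cinf1_cutx].
have sk2 : Cinf1 k2 by rewrite k2E; exact: Cinf1_cutx.
have k201 s : 0 <= k2 s <= 1 by rewrite k2E; exact: cutx01.
have hth s : `|th s| <= 1.
  rewrite thE normrM mulr_ile1//; first exact: sin_max.
  by have /andP[a b] := cutx01 0 s q0 q1; rewrite ger0_norm.
pose phi x : R := th x.1 * k2 x.2.
have sphi : Cinf (@dir R) phi by exact: Cinf_prod.
pose W : set (pt R) := rect (- pi) pi (h - (L + 1)) (h + (L + 1)).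
have WB : W `<=` Ball r.
  move=> x [/= x1 x2]; rewrite BallE ?ltW//= /q2; move: x1 x2; rewrite !in_itv/= hE rE.
  exact: window_lt.
have tphi : testfun (Ball r) phi.
  apply: (testfun_compact sphi (@compact_rect _ _ _ _ _) WB) => x nW.
  have [h1|h1] := leP pi `|x.1|.
    by rewrite /phi thE (@cutx0 _ 0 _ pi) ?subr0 ?mulr0 ?mul0r// ltW.
  have [h2|h2] := leP (L + 1) `|x.2 - h|.
    by rewrite /phi k2E cutx0// mulr0.
  exfalso; apply: nW; split; rewrite /= in_itv/=.
    by rewrite -ler_norml ltW.
  by move: h2; rewrite ltr_norml => /andP[? ?]; apply/andP; split; lra.
have hphi x : phi x ^+ 2 + (fun=> 0 : R) x ^+ 2 <= 1.
  rewrite expr0n/= addr0 -real_normK ?num_real// expr_le1//.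
  rewrite normrM mulr_ile1//; have /andP[a b] := k201 x.2; by rewrite ger0_norm.
have FE : (fun x => Dp true phi x + Dp false (fun=> 0) x) = (fun x => 'D_1 th x.1 * k2 x.2).
  by apply/funext => x; rewrite Dp_cst addr0 Dp_prod1.
have mu0 : measurable_fun (Ball r : set (PT R)) (fun x => u0 x + w x).
  apply: measurable_funD => //; apply: measurable_funTS; apply: continuous_measurable_pt.
  exact: Cinf_continuous (@Cinf_u0 R).
have mE' := measurable_gt0_on mB mu0.
have mE0 := measurableI _ _ (@measurable_E0 R) mB.
have [F FF] : exists f : pt R -> R, f = fun x => 'D_1 th x.1 * k2 x.2 by eexists.
have cF : continuous F.
  by rewrite FF -FE; apply: Cinf_continuous; apply: CinfD; apply: Cinf_Dp => //; exact: Cinf_cst.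
have F0 x : ~ W x -> F x = 0.
  move=> nW; rewrite FF; have [h1|h1] := ltP pi `|x.1|; first by rewrite thE theta_off// mul0r.
  have [h2|h2] := leP (L + 1) `|x.2 - h|; first by rewrite k2E cutx0// mulr0.
  exfalso; apply: nW; split; rewrite /= in_itv/=; first by rewrite -ler_norml.
  by move: h2; rewrite ltr_norml => /andP[? ?]; apply/andP; split; lra.
have FC x : `|F x| <= C * `|cos x.1|.
  rewrite FF normrM; have [h1|h1] := ltP pi `|x.1|.
    by rewrite thE theta_off// normr0 mul0r mulr_ge0// ltW.
  rewrite -[leRHS]mulr1; apply: ler_pM => //.
    by rewrite thE; exact: HC.
  by have /andP[a b] := k201 x.2; rewrite ger0_norm.
have G0 : 4 * L <= I (E0 `&` Ball r) F.
  have W1 : h - (L + 1) <= h + (L + 1) by clear -L0; lra.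
  rewrite (@I_setI_sub _ _ (E0 `&` W)); last 2 first.
  - by move=> x [Ex _] nx; apply: F0 => Wx; exact: nx.
  - exact: setIS.
  rewrite (I_E0_rect _ _ cF).
  have -> : F = Dp true phi by rewrite FF; apply/funext => x; rewrite Dp_prod1.
  by rewrite I_rect_Dp1//; [exact: flux_lower|clear -p0; lra].
have EI := per1_ge mE' mB tphi (testfun0 _) hphi.
rewrite FE -FF in EI; apply: lt_le_trans EI; rewrite lte_fin.
have [eta etaE] : exists e, e = expR (- t) by eexists.
pose one : pt R -> R := fun=> 1.
(* Majorant of the divergence where the sign has flipped; the indicator of the window comes from the
   1 in |w| <= 1 + w^2. *)
pose G (x : pt R) : R := C * eta * ((one \_ W) x + w x ^+ 2).
have mW : measurable (W : set (PT R)) := measurable_rect _ _ _ _.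
have o1 : ok (Ball r) (one \_ W).
  by apply: ok_restrict => //; apply: continuous_ok_Ball; [exact: ltW|move=> x; exact: cvg_cst].
have oG : ok (Ball r) G by apply: okZ => //; exact: okD.
have IG : I (Ball r) G <= 1.
  rewrite (IZ mB _ (okD mB o1 ow)) (ID mB o1 ow) -I_restrict setIC (setIidl WB).
  have -> : I W one = 4 * pi * (L + 1).
    rewrite I_rect_cst1; [lra|clear -p0; lra|clear -L0; lra].
  rewrite -mulrA -ler_pdivlMl// mulr1; apply: le_trans ht; rewrite -etaE.
  by rewrite ler_wpM2l ?etaE ?expR_ge0// lerD2l; move: Iw; rewrite rE mulrAC.
have [E' E'E] : exists A : set (PT R), A = [set x : pt R | 0 < u0 x + w x] `&` Ball r by eexists.
rewrite -E'E in mE' *.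
have oF := continuous_ok_Ball (ltW r0) cF.
have oE' : ok (Ball r) (F \_ E') by exact: ok_restrict.
have oE0 : ok (Ball r) (F \_ E0) by apply: ok_restrict => //; exact: measurable_E0.
have ptw x : Ball r x -> `|(F \_ E0) x - (F \_ E') x| <= G x.
  move=> Bx; have G0' : 0 <= G x.
    rewrite /G !mulr_ge0 ?(ltW C0)// ?etaE ?expR_ge0// addr_ge0 ?sqr_ge0// patchE.
    by case: ifP.
  have [Wx|nW] := pselect (W x); last first.
    by rewrite !patchE F0// !if_same subr0 normr0.
  have S : (x \in E') = (0 < u0 x + w x).
    by rewrite E'E; apply/idP/idP; [rewrite inE => -[]|move=> hx; rewrite inE; split].
  have S0 : (x \in E0) = (0 < u0 x) by apply/idP/idP; rewrite inE.
  rewrite !patchE S S0; have [e|ne] := eqVneq (0 < u0 x) (0 < u0 x + w x).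
    by rewrite e; case: ifP => _; rewrite subrr normr0.
  (* The window starts at height h - (L + 1) = t, so exp(-x2) <= exp(-t) on it. *)
  have fx : `|F x| <= G x.
    apply: le_trans (FC x) _; rewrite /G patchE mem_set//= -[w x ^+ 2]real_normK ?num_real//.
    apply: (@weight_le _ _ _ _ (expR x.2)) => //; first exact: ltW.
    - exact: expR_gt0.
    - rewrite etaE -expRN ler_expR lerN2; move: Wx => [_ /=]; rewrite in_itv/= hE => /andP[hx _].
      by apply: le_trans hx; lra.
    - by apply: sign_flip; [exact: expR_gt0|exact: ne].
  by move: ne; case: ifP => _; case: ifP => _ // _; rewrite ?subr0 ?sub0r ?normrN.
have D : I (Ball r) (F \_ E0) - I (Ball r) (F \_ E') <= 1.
  apply: le_trans IG; rewrite -IB//; apply: le_trans (ler_norm _) _.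
  by apply: I_abs_le => //; exact: okB.
have EB : Ball r `&` E' = E' by rewrite E'E; apply: setIidr; exact: subIsetr.
rewrite -EB I_restrict; move: G0; rewrite setIC I_restrict.
move: D; rewrite LE; have := ler_norm p; have := normr_ge0 p; clear.
move: (`|p|) (I _ _) (I _ _) => a b c; lra.
Qed.

End lower1.

(** * The fractional kernel *)

Section kernel_bound.
Context {R : realType}.
Local Notation mu := (@lebesgue_measure R).

Lemma int_powR (p c d : R) : 0 < c -> c < d -> p != 0 ->
  (\int[mu]_(x in `[c, d]) (x `^ (p - 1))%:E = ((d `^ p - c `^ p) / p)%:E)%E.
Proof.
move=> c0 cd p0.
have dF (q x : R) : 0 < x -> is_derive x (1:R) (fun x => x `^ q) (q * x `^ (q - 1)).
  move=> x0; have h : x \in `]0, +oo[ by rewrite in_itv/= x0.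
  by split; [exact: derivable_powR|rewrite -derive1E powR_derive1].
have cF (q x : R) : 0 < x -> {for x, continuous (fun x : R => x `^ q)}.
  move=> x0; apply: differentiable_continuous; apply/derivable1_diffP.
  by have [] := dF q _ x0.
pose F (x : R) := p^-1 * x `^ p.
have cFF x : 0 < x -> {for x, continuous F}.
  by move=> x0; apply: cvgM; [exact: cvg_cst|exact: cF].
rewrite (@continuous_FTC2 _ _ F)//.
- by rewrite -EFinB /F -mulrBr mulrC.
- apply: continuous_in_subspaceT => x; rewrite inE/= in_itv/= => /andP[cx _].
  by apply: cF; exact: lt_le_trans cx.
- split.
  + move=> x; rewrite in_itv/= => /andP[cx _]; apply: derivableM; first exact: derivable_cst.
    by have [] := dF p _ (lt_trans c0 cx).
  + by apply: cvg_at_right_filter; exact: cFF.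
  + by apply: cvg_at_left_filter; apply: cFF; exact: lt_trans cd.
- move=> x; rewrite in_itv/= => /andP[cx _].
  have D := dF p _ (lt_trans c0 cx); rewrite derive1E.
  have -> : F = p^-1 \*: (fun x : R => x `^ p) by apply/funext.
  by rewrite deriveZ ?derive_val// /GRing.scale/= mulrA mulVf// mul1r.
Qed.

(** For a < 1 < b the first power is the smaller near 0, where it is integrable, and the second at
    infinity, where it is integrable. *)
Definition fmin (a b t : R) : R := Num.min (`|t| `^ (- a)) (`|t| `^ (- b)).

Lemma fmin_ge0 a b t : 0 <= fmin a b t.
Proof. by rewrite /fmin le_min !powR_ge0. Qed.

Lemma measurable_fmin a b : measurable_fun [set: R] (fmin a b).
Proof.
by apply: measurable_minr; (apply: (@measurableT_comp _ _ _ _ _ _ (@powR R ^~ _)); [exact: measurable_powR|exact: normr_measurable]).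
Qed.

Lemma int_fmin_pos (a b : R) : 0 < a < 1 -> 1 < b ->
  (\int[mu]_(t in `]0%R, +oo[) (fmin a b t)%:E <= ((1 - a)^-1 + (b - 1)^-1)%:E)%E.
Proof.
move=> /andP[a0 a1] b1.
(* The shift to n + 2 keeps 1 strictly inside, so each interval splits there into two nondegenerate
   ones. *)
pose F (n : nat) := `[(n.+2%:R : R)^-1, n.+2%:R]%classic.
have mF n : measurable (F n) by exact: measurable_itv.
have ndF : nondecreasing_seq F.
  apply/nondecreasing_seqP => n; rewrite subsetEset => x; rewrite /F /= !in_itv/= => /andP[h1 h2].
  rewrite (le_trans _ h1) ?(le_trans h2)// ?ler_nat// lef_pV2 ?posrE ?ltr0n// ler_nat//.
have mf n : measurable_fun (F n) (fun t => (fmin a b t)%:E).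
  by apply/measurable_EFinP; apply: measurable_funTS; exact: measurable_fmin.
have U : `]0, +oo[%classic = \bigcup_n F n.
  apply/seteqP; split=> [x /=|x [n _]]; rewrite /F /= !in_itv/= ?andbT; last first.
    by move=> /andP[h _]; apply: lt_le_trans h; rewrite invr_gt0 ltr0n.
  move=> x0; pose m := Num.bound (x + x^-1).
  have hm : x + x^-1 < m%:R by apply: archi_boundP; apply: addr_ge0; rewrite ?invr_ge0; exact: ltW.
  have xi : 0 < x^-1 by rewrite invr_gt0.
  have m2 : (m%:R : R) <= m.+2%:R by rewrite ler_nat ltnW// ltnW.
  exists m => //=; rewrite in_itv/=; apply/andP; split; last by lra.
  by rewrite invf_ple ?posrE ?ltr0n//; lra.
rewrite U.
have f0 i x : F i x -> (0%R <= (fmin a b x)%:E)%E by rewrite lee_fin fmin_ge0.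
have cv := @ge0_nondecreasing_set_cvg_integral _ (measurableTypeR R) R F (fun t => (fmin a b t)%:E) mu ndF mF mf f0.
rewrite -(cvg_lim _ cv) //.
apply: lime_le; first by apply: cvgP cv.
near=> n.
have n0 : 0 < (n.+2%:R : R) by rewrite ltr0n.
have n1 : 1 < (n.+2%:R : R) by rewrite ltr1n.
have ni : (n.+2%:R : R)^-1 < 1 by rewrite invf_lt1.
have ni0 : 0 < (n.+2%:R : R)^-1 by rewrite invr_gt0.
have sub : F n `<=` `[(n.+2%:R : R)^-1, 1] `|` `[1, n.+2%:R].
  move=> x; rewrite /F /= !in_itv/= => /andP[h1 h2].
  by have [h|h] := leP x 1; [left; rewrite h1|right; rewrite h2 ltW].
have mfm A : measurable_fun A (fun t => (fmin a b t)%:E).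
  by apply/measurable_EFinP; apply: measurable_funTS; exact: measurable_fmin.
have mpw q A : measurable_fun A (fun x : R => (x `^ q)%:E).
  by apply/measurable_EFinP; apply: measurable_funTS; exact: measurable_powR.
apply: (@le_trans _ _ (\int[mu]_(t in `[((n.+2%:R : R)^-1)%R, 1%R] `|` `[1%R, n.+2%:R%R]) (fmin a b t)%:E)%E).
  apply: ge0_subset_integral; [exact: mF|apply: measurableU; exact: measurable_itv|exact: mfm| |exact: sub].
  by move=> x _; rewrite lee_fin fmin_ge0.
have -> : `[(n.+2%:R : R)^-1, 1] `|` `[1, n.+2%:R] = `[(n.+2%:R : R)^-1, 1] `|` `]1, n.+2%:R]%classic.
  apply/seteqP; split=> x /= [h|]; [by left| |by left|]; rewrite !in_itv/= => /andP[h1 h2].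
    by move: h1; rewrite le_eqVlt => /predU1P[<-|h1]; [left; rewrite lexx ltW|right; rewrite h1].
  by right; rewrite h2 ltW.
rewrite ge0_integral_setU; [|exact: measurable_itv|exact: measurable_itv|exact: mfm| |]; last 2 first.
- by move=> x _; rewrite lee_fin fmin_ge0.
- apply/eqP/seteqP; split=> // x [/=]; rewrite !in_itv/= => /andP[_ h1] /andP[h2 _].
  by move: h2; rewrite ltNge h1.
rewrite EFinD; apply: leeD.
  apply: (@le_trans _ _ (\int[mu]_(t in `[((n.+2%:R : R)^-1)%R, 1%R]) (t `^ ((1 - a) - 1))%:E)%E).
    apply: ge0_le_integral; [exact: measurable_itv| |exact: mfm|exact: mpw|].
      by move=> x _; rewrite lee_fin fmin_ge0.
    move=> x /=; rewrite in_itv/= => /andP[h1 _]; rewrite lee_fin /fmin ge_min.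
    have x0 : 0 < x := lt_le_trans ni0 h1.
    rewrite (gtr0_norm x0); apply/orP; left; have -> : 1 - a - 1 = - a by lra.
    exact: lexx.
  rewrite int_powR//; last by rewrite subr_eq0 gt_eqF.
  by rewrite lee_fin powR1 ler_pdivrMr ?subr_gt0// mulVf ?subr_eq0 ?gt_eqF//.
apply: (@le_trans _ _ (\int[mu]_(t in `[1%R, n.+2%:R]) (t `^ ((1 - b) - 1))%:E)%E).
  apply: (@le_trans _ _ (\int[mu]_(t in `]1%R, n.+2%:R]) (t `^ ((1 - b) - 1))%:E)%E).
    apply: ge0_le_integral; [exact: measurable_itv| |exact: mfm|exact: mpw|].
      by move=> x _; rewrite lee_fin fmin_ge0.
    move=> x /=; rewrite in_itv/= => /andP[h1 _]; rewrite lee_fin /fmin ge_min.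
    have x0 : 0 < x := lt_trans ltr01 h1.
    rewrite (gtr0_norm x0); apply/orP; right; have -> : 1 - b - 1 = - b by lra.
    exact: lexx.
  apply: ge0_subset_integral; [exact: measurable_itv|exact: measurable_itv|exact: mpw| |].
    by move=> x _; rewrite lee_fin powR_ge0.
  by move=> x /=; rewrite !in_itv/= => /andP[/ltW-> ->].
have b0 : 0 < b - 1 by rewrite subr_gt0.
rewrite int_powR//; last by rewrite subr_eq0 lt_eqF.
rewrite lee_fin powR1 -[1 - b]opprB invrN mulrN -mulNr opprB ler_pdivrMr//.
by rewrite mulVf ?gt_eqF// lerBlDr lerDl powR_ge0.
Unshelve. all: by end_near. Qed.

Lemma int_fmin (a b : R) : 0 < a < 1 -> 1 < b -> (\int[mu]_t (fmin a b t)%:E < +oo)%E.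
Proof.
move=> ha hb; have h := int_fmin_pos ha hb.
have mfm A : measurable_fun A (fun t => (fmin a b t)%:E).
  by apply/measurable_EFinP; apply: measurable_funTS; exact: measurable_fmin.
have f0 x : (0 <= (fmin a b x)%:E)%E by rewrite lee_fin fmin_ge0.
have U : [set: R] = `]-oo, 0] `|` `]0, +oo[.
  apply/seteqP; split=> // x _ /=; rewrite !in_itv/= andbT.
  by have [|] := leP x 0; [left|right].
rewrite U ge0_integral_setU//; [|exact: mfm|].
all: swap 1 2.
  apply/eqP/seteqP; split=> // x [/=]; rewrite !in_itv/= andbT => h1.
  by rewrite ltNge h1.
apply: lte_add_pinfty; last by apply: le_lt_trans h (ltry _).
have -> : (\int[mu]_(x in `]-oo, 0%R]) (fmin a b x)%:E = \int[mu]_(x in `]-oo, 0%R]) (fmin a b (- x))%:E)%E.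
  by apply: eq_integral => x _; rewrite /fmin normrN.
rewrite -(ge0_integration_by_substitution0 (mfm _) f0).
by rewrite -integral_itv_obnd_cbnd; [exact: le_lt_trans h (ltry _)|exact: mfm].
Qed.

Lemma min_powR (x s : R) : 0 < x -> 0 <= s <= 1 -> Num.min 1 x <= x `^ s.
Proof.
move=> x0 /andP[s0 s1]; rewrite ge_min; have [h|h] := leP x 1.
  by apply/orP; right; apply: ger1_powR => //; rewrite x0.
apply/orP; left; rewrite -(powRr0 x); apply: ler_powR => //; exact: ltW.
Qed.

Lemma powR_anti (r x y : R) : 0 <= r -> 0 < x -> x <= y -> y `^ (- r) <= x `^ (- r).
Proof.
move=> r0 x0 xy; have y0 := lt_le_trans x0 xy.
rewrite !powRN lef_pV2 ?posrE ?powR_gt0//.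
by apply: ge0_ler_powR => //; rewrite nnegrE ltW.
Qed.

Lemma enorm_ge1 (z : pt R) : `|z.1| <= enorm z.
Proof. by rewrite -sqrtr_sqr ler_wsqrtr// lerDl sqr_ge0. Qed.

Lemma enorm_ge2 (z : pt R) : `|z.2| <= enorm z.
Proof. by rewrite -sqrtr_sqr ler_wsqrtr// lerDr sqr_ge0. Qed.

(** As rho dominates both t and u, rho^(-q) <= t^(-a-s) u^(-b). The minimum is at most (t/B)^s: it
    cancels the excess t^(-s) and leaves B^(-s) <= B^(-d). *)
Lemma kernel_split (q a b s d B rho t u : R) : 0 <= a -> 0 <= b -> q = a + b + s ->
  0 <= d -> d <= s <= 1 -> 1 <= B -> 0 < t -> 0 < u -> t <= rho -> u <= rho ->
  rho `^ (- q) * Num.min 1 (t / B) <= B `^ (- d) * (t `^ (- a) * u `^ (- b)).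
Proof.
move=> a0 b0 -> d0 /andP[ds s1] B1 t0 u0 tr ur.
have r0 := lt_le_trans t0 tr; have B0 : 0 < B := lt_le_trans ltr01 B1.
have s0 := le_trans d0 ds.
have h1 : Num.min 1 (t / B) <= t `^ s * B `^ (- d).
  apply: le_trans (min_powR _ (_ : 0 <= s <= 1)) _; [exact: divr_gt0|by rewrite s0|].
  rewrite powRM ?(ltW t0)// ?invr_ge0 ?(ltW B0)//; apply: ler_wpM2l; first exact: powR_ge0.
  rewrite -powR_inv1 ?(ltW B0)// -powRrM mulN1r; apply: ler_powR => //.
  by rewrite lerN2.
have h2 : rho `^ (- (a + b + s)) <= t `^ (- (a + s)) * u `^ (- b).
  have -> : - (a + b + s) = - (a + s) + - b by lra.
  rewrite powRD; last by apply/implyP => _; rewrite gt_eqF.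
  apply: ler_pM; rewrite ?powR_ge0//; apply: powR_anti => //; exact: addr_ge0.
have m0 : 0 <= Num.min 1 (t / B) by rewrite le_min ler01 divr_ge0 ?ltW.
apply: le_trans (ler_pM (powR_ge0 _ _) m0 h2 h1) _.
have -> : t `^ (- a) = t `^ (- (a + s)) * t `^ s.
  rewrite -powRD; last by apply/implyP => _; rewrite gt_eqF.
  by congr (_ `^ _); lra.
by rewrite le_eqVlt; apply/orP; left; apply/eqP; ring.
Qed.

(* The exponents straddle 1, so that fsig is integrable on the line, and the sum of any
   two of them is between 1 + sigma and 2 + sigma / 2: what is left of 2 + sigma is the
   power in [sigma / 2, 1] by which min 1 (t / B) is bounded. *)
Definition fsig (sigma : R) := fmin ((1 + sigma) / 2) (1 + sigma / 4).

Lemma kernel_fmin (sigma B rho t u : R) : 0 < sigma < 1 -> 1 <= B -> t != 0 -> u != 0 ->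
  `|t| <= rho -> `|u| <= rho ->
  rho `^ (- 2 - sigma) * Num.min 1 (`|t| / B) <= B `^ (- (sigma / 2)) * (fsig sigma t * fsig sigma u).
Proof.
move=> /andP[s0 s1] B1 t0 u0 tr ur.
have t1 : 0 < `|t| by rewrite normr_gt0.
have u1 : 0 < `|u| by rewrite normr_gt0.
have -> : - 2 - sigma = - (2 + sigma) by lra.
have key a b : a = (1 + sigma) / 2 \/ a = 1 + sigma / 4 -> b = (1 + sigma) / 2 \/ b = 1 + sigma / 4 ->
    rho `^ (- (2 + sigma)) * Num.min 1 (`|t| / B) <= B `^ (- (sigma / 2)) * (`|t| `^ (- a) * `|u| `^ (- b)).
  move=> ha hb; apply: (@kernel_split _ _ _ (2 + sigma - a - b)) => //.
  - by case: ha => ->; lra.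
  - by case: hb => ->; lra.
  - by lra.
  - by lra.
  - by case: ha => ->; case: hb => ->; apply/andP; split; lra.
move: key; move: (Num.min 1 _) => m key.
by rewrite /fsig /fmin /Order.min; case: ifP => _; case: ifP => _; apply: key; auto.
Qed.

End kernel_bound.

(** * Translation invariance of Lebesgue measure *)

Section translation.
Context {R : realType}.
Local Notation mu := (@lebesgue_measure R).
Local Notation lam := (mu \x mu)%E.
Local Open Scope ereal_scope.

(** Uniqueness of Lebesgue measure, given its values on half-open intervals. *)
Lemma lebesgue_measureD (a : R) (A : set (measurableTypeR R)) : measurable A ->
  pushforward mu ((fun x => a + x)%R : _ -> measurableTypeR R) A = mu A.
Proof.
have ma : measurable_fun setT ((fun x => a + x)%R : measurableTypeR R -> measurableTypeR R).
  by apply: measurable_funD.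
pose phi : {mfun measurableTypeR R >-> measurableTypeR R} :=
  HB.pack ((fun x => a + x)%R : measurableTypeR R -> measurableTypeR R) (isMeasurableFun.Build _ _ _ _ _ ma).
move=> mA; apply/esym; apply: (@lebesgue_measure_unique R (pushforward mu phi)) => //= _ [[c d]] _ <-.
rewrite /pushforward (_ : _ @^-1` _ = [set` `](c - a)%R, (d - a)%R]]).
  rewrite /= !lebesgue_measure_itv/= !lte_fin ltrD2r; case: ifP => // _.
  by rewrite -!EFinB; congr (_%:E); lra.
by apply/seteqP; split=> x /=; rewrite !in_itv/= => /andP[h1 h2]; apply/andP; split; lra.
Qed.

Lemma transl1 (a : R) (f : R -> \bar R) : measurable_fun [set: measurableTypeR R] f ->
  (forall x, 0 <= f x) -> \int[mu]_x f (a + x)%R = \int[mu]_x f x.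
Proof.
move=> mf f0; have ma : measurable_fun setT ((fun x => a + x)%R : measurableTypeR R -> measurableTypeR R).
  by apply: measurable_funD.
have := @ge0_integral_pushforward _ _ _ _ _ _ ma mu setT f measurableT mf (fun x _ => f0 x).
rewrite preimage_setT => <-.
by apply: eq_measure_integral => A mA _; exact: lebesgue_measureD.
Qed.

Lemma measurable_transl (a : pt R) : measurable_fun setT ((fun z => a + z)%R : PT R -> PT R).
Proof.
apply/measurable_fun_pairP; split => /=.
  exact: (measurable_funD (measurable_cst _) measurable_fst).
exact: (measurable_funD (measurable_cst _) measurable_snd).
Qed.

Lemma transl2 (a : pt R) (f : PT R -> \bar R) : measurable_fun [set: PT R] f ->
  (forall x, 0 <= f x) -> \int[lam]_z f (a + z)%R = \int[lam]_z f z.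
Proof.
move=> mf f0.
have mfa : measurable_fun [set: PT R] (fun z => f (a + z)%R).
  exact: (measurableT_comp mf (measurable_transl a)).
rewrite (fubini_tonelli1 _ mfa)// (fubini_tonelli1 _ mf)//.
have mF := measurable_fun_fubini_tonelli_F (m2 := mu) f mf f0.
rewrite -[RHS](transl1 a.1 mF); last by move=> x; exact: integral_ge0.
apply: eq_integral => x _; rewrite /fubini_F.
rewrite -(@transl1 a.2 (fun y => f ((a.1 + x)%R, y))) //.
exact: (measurableT_comp mf (measurable_pair1 _)).
Qed.
End translation.

(** A pointwise gain c on P integrates to a gain c m(P); the additive form avoids subtracting
    integrals that may be infinite. With f = 0 it is Markov's inequality. *)
Lemma int_gain d (T : measurableType d) (R : realType) (m : {measure set T -> \bar R})
  (A P : set T) (f g : T -> \bar R) (c : \bar R) : measurable A -> measurable P ->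
  P `<=` A -> (0 <= c)%E -> (forall x, A x -> (0 <= f x)%E) ->
  measurable_fun A f -> measurable_fun A g ->
  (forall x, A x -> (f x + (cst c \_ P) x <= g x)%E) ->
  (\int[m]_(x in A) f x + c * m P <= \int[m]_(x in A) g x)%E.
Proof.
move=> mA mP PA c0 f0 mf mg h.
have p0 x : (0 <= (cst c \_ P) x)%E by rewrite patchE; case: ifP.
have mcP : measurable_fun A (cst c \_ P).
  apply: measurable_funTS; apply/(measurable_restrictT _ mP); exact: measurable_cst.
have -> : (c * m P = \int[m]_(x in A) (cst c \_ P) x)%E.
  rewrite -integral_cst// [LHS]integral_mkcond [RHS]integral_mkcond; apply: eq_integral => x _.
  rewrite !patchE; case: ifPn => xP; last by rewrite if_same.
  by rewrite mem_set//; apply: PA; exact: set_mem.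
rewrite -ge0_integralD//; apply: ge0_le_integral.
- exact: mA.
- by move=> x Ax; apply: adde_ge0; [exact: f0|exact: p0].
- exact: emeasurable_funD.
- exact: mg.
- exact: h.
Qed.

(** * Double integrals of a symmetric kernel *)

Section double_integral.
Context d (T : measurableType d) (R : realType).
Variables (m : {sigma_finite_measure set T -> \bar R}) (k : T * T -> \bar R).
Hypotheses (mk : measurable_fun setT k) (k0 : forall p, (0 <= k p)%E) (ksym : forall x y, k (x, y) = k (y, x)).
Local Open Scope ereal_scope.
Implicit Types X Y : set T.

Definition dint X Y : \bar R := \int[m]_(x in X) \int[m]_(y in Y) k (x, y).

Lemma measurable_restrX X Y : measurable X -> measurable Y -> measurable_fun setT (k \_ (X `*` Y)).
Proof.
move=> mX mY; apply/(measurable_restrictT k (measurableX mX mY)).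
by apply: measurable_funTS; exact: mk.
Qed.

Lemma restrX_ge0 X Y p : 0 <= (k \_ (X `*` Y)) p.
Proof. by rewrite patchE; case: ifP. Qed.

Lemma dintE X Y : dint X Y = \int[m]_x \int[m]_y (k \_ (X `*` Y)) (x, y).
Proof.
rewrite /dint integral_mkcond; apply: eq_integral => x _.
rewrite patchE; case: ifPn => xX.
  rewrite integral_mkcond; apply: eq_integral => y _; rewrite !patchE.
  by rewrite (_ : ((x, y) \in X `*` Y) = (y \in Y))// in_setX xX.
by apply/esym/integral0_eq => y _; rewrite patchE in_setX/= (negbTE xX).
Qed.

Lemma dint_prod X Y : measurable X -> measurable Y -> dint X Y = \int[m \x m]_(p in X `*` Y) k p.
Proof.
move=> mX mY; rewrite dintE [RHS]integral_mkcond.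
by rewrite (fubini_tonelli1 _ (measurable_restrX mX mY) (restrX_ge0 X Y)).
Qed.

Lemma dint_sym X Y : measurable X -> measurable Y -> dint X Y = dint Y X.
Proof.
move=> mX mY; rewrite !dintE (fubini_tonelli _ (measurable_restrX mX mY) (restrX_ge0 X Y)).
apply: eq_integral => y _; apply: eq_integral => x _; rewrite !patchE !in_setX /= andbC.
by case: ifP => // _; rewrite ksym.
Qed.

Lemma dint_ge0 X Y : 0 <= dint X Y.
Proof. by apply: integral_ge0 => x _; exact: integral_ge0. Qed.

Lemma dint_mono X Y X' Y' : measurable X -> measurable Y -> measurable X' -> measurable Y' ->
  X `<=` X' -> Y `<=` Y' -> dint X Y <= dint X' Y'.
Proof.
move=> mX mY mX' mY' XX YY; rewrite !dint_prod//; apply: ge0_subset_integral.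
- exact: measurableX.
- exact: measurableX.
- by apply: measurable_funTS; exact: mk.
- by move=> p _; exact: k0.
- by move=> [x y] [/= /XX ? /YY ?].
Qed.

Lemma dint_setUr X Y Y' : measurable X -> measurable Y -> measurable Y' -> [disjoint Y & Y'] ->
  dint X (Y `|` Y') = dint X Y + dint X Y'.
Proof.
move=> mX mY mY' dis; rewrite !dint_prod//; last exact: measurableU.
rewrite (_ : X `*` (Y `|` Y') = (X `*` Y) `|` (X `*` Y')); last first.
  by apply/seteqP; split=> [[x y] [/= Xx [?|?]]|[x y] [] [/= ? ?]]; [left|right|split; [|left]|split; [|right]].
rewrite ge0_integral_setU//.
- exact: measurableX.
- exact: measurableX.
- by apply: measurable_funTS; exact: mk.
- move: dis; rewrite !disj_set2E => /eqP dis; apply/eqP/seteqP; split=> // [[x y]] [[/= _ h1] [/= _ h2]].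
  by have : (Y `&` Y') y by []; rewrite dis.
Qed.

Lemma dint_setUl X X' Y : measurable X -> measurable X' -> measurable Y -> [disjoint X & X'] ->
  dint (X `|` X') Y = dint X Y + dint X' Y.
Proof.
move=> mX mX' mY dis; rewrite (dint_sym (measurableU _ _ mX mX') mY) (dint_setUr mY mX mX' dis).
by rewrite (dint_sym mY mX) (dint_sym mY mX').
Qed.

Lemma dint_subU X Y Y1 Y2 : measurable X -> measurable Y -> measurable Y1 -> measurable Y2 ->
  Y `<=` Y1 `|` Y2 -> dint X Y <= dint X Y1 + dint X Y2.
Proof.
move=> mX mY m1 m2 h; have mD := measurableD m2 m1.
apply: (@le_trans _ _ (dint X (Y1 `|` (Y2 `\` Y1)))).
  by apply: dint_mono => //; [exact: measurableU|rewrite setU_setD].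
have dis : [disjoint Y1 & Y2 `\` Y1] by rewrite disj_set2E setDIK.
rewrite (dint_setUr mX m1 mD dis); apply: leeD; first exact: lexx.
exact: (dint_mono mX mD mX m2 (@subset_refl _ _) (@subDsetl _ _ _)).
Qed.

Lemma measurable_dint Y : measurable Y -> measurable_fun setT (fun x => \int[m]_(y in Y) k (x, y)).
Proof.
move=> mY; rewrite (_ : (fun x => _) = fubini_F m (k \_ (setT `*` Y))).
  exact: measurable_fun_fubini_tonelli_F (measurable_restrX measurableT mY) (restrX_ge0 setT Y).
apply/funext => x; rewrite /fubini_F [LHS]integral_mkcond; apply: eq_integral => y _; rewrite !patchE.
by rewrite in_setX in_setT.
Qed.

Lemma dint_gain A E N P (c : \bar R) : measurable A -> measurable E -> measurable N -> measurable P ->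
  P `<=` A -> 0 <= c ->
  (forall x, A x -> \int[m]_(y in E) k (x, y) + (cst c \_ P) x <= \int[m]_(y in N) k (x, y)) ->
  dint A E + c * m P <= dint A N.
Proof.
move=> mA mE mN mP PA c0 h; apply: int_gain => //.
- by move=> x _; apply: integral_ge0.
- exact: measurable_funTS (measurable_dint mE).
- exact: measurable_funTS (measurable_dint mN).
Qed.

Lemma dint_ge X Y (c : \bar R) (P : set T) : measurable X -> measurable Y -> measurable P -> P `<=` X ->
  0 <= c -> (forall x, P x -> c <= \int[m]_(y in Y) k (x, y)) -> c * m P <= dint X Y.
Proof.
move=> mX mY mP PX c0 h; apply: (@le_trans _ _ (dint P Y)); last exact: dint_mono.
have := @dint_gain P set0 Y P c mP measurable0 mY mP (@subset_refl _ _) c0.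
have -> : dint P set0 = 0 by apply: integral0_eq => x _; rewrite integral_set0.
rewrite add0e; apply => x Px; rewrite integral_set0 add0e patchE mem_set//; exact: h.
Qed.

Section translation_invariant.
Variables (op : T -> T -> T) (kz : T -> \bar R).
Hypotheses (mop : measurable_fun setT (fun p : T * T => op p.1 p.2))
  (inv : forall x f, measurable_fun setT f -> (forall y, 0 <= f y) -> \int[m]_z f (op x z) = \int[m]_z f z)
  (kzE : forall x z, k (x, op x z) = kz z) (mkz : measurable_fun setT kz).

Lemma dint_shift X Y : measurable X -> measurable Y ->
  dint X Y = \int[m]_z \int[m]_x (k \_ (X `*` Y)) (x, op x z).
Proof.
move=> mX mY; have mr := measurable_restrX mX mY; rewrite dintE.
have ms : measurable_fun setT (fun p : T * T => (p.1, op p.1 p.2)) by apply: measurable_fun_pair.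
rewrite -(fubini_tonelli (fun p => (k \_ (X `*` Y)) (p.1, op p.1 p.2)) (measurableT_comp mr ms)); last by move=> p; exact: restrX_ge0.
apply: eq_integral => x _; rewrite -(inv x (f := (fun y => (k \_ (X `*` Y)) (x, y)))) //.
- exact: (measurableT_comp mr (measurable_pair1 _)).
- by move=> y; exact: restrX_ge0.
Qed.

(** With y = x + z the kernel depends on the displacement z alone. Tonelli integrates over x first,
    leaving the measure of those points of X that z carries into Y. *)
Lemma dint_shift_le X Y (g : T -> \bar R) : measurable X -> measurable Y -> measurable_fun setT g ->
  (forall z, m [set x | X x /\ Y (op x z)] <= g z) -> dint X Y <= \int[m]_z (kz z * g z).
Proof.
move=> mX mY mg h; have mr := measurable_restrX mX mY; rewrite dint_shift//.
have ms : measurable_fun setT (fun p : T * T => (p.1, op p.1 p.2)) by apply: measurable_fun_pair.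
have kz0 z : 0 <= kz z by rewrite -(kzE z z).
apply: ge0_le_integral.
- exact: measurableT.
- by move=> z _; apply: integral_ge0 => x _; exact: restrX_ge0.
- by apply: (measurable_fun_fubini_tonelli_G (fun p => (k \_ (X `*` Y)) (p.1, op p.1 p.2)) (measurableT_comp mr ms)) => p; exact: restrX_ge0.
- by apply: emeasurable_funM.
- move=> z _; apply: le_trans (lee_wpmul2l (kz0 z) (h z)).
  set S := [set x | _].
  have mS : measurable S.
    have -> : S = X `&` (fun x => op x z) @^-1` Y by apply/seteqP; split=> x [? ?].
    apply: measurableI => //; rewrite -[X in measurable X]setTI.
    exact: (measurableT_comp mop (measurable_pair2 z)).
  rewrite -integral_cst// [leRHS]integral_mkcond le_eqVlt; apply/orP; left; apply/eqP.
  apply: eq_integral => x _; rewrite !patchE in_setX/=.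
  have -> : (x \in S) = (x \in X) && (op x z \in Y).
    by apply/idP/andP => [/set_mem[? ?]|[/set_mem ? /set_mem ?]]; [split; exact: mem_set|exact: mem_set].
  by case: ifP => // _; rewrite kzE.
Qed.

End translation_invariant.
End double_integral.

Section sigma_finite.
Context {R : realType}.

Lemma leb2_sigma_finite : sigma_finite [set: PT R] (@leb2 R).
Proof.
exists (fun n : nat => rect (- n%:R) n%:R (- n%:R) n%:R : set (PT R)).
  apply/seteqP; split=> // x _; exists (Num.bound (`|x.1| + `|x.2|)) => //.
  have h : `|x.1| + `|x.2| < (Num.bound (`|x.1| + `|x.2|))%:R by apply: archi_boundP; exact: addr_ge0.
  have h1 : `|x.1| <= (Num.bound (`|x.1| + `|x.2|))%:R by apply: ltW; apply: le_lt_trans h; rewrite lerDl.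
  have h2 : `|x.2| <= (Num.bound (`|x.1| + `|x.2|))%:R by apply: ltW; apply: le_lt_trans h; rewrite lerDr.
  by split; rewrite /= in_itv/= -ler_norml.
by move=> n; split; [exact: measurable_rect|exact: leb2_rect_lty].
Qed.

(* The library's sigma-finite instance for product measures is only canonical
   for subprobabilities. *)
HB.instance Definition _ := Measure.copy (@leb2 R) (@lebesgue_measure R \x @lebesgue_measure R)%E.
HB.instance Definition _ := Measure_isSigmaFinite.Build _ _ _ (@leb2 R) leb2_sigma_finite.

End sigma_finite.

(** * Interaction of two sets under the fractional kernel *)

Section fractional.
Context {R : realType}.
Local Notation mu := (@lebesgue_measure R).
Local Notation lam := (@leb2 R).
Local Open Scope ereal_scope.
Implicit Types X Y : set (PT R).

Definition ker (s : R) (p : PT R * PT R) : \bar R := (Defs.edist p.1 p.2 `^ (- 2 - s))%:E.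
Definition kap (s : R) (z : PT R) : \bar R := (enorm z `^ (- 2 - s))%:E.
Definition I2 (s : R) X Y : \bar R := @dint _ (PT R) R lam (ker s) X Y.

Lemma ker_ge0 s p : 0 <= ker s p. Proof. by rewrite lee_fin powR_ge0. Qed.

Lemma enormN (z : pt R) : enorm (- z)%R = enorm z.
Proof. by rewrite /enorm /= !sqrrN. Qed.

Lemma edistC (x y : pt R) : Defs.edist x y = Defs.edist y x.
Proof. by rewrite /Defs.edist -enormN opprB. Qed.

Lemma ker_sym s x y : ker s (x, y) = ker s (y, x).
Proof. by rewrite /ker/= edistC. Qed.

Lemma ker_transl s x z : ker s (x, x + z)%R = kap s z.
Proof.
rewrite /ker /kap /Defs.edist/= -enormN; congr (enorm _ `^ _)%:E.
by rewrite opprB addrC addKr.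
Qed.

Lemma continuous_enorm : continuous (@enorm R).
Proof.
move=> x; apply: (@continuous_comp _ _ _ (fun x : pt R => x.1 ^+ 2 + x.2 ^+ 2)%R (@Num.sqrt R)).
  exact: Cinf_continuous (@Cinf_q2 R) x.
exact: sqrt_continuous.
Qed.

Lemma measurable_kap s : measurable_fun setT (kap s).
Proof.
apply/measurable_EFinP; apply: (@measurableT_comp _ _ _ _ _ _ (fun t : R => t `^ (- 2 - s))%R).
  exact: measurable_powR.
by apply: continuous_measurable_pt; exact: continuous_enorm.
Qed.

Lemma measurable_ker s : measurable_fun setT (ker s).
Proof.
have -> : ker s = kap s \o (fun p : PT R * PT R => (p.1.1 - p.2.1, p.1.2 - p.2.2)%R) by [].
apply: measurableT_comp; first exact: measurable_kap.
have m1 : measurable_fun setT (fun p : PT R * PT R => p.1.1) := measurableT_comp measurable_fst measurable_fst.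
have m2 : measurable_fun setT (fun p : PT R * PT R => p.1.2) := measurableT_comp measurable_snd measurable_fst.
have m3 : measurable_fun setT (fun p : PT R * PT R => p.2.1) := measurableT_comp measurable_fst measurable_snd.
have m4 : measurable_fun setT (fun p : PT R * PT R => p.2.2) := measurableT_comp measurable_snd measurable_snd.
by apply: measurable_fun_pair; exact: measurable_funB.
Qed.

Lemma measurable_addp : measurable_fun setT (fun p : PT R * PT R => (p.1 + p.2)%R : PT R).
Proof.
have m1 : measurable_fun setT (fun p : PT R * PT R => p.1.1) := measurableT_comp measurable_fst measurable_fst.
have m2 : measurable_fun setT (fun p : PT R * PT R => p.1.2) := measurableT_comp measurable_snd measurable_fst.
have m3 : measurable_fun setT (fun p : PT R * PT R => p.2.1) := measurableT_comp measurable_fst measurable_snd.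
have m4 : measurable_fun setT (fun p : PT R * PT R => p.2.2) := measurableT_comp measurable_snd measurable_snd.
have -> : (fun p : PT R * PT R => (p.1 + p.2)%R : PT R) = (fun p => (p.1.1 + p.2.1, p.1.2 + p.2.2)%R) by [].
by apply: measurable_fun_pair; exact: measurable_funD.
Qed.

Lemma I2_sym s X Y : measurable X -> measurable Y -> I2 s X Y = I2 s Y X.
Proof. exact: (dint_sym _ (measurable_ker s) (ker_ge0 s) (ker_sym s)). Qed.

Lemma I2_ge0 s X Y : 0 <= I2 s X Y.
Proof. exact: (dint_ge0 _ (ker_ge0 s)). Qed.

Lemma I2_mono s X Y X' Y' : measurable X -> measurable Y -> measurable X' -> measurable Y' ->
  X `<=` X' -> Y `<=` Y' -> I2 s X Y <= I2 s X' Y'.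
Proof. exact: (dint_mono _ (measurable_ker s) (ker_ge0 s)). Qed.

Lemma I2_setUr s X Y Y' : measurable X -> measurable Y -> measurable Y' -> [disjoint Y & Y'] ->
  I2 s X (Y `|` Y') = I2 s X Y + I2 s X Y'.
Proof. exact: (dint_setUr _ (measurable_ker s) (ker_ge0 s)). Qed.

Lemma I2_setUl s X X' Y : measurable X -> measurable X' -> measurable Y -> [disjoint X & X'] ->
  I2 s (X `|` X') Y = I2 s X Y + I2 s X' Y.
Proof. exact: (dint_setUl _ (measurable_ker s) (ker_ge0 s) (ker_sym s)). Qed.

Lemma I2_subU s X Y Y1 Y2 : measurable X -> measurable Y -> measurable Y1 -> measurable Y2 ->
  Y `<=` Y1 `|` Y2 -> I2 s X Y <= I2 s X Y1 + I2 s X Y2.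
Proof. exact: (dint_subU _ (measurable_ker s) (ker_ge0 s)). Qed.

Lemma I2_gain s A E N P (c : \bar R) : measurable A -> measurable E -> measurable N -> measurable P ->
  P `<=` A -> 0 <= c ->
  (forall x, A x -> \int[lam]_(y in E) ker s (x, y) + (cst c \_ P) x <= \int[lam]_(y in N) ker s (x, y)) ->
  I2 s A E + c * lam P <= I2 s A N.
Proof. by move=> mA mE mN mP; exact: (@dint_gain _ (PT R) R lam (ker s) (measurable_ker s) (ker_ge0 s) A E N P c mA mE mN mP). Qed.

Lemma I2_ge s X Y (c : \bar R) (P : set (PT R)) : measurable X -> measurable Y -> measurable P -> P `<=` X ->
  0 <= c -> (forall x, P x -> c <= \int[lam]_(y in Y) ker s (x, y)) -> c * lam P <= I2 s X Y.
Proof. by move=> mX mY mP; exact: (@dint_ge _ (PT R) R lam (ker s) (measurable_ker s) (ker_ge0 s) X Y c P mX mY mP). Qed.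

Lemma I2_shift_le s X Y (g : PT R -> \bar R) : measurable X -> measurable Y -> measurable_fun setT g ->
  (forall z, lam [set x | X x /\ Y (x + z)%R] <= g z) -> I2 s X Y <= \int[lam]_z (kap s z * g z).
Proof.
apply: (dint_shift_le (measurable_ker s) (ker_ge0 s) measurable_addp _ (ker_transl s) (measurable_kap s)).
by move=> x f mf f0; exact: transl2.
Qed.

Lemma measurable_ker1 s x A : measurable_fun A (fun y => ker s (x, y)).
Proof. by apply: measurable_funTS; exact: (measurableT_comp (measurable_ker s) (measurable_pair1 _)). Qed.

Lemma int_ker_shift s x (a : pt R) (E N : set (PT R)) : measurable E -> measurable N ->
  (forall y : pt R, E (a + y)%R <-> N y) ->
  \int[lam]_(y in E) ker s (x, y) = \int[lam]_(y in N) ker s (x, a + y)%R.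
Proof.
move=> mE mN h; rewrite integral_mkcond [RHS]integral_mkcond -(@transl2 _ a).
- apply: eq_integral => y _; rewrite !patchE; have -> // : (a + y \in E)%R = (y \in N).
  by apply/idP/idP => /set_mem/h/mem_set.
- by apply/(measurable_restrictT _ mE); exact: measurable_ker1.
- by move=> y; rewrite patchE; case: ifP => // _; exact: ker_ge0.
Qed.

Lemma axes_null : lam ([set z | z.1 = 0%R] `|` [set z | z.2 = 0%R] : set (PT R)) = 0.
Proof.
have m0 : measurable [set 0%R : measurableTypeR R] by exact: measurable_set1.
have -> : [set z | z.1 = 0%R] = [set 0%R] `*` setT :> set (PT R) by apply/seteqP; split=> [z|z []].
have -> : [set z | z.2 = 0%R] = setT `*` [set 0%R] :> set (PT R) by apply/seteqP; split=> [z|z []].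
by apply: leb2_U0; do ?exact: measurableX; rewrite leb2E// lebesgue_measure_set1 ?mul0e ?mule0.
Qed.

Lemma measurable_axes : measurable ([set z | z.1 = 0%R] `|` [set z | z.2 = 0%R] : set (PT R)).
Proof.
have m0 : measurable [set 0%R : measurableTypeR R] by exact: measurable_set1.
have -> : [set z | z.1 = 0%R] = [set 0%R] `*` setT :> set (PT R) by apply/seteqP; split=> [z|z []].
have -> : [set z | z.2 = 0%R] = setT `*` [set 0%R] :> set (PT R) by apply/seteqP; split=> [z|z []].
by apply: measurableU; exact: measurableX.
Qed.

Definition coord (b : bool) (z : pt R) : R := if b then z.1 else z.2.

Lemma measurable_coord b : measurable_fun [set: PT R] (coord b).
Proof. by case: b; [exact: measurable_fst|exact: measurable_snd]. Qed.

Lemma kap_coord s b B (z : pt R) : (0 < s < 1)%R -> (1 <= B)%R -> z.1 != 0%R -> z.2 != 0%R ->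
  (enorm z `^ (- 2 - s) * Num.min 1 (`|coord b z| / B) <= B `^ (- (s / 2)) * (fsig s z.1 * fsig s z.2))%R.
Proof.
move=> hs hB z1 z2; case: b => /=.
  by apply: kernel_fmin => //; [exact: enorm_ge1|exact: enorm_ge2].
by rewrite [X in (_ <= _ * X)%R]mulrC; apply: kernel_fmin => //; [exact: enorm_ge2|exact: enorm_ge1].
Qed.

Lemma measurable_fsig s : measurable_fun [set: R] (fsig s).
Proof. exact: measurable_fmin. Qed.

Lemma fsig_ge0 (s t : R) : (0 <= fsig s t)%R. Proof. exact: fmin_ge0. Qed.

Lemma int_fsig2 s : (0 < s < 1)%R ->
  exists2 C : R, (0 <= C)%R & \int[lam]_z (fsig s z.1 * fsig s z.2)%:E = C%:E.
Proof.
move=> /andP[s0 s1].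
have fi : \int[mu]_t (fsig s t)%:E < +oo by apply: int_fmin; [apply/andP; split; lra|lra].
have i0 : 0 <= \int[mu]_t (fsig s t)%:E by apply: integral_ge0 => t _; rewrite lee_fin fsig_ge0.
have fn : \int[mu]_t (fsig s t)%:E \is a fin_num by rewrite ge0_fin_numE.
exists (fine (\int[mu]_t (fsig s t)%:E) ^+ 2)%R; first exact: sqr_ge0.
have mf := measurable_fsig s.
have mp : measurable_fun [set: PT R] (fun z : PT R => (fsig s z.1 * fsig s z.2)%:E).
  apply/measurable_EFinP; apply: measurable_funM.
    exact: (measurableT_comp mf measurable_fst).
  exact: (measurableT_comp mf measurable_snd).
rewrite (fubini_tonelli1 _ mp); last by move=> z; rewrite lee_fin mulr_ge0 ?fsig_ge0.
have E x : \int[mu]_y (fsig s (x, y).1 * fsig s (x, y).2)%:E = (fsig s x)%:E * \int[mu]_t (fsig s t)%:E.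
  rewrite -ge0_integralZl//.
  - exact/measurable_EFinP.
  - by move=> t _; rewrite lee_fin fsig_ge0.
  - by rewrite lee_fin fsig_ge0.
under eq_integral => x _ do rewrite /fubini_F E.
rewrite ge0_integralZr//; [by rewrite -(fineK fn) -EFinM expr2|exact/measurable_EFinP|].
by move=> t _; rewrite lee_fin fsig_ge0.
Qed.

(** This bound is used twice. With B = 1 and horizontal displacements it gives finiteness. With B =
    b and vertical ones, c is proportional to b and the factor B^(-s/2) makes the result negligible
    against b; C does not depend on B. *)
Lemma I2_bound s : (0 < s < 1)%R -> exists2 C : R, (0 <= C)%R & forall b B c X Y,
  (1 <= B)%R -> (0 <= c)%R -> measurable X -> measurable Y ->
  (forall z, lam [set x | X x /\ Y (x + z)%R] <= (c * Num.min 1 (`|coord b z| / B))%:E) ->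
  I2 s X Y <= (c * B `^ (- (s / 2)) * C)%:E.
Proof.
move=> hs; have [C C0 CE] := int_fsig2 hs; exists C => // b B c X Y B1 c0 mX mY h.
have B0 : (0 < B)%R := lt_le_trans ltr01 B1.
have mg : measurable_fun [set: PT R] (fun z : PT R => (c * Num.min 1 (`|coord b z| / B))%:E).
  apply/measurable_EFinP; apply: measurable_funM => //; apply: measurable_minr => //.
  apply: measurable_funM => //; exact: (measurableT_comp (@normr_measurable _ setT) (measurable_coord b)).
apply: le_trans (I2_shift_le s mX mY mg h) _.
have g0 z : (0 <= c * Num.min 1 (`|coord b z| / B))%R.
  by rewrite mulr_ge0// le_min ler01 divr_ge0// ltW.
have mk := emeasurable_funM (measurable_kap s) mg.
(* The axes are removed because 0 to a nonzero power is 0 here: [fsig] vanishes on them and cannot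
   dominate the kernel. *)
have [H HE] : exists H, H = [set z | z.1 = 0%R] `|` [set z | z.2 = 0%R] :> set (PT R) by eexists.
have mH : measurable H by rewrite HE; exact: measurable_axes.
have H0 : lam H = 0 by rewrite HE; exact: axes_null.
rewrite (ge0_negligible_integral mH measurableT mk _ H0); last first.
  by move=> z _; rewrite mule_ge0// lee_fin ?powR_ge0.
have mp : measurable_fun [set: PT R] (fun z : PT R => (fsig s z.1 * fsig s z.2)%:E).
  apply/measurable_EFinP; apply: measurable_funM.
    exact: (measurableT_comp (measurable_fsig s) measurable_fst).
  exact: (measurableT_comp (measurable_fsig s) measurable_snd).
have p0 z : 0 <= (fsig s z.1 * fsig s z.2)%:E by rewrite lee_fin mulr_ge0 ?fsig_ge0.
have cB : (0 <= c * B `^ (- (s / 2)))%R by rewrite mulr_ge0 ?powR_ge0.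
have mT : measurable (setT `\` H) by exact: measurableD.
rewrite EFinM -CE -ge0_integralZl//.
apply: (@le_trans _ _ (\int[lam]_(z in setT `\` H) ((c * B `^ (- (s / 2)))%:E * (fsig s z.1 * fsig s z.2)%:E))).
  apply: ge0_le_integral.
  - exact: mT.
  - by move=> z _; rewrite mule_ge0// lee_fin ?powR_ge0.
  - exact: measurable_funTS mk.
  - by apply: measurable_funTS; apply: emeasurable_funM.
  - move=> z [_ nH]; rewrite -!EFinM lee_fin.
    have z1 : z.1 != 0%R by apply/eqP => e; apply: nH; rewrite HE; left.
    have z2 : z.2 != 0%R by apply/eqP => e; apply: nH; rewrite HE; right.
    have := ler_wpM2l c0 (kap_coord b hs B1 z1 z2); rewrite [leRHS]mulrA; apply: le_trans.
    by rewrite mulrCA.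
apply: ge0_subset_integral => //.
- by apply: emeasurable_funM.
- by move=> z _; rewrite mule_ge0.
Qed.

End fractional.
Global Opaque I2.

(** * The fractional perimeter *)

Section fractional_finite.
Context {R : realType}.
Local Notation lam := (@leb2 R).

Lemma find_strip (s p x : R) (n : nat) : s <= x <= s + p *+ n.+1 ->
  exists2 k, (k <= n)%N & s + p *+ k <= x <= s + p *+ k.+1.
Proof.
elim: n => [|n IH] /andP[h1 h2].
  by exists 0%N => //; rewrite mulr0n addr0 h1 h2.
have [h|h] := leP x (s + p *+ n.+1).
  by have [k kn hk] := IH ltac:(by rewrite h1 h); exists k => //; exact: leqW.
by exists n.+1 => //; rewrite h2 ltW.
Qed.

(** Either t and t + z lie in one open strip, where cos keeps its sign, or a dividing line separates
    them. N exceeds r + 1 so that the strips also cover t + z. *)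
Lemma cos_flip (N : nat) (r t z : R) : r + 1 < N%:R -> `|t| <= r -> `|z| < 1 ->
  (0 < cos t) != (0 < cos (t + z)) ->
  exists2 k, (k <= (4 * N).+1)%N & `|t - (- (pi / 2) - pi *+ 2 *+ N + pi *+ k)| <= `|z|.
Proof.
move=> rN tr z1 fl; have [] := strips_cover rN.
set s := - (pi / 2) - _ => s1 s2.
have key (a b : R) : s <= a -> b <= s + pi *+ (4 * N).+1 -> a <= b -> (0 < cos a) != (0 < cos b) ->
    exists2 k, (k <= (4 * N).+1)%N & a <= s + pi *+ k <= b.
  move=> sa bs ab ne.
  have [k kn /andP[k1 k2]] : exists2 k, (k <= 4 * N)%N & s + pi *+ k <= a <= s + pi *+ k.+1.
    by apply: find_strip; rewrite sa (le_trans ab bs).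
  have [h|h] := leP (s + pi *+ k.+1) b; first by exists k.+1 => //; rewrite k2.
  move: k1; rewrite le_eqVlt => /predU1P[e|k1]; first by exists k; [exact: leqW|rewrite e lexx].
  exfalso; move: ne.
  have ha := @cos_strip R N k a; rewrite k1 (le_lt_trans ab h) in ha; have {}ha := ha isT.
  have hb := @cos_strip R N k b; rewrite h (lt_le_trans k1 ab) in hb; have {}hb := hb isT.
  move: ha hb; case: (odd k) => ha hb; last by rewrite ha hb.
  by rewrite [0 < cos a]ltNge [0 < cos b]ltNge (ltW ha) (ltW hb).
have tb : - r <= t <= r by rewrite -ler_norml.
have zb : -1 < z < 1 by rewrite -ltr_norml.
move/andP : tb => [t1 t2]; move/andP : zb => [z2 z3].
have [z0|z0] := leP 0 z.
  have [k kn /andP[h1 h2]] := key t (t + z) ltac:(lra) ltac:(lra) ltac:(lra) fl.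
  by exists k => //; rewrite (ger0_norm z0) ler_norml; apply/andP; split; lra.
rewrite eq_sym in fl; have [k kn /andP[h1 h2]] := key (t + z) t ltac:(lra) ltac:(lra) ltac:(lra) fl.
by exists k => //; rewrite (ltr0_norm z0) ler_norml; apply/andP; split; lra.
Qed.

Lemma measurable_shift (X Y : set (PT R)) (z : pt R) : measurable X -> measurable Y ->
  measurable ([set x | X x /\ Y (x + z)] : set (PT R)).
Proof.
move=> mX mY.
have -> : [set x | X x /\ Y (x + z)] = X `&` (fun x => x + z) @^-1` Y by apply/seteqP; split=> x [? ?].
apply: measurableI => //; rewrite -[X in measurable X]setTI.
exact: (measurableT_comp (@measurable_addp R) (measurable_pair2 z)).
Qed.

(** For |z.1| < 1 the points whose sign flips lie in bands of width 2|z.1| and height 2r around the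
    4N + 2 dividing lines; for larger z.1 the area 4 r^2 of the square is enough. *)
Lemma lam_flip (r : R) : 0 < r -> exists2 c : R, 0 <= c & forall (S : set (PT R)) (z : pt R),
  measurable S -> S `<=` rect (- r) r (- r) r ->
  (forall x, S x -> (0 < cos x.1) != (0 < cos (x.1 + z.1))) ->
  (lam S <= (c * Num.min 1 (`|coord true z| / 1))%:E)%E.
Proof.
move=> r0; have [N rN] : exists N : nat, r + 1 < N%:R.
  by exists (Num.bound (r + 1)); apply: archi_boundP; rewrite addr_ge0// ltW.
set n := (4 * N).+2.
exists (n%:R * (4 * r) + 4 * r ^+ 2).
  by rewrite addr_ge0// ?mulr_ge0 ?sqr_ge0// ltW.
move=> S z mS Sr fl; rewrite divr1 /=.
have rr : - r <= r by lra.
have [h|h] := leP 1 `|z.1|.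
  apply: (@le_trans _ _ (lam (rect (- r) r (- r) r))).
    by apply: le_measure; rewrite ?inE//; exact: measurable_rect.
  rewrite leb2_rect// lee_fin mulr1 ?(min_idPl h).
  have q0 : 0 <= n%:R * (4 * r) by apply: mulr_ge0 => //; lra.
  by move: q0; move: (n%:R * _) => q q0; rewrite expr2; nra.
pose l k : R := - (pi / 2) - pi *+ 2 *+ N + pi *+ k.
pose A k : set (PT R) := rect (l k - `|z.1|) (l k + `|z.1|) (- r) r.
apply: (@le_trans _ _ (lam (\big[setU/set0]_(k < n) A k))).
  apply: le_measure; rewrite ?inE//.
    by apply: bigsetU_measurable => k _; exact: measurable_rect.
  move=> x Sx; have [/= x1 x2] := Sr x Sx; move: x1; rewrite in_itv/= -ler_norml => x1.
  have [k kn hk] := cos_flip rN x1 h (fl x Sx).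
  rewrite -bigcup_mkord; exists k => //=.
  split => //=; rewrite in_itv/=; move: hk; rewrite ler_norml -/(l k) => /andP[? ?].
  by apply/andP; split; lra.
have B := @Boole_inequality _ _ _ lam A n (fun k _ => measurable_rect _ _ _ _).
apply: le_trans B _.
apply: (@le_trans _ _ (\sum_(k < n) (4 * r * `|z.1|)%:E)%E).
  apply: lee_sum => k _; have z0 := normr_ge0 z.1.
  have AE : lam (A k) = (4 * r * `|z.1|)%:E.
    by rewrite /A leb2_rect//; [congr (_%:E); ring|lra].
  by rewrite [X in (X <= _)%E]AE.
rewrite sumEFin lee_fin sumr_const card_ord -[leLHS]mulr_natl [leLHS]mulrA.
by apply: ler_wpM2r; rewrite ?normr_ge0// lerDl mulr_ge0 ?sqr_ge0.
Qed.

Lemma measurable_E0C : measurable (~` E0 : set (PT R)).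
Proof. exact: measurableC (@measurable_E0 R). Qed.

Lemma frac_E0_finite (s r : R) : 0 < s < 1 -> 0 < r ->
  (I2 s E0 (~` E0 `&` Ball r) < +oo)%E /\ (I2 s (E0 `&` Ball r) (~` E0 `&` ~` Ball r) < +oo)%E.
Proof.
move=> hs r0; have [C C0 HC] := I2_bound hs; have [c c0 hc] := lam_flip r0.
have mB := measurable_Ball (ltW r0); have mE := @measurable_E0 R; have mEC := measurable_E0C.
have m1 := measurableI _ _ mEC mB; have m2 := measurableI _ _ mE mB.
have m3 := measurableI _ _ mEC (measurableC mB).
split.
  (* The shift bound needs its first set inside a bounded square, so the set in the ball is put
     first. *)
  rewrite I2_sym//; apply: le_lt_trans (HC true 1 c _ _ _ _ _ _ _) (ltry _) => // z.
  apply: hc; first exact: measurable_shift.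
    by move=> x [[_ Bx] _]; exact: Ball_rect (ltW r0) _ Bx.
  move=> x [[+ _]]; rewrite E0E /= => /negP nx px; rewrite px.
  by move: nx; case: (0 < cos x.1).
apply: le_lt_trans (HC true 1 c _ _ _ _ _ _ _) (ltry _) => // z.
apply: hc; first exact: measurable_shift.
  by move=> x [[_ Bx] _]; exact: Ball_rect (ltW r0) _ Bx.
move=> x [[+ _] [+ _]]; rewrite E0E /= => px /negP nx; rewrite px.
by move: nx; rewrite /=; case: (0 < cos _).
Qed.

End fractional_finite.

(** * Removing the box lowers the fractional interaction *)

Section fractional_drop.
Context {R : realType}.
Local Notation lam := (@leb2 R).

Definition sh (g : R) : pt R := (g * pi, 0).
Definition Eside (g : R) : set (pt R) := [set x | pi < g * x.1 /\ 0 < cos x.1].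
Definition Nside (g : R) : set (pt R) := [set x | 0 < g * x.1 /\ cos x.1 < 0].

Lemma continuous_cos_fst : continuous (fun x : pt R => cos x.1).
Proof. by apply: Cinf_continuous; apply: Cinf_comp (@Cinf_fst R) _; exact: (@Cinf1_cossin R).1. Qed.

Lemma continuous_scale_fst (g a : R) : continuous (fun x : pt R => g * x.1 - a).
Proof.
by move=> x; apply: cvgB; [apply: cvgM; [exact: cvg_cst|exact: cvg_fst]|exact: cvg_cst].
Qed.

Lemma measurable_Eside g : measurable (Eside g : set (PT R)).
Proof.
have -> : Eside g = [set x | 0 < g * x.1 - pi] `&` [set x | 0 < cos x.1].
  by apply/seteqP; split=> x [h1 h2]; split => //; move: h1; rewrite /= subr_gt0.
apply: measurableI; apply: measurable_gt0; [exact: continuous_scale_fst|exact: continuous_cos_fst].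
Qed.

Lemma measurable_Nside g : measurable (Nside g : set (PT R)).
Proof.
have -> : Nside g = [set x | 0 < g * x.1 - 0] `&` [set x | 0 < - cos x.1].
  by apply/seteqP; split=> x [h1 h2]; split; move: h1 h2; rewrite /= ?subr0 ?oppr_gt0.
apply: measurableI; apply: measurable_gt0; first exact: continuous_scale_fst.
by move=> x; apply: cvgN; exact: continuous_cos_fst.
Qed.

Lemma cos_shift_pi (g t : R) : g = 1 \/ g = -1 -> cos (g * pi + t) = - cos t.
Proof.
by case=> ->; rewrite cosD ?mul1r ?mulN1r ?cosN ?sinN cospi sinpi ?oppr0 mul0r subr0 mulN1r.
Qed.

Lemma side_shift (g : R) (y : pt R) : g = 1 \/ g = -1 -> Eside g (sh g + y) <-> Nside g y.
Proof.
move=> hg; rewrite /Eside /Nside /sh /= cos_shift_pi// oppr_gt0.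
by case: hg => ->; split=> -[h1 h2]; split=> //; lra.
Qed.

Lemma cos_pos_small (t : R) : `|t| <= pi -> 0 < cos t -> `|t| < pi / 2.
Proof.
move=> h c; rewrite ltNge; apply/negP => h2.
by have := @cos_le0_strip R t; rewrite h h2 => /(_ isT); rewrite leNgt c.
Qed.

Lemma cos_neg_large (t : R) : cos t < 0 -> pi / 2 < `|t|.
Proof.
move=> c; rewrite ltNge; apply/negP; rewrite ler_norml => h.
by have := cos_ge0_pihalf h; rewrite leNgt c.
Qed.

Lemma enorm_le_of (u v : pt R) : `|u.1| <= `|v.1| -> u.2 = v.2 -> enorm u <= enorm v.
Proof.
move=> h1 h2; rewrite /enorm ler_wsqrtr// h2 lerD2r -(real_normK (num_real u.1)) -(real_normK (num_real v.1)).
by rewrite ler_sqr ?nnegrE.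
Qed.

Lemma enorm_le_sum (u : pt R) : enorm u <= `|u.1| + `|u.2|.
Proof.
have n1 := normr_ge0 u.1; have n2 := normr_ge0 u.2.
rewrite enorm_le ?addr_ge0// /q2 -(real_normK (num_real u.1)) -(real_normK (num_real u.2)); nra.
Qed.

(** The kernel is 0 at distance 0 by the convention on powers, so the smaller distance must be
    positive. *)
Lemma ker_antitone (s : R) (x y y' : pt R) : 0 < s -> 0 < Defs.edist x y -> Defs.edist x y <= Defs.edist x y' ->
  (ker s (x, y') <= ker s (x, y))%E.
Proof.
move=> s0 h1 h2; rewrite lee_fin /=; have -> : - 2 - s = - (2 + s) by lra.
by apply: powR_anti => //; lra.
Qed.

(** A point of the central strip has |x1| < pi/2 and a point of [Nside g] lies beyond pi/2 on side
    g, so pushing the latter further out by pi increases the distance. *)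
Lemma shift_far (g : R) (x y : pt R) : g = 1 \/ g = -1 -> `|x.1| <= pi -> 0 < cos x.1 -> Nside g y ->
  [/\ 0 < g * (y.1 - x.1), 0 < Defs.edist x y & Defs.edist x y <= Defs.edist x (sh g + y)].
Proof.
move=> hg x1 x2 [y1 y2]; have p0 := pi_gt0 R.
have hx := cos_pos_small x1 x2; have hy := cos_neg_large y2.
have d0 : 0 < g * (y.1 - x.1).
  move: hx hy; rewrite ltr_norml lter_normr => /andP[a b] /orP[c|c];
  by case: hg y1 => -> y1; lra.
split=> //.
  rewrite /Defs.edist; apply: lt_le_trans (enorm_ge1 _); rewrite normr_gt0 /=.
  by apply/eqP => e; move: d0; rewrite -opprB e oppr0 mulr0 ltxx.
apply: enorm_le_of => /=; last by rewrite add0r.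
have n1 : `|x.1 - y.1| = g * (y.1 - x.1).
  by case: hg d0 => -> d0; [rewrite ltr0_norm; lra|rewrite gtr0_norm; lra].
rewrite n1; case: hg d0 => -> d0.
  by rewrite ltr0_norm; lra.
by rewrite gtr0_norm; lra.
Qed.

(* Eside g is the translate of Nside g by (g * pi, 0), away from A. *)
Lemma side_gain (s g : R) (A P : set (PT R)) (W : pt R -> set (PT R)) (c w : R) : 0 < s -> g = 1 \/ g = -1 ->
  measurable A -> measurable P -> P `<=` A -> (forall x, A x -> `|x.1| <= pi /\ 0 < cos x.1) ->
  0 <= c -> 0 <= w -> (forall x, P x -> [/\ measurable (W x), lam (W x) = w%:E, W x `<=` Nside g &
    forall y, W x y -> (ker s (x, (sh g + y)%R) + c%:E <= ker s (x, y))%E]) ->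
  (I2 s A (Eside g) + (c * w)%:E * lam P <= I2 s A (Nside g))%E.
Proof.
move=> s0 hg mA mP PA hA c0 w0 h.
have mE := measurable_Eside g; have mN := measurable_Nside g.
apply: I2_gain => //; first by rewrite lee_fin mulr_ge0.
move=> x Ax; have [x1 x2] := hA x Ax.
(* Both inner integrals now run over the same set and can be compared pointwise. *)
rewrite (@int_ker_shift _ s x (sh g) _ _ mE mN); last by move=> y; exact: side_shift.
have mk : measurable_fun (Nside g : set (PT R)) (fun y => ker s (x, (sh g + y)%R)).
  apply: measurable_funTS.
  have m1 := measurableT_comp (measurable_ker s) (measurable_pair1 x).
  exact: (measurableT_comp m1 (@measurable_transl R (sh g))).
have mk1 : measurable_fun (Nside g : set (PT R)) (fun y => ker s (x, y)) by exact: measurable_ker1.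
have le y : Nside g y -> (ker s (x, (sh g + y)%R) <= ker s (x, y))%E.
  by move=> Ny; have [_ e1 e2] := shift_far hg x1 x2 Ny; exact: ker_antitone.
rewrite patchE; case: ifPn => xP.
  have [mW lW WN hW] := h x (set_mem xP).
  rewrite /= EFinM -lW; apply: int_gain; [exact: mN|exact: mW|exact: WN|by rewrite lee_fin| |exact: mk|exact: mk1|].
  - by move=> y _; exact: ker_ge0.
  - move=> y Ny; rewrite patchE; case: ifPn => yW; first by apply: hW; exact: set_mem.
    by rewrite /= adde0; exact: le.
rewrite adde0; apply: ge0_le_integral; [exact: mN| |exact: mk|exact: mk1|exact: le].
by move=> y _; exact: ker_ge0.
Qed.

Lemma small_power (s e : R) : 0 < s -> 0 < e -> exists2 b : R, 5 <= b & b `^ (- (s / 2)) <= e.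
Proof.
move=> s0 e0; exists (5 + e `^ (- (2 / s))); first by rewrite lerDl powR_ge0.
have h0 : 0 < e `^ (- (2 / s)) by exact: powR_gt0.
apply: le_trans (powR_anti (_ : 0 <= s / 2) h0 (_ : _ <= 5 + e `^ (- (2 / s)))) _.
- by rewrite divr_ge0// ltW.
- by rewrite lerDr.
rewrite -powRrM; have -> : - (2 / s) * - (s / 2) = 1.
  by rewrite mulrNN mulrA divfK ?gt_eqF// divff// pnatr_eq0.
by rewrite powRr1// ltW.
Qed.

(** The parts of the central strip above and below the box: they have no nearer negative strip to be
    matched with, and form the cost of the cut. *)
Definition C0 (b : R) : set (pt R) := [set x | (`|x.1| <= pi /\ 0 < cos x.1) /\ b < `|x.2|].

Lemma measurable_box b : measurable (E0 `&` rect (- pi) pi (- b) b : set (PT R)).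
Proof. by apply: measurableI; [exact: measurable_E0|exact: measurable_rect]. Qed.

Lemma measurable_C0 b : measurable (C0 b : set (PT R)).
Proof.
have -> : C0 b = [set x | `|x.1| <= pi] `&` E0 `&` [set x | 0 < `|x.2| - b].
  by rewrite E0E; apply/seteqP; split=> x [[h1 h2] h3]; (split; [split|]); move: h1 h2 h3; rewrite /= ?subr_gt0.
apply: measurableI; [apply: measurableI|]; last 2 first.
- exact: measurable_E0.
- apply: measurable_gt0 => x; apply: cvgB; last exact: cvg_cst.
  by apply: cvg_norm; exact: cvg_snd.
rewrite (_ : [set x | _] = ~` [set x | 0 < `|x.1| - pi]).
  apply: measurableC; apply: measurable_gt0 => x; apply: cvgB; last exact: cvg_cst.
  by apply: cvg_norm; exact: cvg_fst.
by apply/seteqP; split=> x /=; rewrite subr_gt0 leNgt => /negP.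
Qed.

(** To leave through an end, a point must lie within |z.2| of it: two bands of area 2 pi |z.2| each.
    The area 4 pi b of the box covers large displacements. *)
Lemma lam_overflow b (z : pt R) : 1 <= b ->
  (lam [set x | (E0 `&` rect (- pi) pi (- b) b) x /\ C0 b (x + z)%R] <=
   (4 * pi * b * Num.min 1 (`|coord false z| / b))%:E)%E.
Proof.
move=> b1; have p0 := pi_gt0 R; have b0 : 0 < b by lra.
have pp : - pi <= pi :> R by lra.
have mS := measurable_shift z (measurable_box b) (measurable_C0 b).
have [t tE] : exists t : R, t = `|z.2| by eexists.
rewrite /= -tE; have t0 : 0 <= t by rewrite tE.
have [h|h] := leP 1 (t / b).
  apply: (@le_trans _ _ (lam (rect (- pi) pi (- b) b))).
    apply: le_measure; rewrite ?inE//; first exact: measurable_rect.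
    by move=> x [[_]].
  by rewrite leb2_rect//; [rewrite lee_fin; lra|lra].
have tb : t < b by move: h; rewrite ltr_pdivrMr// mul1r.
apply: (@le_trans _ _ (lam (rect (- pi) pi (b - t) b `|` rect (- pi) pi (- b) (- b + t)))).
  apply: le_measure; rewrite ?inE//; first by apply: measurableU; exact: measurable_rect.
  move=> x [[_ [/= x1 x2]] [_ /= h3]]; move: x2; rewrite in_itv/= => /andP[x2 x3].
  have z1 : z.2 <= t by rewrite tE ler_norm.
  have z2 : - z.2 <= t by rewrite tE -normrN ler_norm.
  by move: h3; rewrite lter_normr => /orP[h3|h3]; [left|right]; split=> //=; rewrite in_itv/=; apply/andP; split; lra.
apply: le_trans (measureU2 _ _ _) _; [exact: measurable_rect|exact: measurable_rect|].
have e1 : lam (rect (- pi) pi (b - t) b) = (2 * pi * t)%:E.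
  by rewrite leb2_rect//; [congr (_%:E); ring|lra].
have e2 : lam (rect (- pi) pi (- b) (- b + t)) = (2 * pi * t)%:E.
  by rewrite leb2_rect//; [congr (_%:E); ring|lra].
rewrite [X in (X + _ <= _)%E]e1 [X in (_ + X <= _)%E]e2 -EFinD lee_fin.
have -> : 4 * pi * b * (t / b) = 4 * pi * t by field; rewrite gt_eqF.
lra.
Qed.

Lemma E1_sub b : E1 b `<=` (Eside 1 `|` Eside (-1)) `|` C0 b.
Proof.
move=> x [Ex nR]; have cx : 0 < cos x.1 by move: Ex; rewrite E0E.
have [h|h] := ltP pi x.1; first by left; left; split => //; rewrite mul1r.
have [h'|h'] := ltP x.1 (- pi); first by left; right; split => //; rewrite mulN1r; lra.
right; split; first by split => //; rewrite ler_norml h' h.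
rewrite ltNge; apply/negP => h2; apply: nR; split; rewrite /= in_itv/= ?h' ?h//.
by rewrite -ler_norml.
Qed.

(* On the windows used in right_gain, |x - y| <= pi/2 + 1 while the shifted distance
   is at least 5 pi/4. *)
Definition kgap (s : R) : R := (pi / 2 + 1) `^ (- (2 + s)) - (5 * pi / 4) `^ (- (2 + s)).

Lemma kgap_gt0 (s : R) : 0 < s -> 0 < kgap s.
Proof.
move=> s0; rewrite /kgap; have p0 := pi_gt0 R; have p2 := pi_ge2 R.
have h1 : 0 < pi / 2 + 1 :> R by lra.
have h2 : 0 < 5 * pi / 4 :> R by lra.
rewrite subr_gt0 !powRN ltf_pV2 ?posrE ?powR_gt0//.
by apply: gt0_ltr_powR; rewrite ?nnegrE; lra.
Qed.

(** A strict gain on one side is enough, provided that it is linear in b. Each x in a column of area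
    (pi/8) 2b gains [kgap s] on a window of area pi/8. *)
Lemma right_gain (s b : R) : 0 < s -> 5 <= b ->
  (I2 s (E0 `&` rect (- pi) pi (- b) b) (Eside 1) + (kgap s * (pi / 8) * (pi / 8 * (2 * b)))%:E <=
   I2 s (E0 `&` rect (- pi) pi (- b) b) (Nside 1))%E.
Proof.
move=> s0 b5.
have p0 := pi_gt0 R; have p2 := pi_ge2 R; have c0p := kgap_gt0 s0.
pose P : set (PT R) := rect (pi / 4) (3 * pi / 8) (- b) b.
pose W (x : pt R) : set (PT R) := rect (5 * pi / 8) (3 * pi / 4) x.2 (x.2 + 1).
have lP : lam P = (pi / 8 * (2 * b))%:E by rewrite /P leb2_rect; [congr (_%:E); field|lra|lra].
rewrite EFinM -lP; apply: (@side_gain _ _ _ _ W) => //.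
- by left.
- exact: measurable_box.
- exact: measurable_rect.
- move=> x [/= x1 x2]; move: x1; rewrite in_itv/= => /andP[h1 h2]; split.
    by rewrite E0E /=; apply: cos_gt0_pihalf; apply/andP; split; lra.
  by split => //=; rewrite in_itv/=; apply/andP; split; lra.
- move=> x [Ex [/= x1 _]]; split; last by move: Ex; rewrite E0E.
  by rewrite ler_norml; move: x1; rewrite in_itv.
- exact: ltW.
- by lra.
move=> x [/= x1 x2]; move: x1; rewrite in_itv/= => /andP[h1 h2]; split.
- exact: measurable_rect.
- by rewrite /W leb2_rect; [congr (_%:E); field|lra|lra].
- move=> y [/= y1 _]; move: y1; rewrite in_itv/= => /andP[h3 h4]; split; first by rewrite mul1r; lra.
  have : 0 < cos (pi - y.1) by apply: cos_gt0_pihalf; apply/andP; split; lra.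
  by rewrite cosB cospi sinpi mul0r addr0 mulN1r oppr_gt0.
move=> y [/= y1 y2]; move: y1 y2; rewrite !in_itv/= => /andP[h3 h4] /andP[h5 h6].
have E s' : - 2 - s' = - (2 + s') :> R by lra.
rewrite -EFinD lee_fin /= E.
have d1 : 0 < Defs.edist x y.
  by rewrite /Defs.edist; apply: lt_le_trans (enorm_ge1 _); rewrite normr_gt0 /= subr_eq0; apply/eqP; lra.
have d2 : Defs.edist x y <= pi / 2 + 1.
  rewrite /Defs.edist; apply: le_trans (enorm_le_sum _) _; apply: lerD => /=.
    by rewrite ler_norml; apply/andP; split; lra.
  by rewrite ler_norml; apply/andP; split; lra.
have d3 : 5 * pi / 4 <= Defs.edist x (sh 1 + y).
  rewrite /Defs.edist; apply: le_trans (enorm_ge1 _) => /=.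
  by rewrite -normrN; apply: le_trans (ler_norm _); lra.
have q0 : 0 <= 2 + s by lra.
have q1 : 0 < 5 * pi / 4 :> R by lra.
have e1 := powR_anti q0 d1 d2.
have e2 := powR_anti q0 q1 d3.
rewrite /kgap; move: e1 e2; clear; move: (_ `^ _) (_ `^ _) (_ `^ _) (_ `^ _) => p q r t; lra.
Qed.

(** Taking the set of strict gain to be empty leaves the plain comparison. *)
Lemma left_gain (s b : R) : 0 < s ->
  (I2 s (E0 `&` rect (- pi) pi (- b) b) (Eside (-1)) <= I2 s (E0 `&` rect (- pi) pi (- b) b) (Nside (-1)))%E.
Proof.
move=> s0; have := @side_gain s (-1) (E0 `&` rect (- pi) pi (- b) b) set0 (fun=> set0) 0 0 s0.
rewrite mul0r mul0e adde0; apply => //.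
- by right.
- exact: measurable_box.
- move=> x [Ex [/= x1 _]]; split; last by move: Ex; rewrite E0E.
  by rewrite ler_norml; move: x1; rewrite in_itv.
Qed.

Lemma ereal_drop (a e1 e2 k n1 n2 z : \bar R) (g c : R) :
  (0 <= a)%E -> (0 <= e1)%E -> (0 <= e2)%E -> (0 <= k)%E -> (0 <= n1)%E -> (0 <= n2)%E ->
  (a <= e1 + e2 + k)%E -> (e1 + g%:E <= n1)%E -> (e2 <= n2)%E -> (n1 + n2 <= z)%E ->
  (k <= c%:E)%E -> c < g -> (z < +oo)%E -> (a < z)%E.
Proof.
move=> a0 e10 e20 k0 n10 n20 h1 h2 h3 h4 h5 h6 zf.
have kf : k \is a fin_num by rewrite ge0_fin_numE//; apply: le_lt_trans h5 (ltry _).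
have nf : (n1 + n2 < +oo)%E := le_lt_trans h4 zf.
have n1f : n1 \is a fin_num by rewrite ge0_fin_numE//; apply: le_lt_trans nf; rewrite leeDl.
have n2f : n2 \is a fin_num by rewrite ge0_fin_numE//; apply: le_lt_trans nf; rewrite leeDr.
have e2f : e2 \is a fin_num by rewrite ge0_fin_numE//; apply: le_lt_trans h3 _; rewrite -ge0_fin_numE.
have e1f : e1 \is a fin_num.
  rewrite ge0_fin_numE//; have : (e1 + g%:E < +oo)%E by apply: le_lt_trans h2 _; rewrite -ge0_fin_numE.
  by case: (e1) => [x _||] //; exact: ltry.
apply: le_lt_trans h1 _; apply: lt_le_trans h4; move: h2 h3 h5.
rewrite -(fineK kf) -(fineK n1f) -(fineK n2f) -(fineK e1f) -(fineK e2f) -!EFinD !lee_fin lte_fin.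
lra.
Qed.

(** Cutting A out trades its interaction with the complement of [E0] for one with [E1 b]. The outer
    strips are paid for by the negative ones with a surplus linear in b, which exceeds the overflow
    through the ends. *)
Lemma frac_drop_core (s : R) : 0 < s < 1 -> exists2 b, 5 <= b &
  (I2 s (E0 `&` rect (- pi) pi (- b) b) (~` E0) < +oo)%E ->
  (I2 s (E0 `&` rect (- pi) pi (- b) b) (E1 b) < I2 s (E0 `&` rect (- pi) pi (- b) b) (~` E0))%E.
Proof.
move=> hs; have [C CC HC] := I2_bound hs; have /andP[s0 s1] := hs.
have p0 := pi_gt0 R.
have c0p := kgap_gt0 s0.
(* With this bound on b^(-s/2) the cost is at most kgap pi^2 b / 64, half of the gain kgap pi^2 b /
   32. *)
have e0 : 0 < kgap s * pi / (256 * (C + 1)).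
  have h1 : 0 < 256 :> R by lra.
  have h2 : 0 < C + 1 by lra.
  exact: (divr_gt0 (mulr_gt0 c0p p0) (mulr_gt0 h1 h2)).
have [b b5 hb] := small_power s0 e0.
exists b => //; set A := E0 `&` _ => fin.
have mA : measurable (A : set (PT R)) := measurable_box b.
have b1 : 1 <= b by lra.
have cost : (I2 s A (C0 b) <= (4 * pi * b * b `^ (- (s / 2)) * C)%:E)%E.
  apply: (HC false b) => //; [|exact: measurable_C0|by move=> z; exact: lam_overflow].
  by rewrite !mulr_ge0//; lra.
have mEs g := measurable_Eside g.
have mNs g := measurable_Nside g.
have mE1 : measurable (E1 b : set (PT R)).
  by apply: measurableD; [exact: measurable_E0|exact: measurable_rect].
have mEU : measurable (Eside 1 `|` Eside (-1) : set (PT R)) by exact: measurableU.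
have h1 : (I2 s A (E1 b) <= I2 s A (Eside 1) + I2 s A (Eside (-1)) + I2 s A (C0 b))%E.
  apply: le_trans (I2_subU s mA mE1 mEU (measurable_C0 b) (@E1_sub b)) _.
  by apply: leeD => //; exact: I2_subU.
have h2 : (I2 s A (Nside 1) + I2 s A (Nside (-1)) <= I2 s A (~` E0))%E.
  have dis : [disjoint Nside 1 & Nside (-1)].
    rewrite disj_set2E; apply/eqP/seteqP; split=> // x [[+ _] [+ _]] /=; rewrite mul1r mulN1r; lra.
  rewrite -(I2_setUr s mA (mNs 1) (mNs (-1)) dis).
  apply: (I2_mono s mA (measurableU _ _ (mNs _) (mNs _)) mA (@measurable_E0C R)) => //.
  by rewrite E0E; move=> x [[_ h]|[_ h]] /=; move=> h'; move: (lt_trans h h'); rewrite ltxx.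
have gg := right_gain s0 b5; rewrite -/A in gg.
have lg := left_gain b s0; rewrite -/A in lg.
have lt : 4 * pi * b * b `^ (- (s / 2)) * C < kgap s * (pi / 8) * (pi / 8 * (2 * b)).
  have C1 : 0 < C + 1 by lra.
  have x0 := powR_ge0 b (- (s / 2)).
  have C2 : 0 < 256 * (C + 1) by lra.
  move: hb; rewrite (ler_pdivlMr _ _ C2); move: x0 b5 CC c0p p0; clear.
  move: (_ `^ _) pi (kgap s) => x p c x0 b5 CC cp pp h.
  have h1 : x * C * 256 <= c * p by apply: le_trans h; have := mulr_ge0 x0 CC; nra.
  have h2 : 0 < p * b by rewrite mulr_gt0//; lra.
  have h3 : 0 < c * p by rewrite mulr_gt0.
  have h4 := ler_wpM2l (ltW h2) h1.
  have h5 := mulr_gt0 h2 h3.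
  lra.
apply: (ereal_drop _ _ _ _ _ _ h1 gg lg h2 cost lt fin); exact: I2_ge0.
Qed.

End fractional_drop.

Section fractional_perimeter.
Context {R : realType}.
Local Notation lam := (@leb2 R).

Lemma perfrac_I2 (s : R) (E Om : set (pt R)) :
  perfrac s E Om = ((s * (1 - s))%:E * I2 s E (~` E `&` Om) + (s * (1 - s))%:E * I2 s (E `&` Om) (~` E `&` ~` Om))%E.
Proof. by []. Qed.

Lemma perfrac_E0_finite (s r : R) : 0 < s < 1 -> 0 < r -> (perfrac s E0 (Ball r) < +oo)%E.
Proof.
move=> hs r0; have [h1 h2] := frac_E0_finite hs r0; rewrite perfrac_I2.
move: h1 h2 (I2_ge0 s E0 (~` E0 `&` Ball r)) (I2_ge0 s (E0 `&` Ball r) (~` E0 `&` ~` Ball r)).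
case: (I2 _ _ _) => [x||]//; case: (I2 _ _ _) => [y||]// _ _ _ _.
by rewrite -!EFinM -EFinD ltry.
Qed.

Lemma perim_arith (c : R) (x1 x2 z1 z2 y : \bar R) : 0 < c -> (0 <= x1)%E -> (0 <= x2)%E ->
  (0 <= z1)%E -> (0 <= z2)%E -> (0 <= y)%E -> (x1 + z1 < +oo)%E -> (x2 + z2 < +oo)%E ->
  ((z1 + z2 < +oo)%E -> (y < z1 + z2)%E) ->
  (c%:E * (x1 + y) + c%:E * x2 < c%:E * (x1 + z1) + c%:E * (x2 + z2))%E.
Proof.
move=> c0; case: x1 => [x1||]//; case: x2 => [x2||]//; case: z1 => [z1||]//; case: z2 => [z2||]// _ _ _ _.
case: y => [y||]// _ _ _ /(_ (ltry _)) // core.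
have {}core : y < z1 + z2 by rewrite -lte_fin EFinD.
suff : c * (x1 + y) + c * x2 < c * (x1 + z1) + c * (x2 + z2) by rewrite -lte_fin !EFinD !EFinM !EFinD.
by rewrite -!mulrDr ltr_pM2l//; lra.
Qed.

(** Since A lies inside the ball, moving it to the complement changes only its own interactions:
    those with the complement of [E0], in and off the ball, disappear, and the one with all of
    [E1 b] appears. The height b is the same for every ball. *)
Lemma perfrac_drop (s : R) : 0 < s < 1 -> exists2 b, 5 <= b & forall r, 0 < r ->
  rect (- pi) pi (- b) b `<=` Ball r -> (perfrac s (E1 b) (Ball r) < perfrac s E0 (Ball r))%E.
Proof.
move=> hs; have [b b5 core] := frac_drop_core hs; exists b => // r r0 RB.
have [f1 f2] := frac_E0_finite hs r0; have /andP[s0 s1] := hs.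
move: core; set A := E0 `&` _ => core.
have mB := measurable_Ball (ltW r0); have mBC := measurableC mB.
have mE := @measurable_E0 R; have mEC := @measurable_E0C R.
have mA : measurable (A : set (PT R)) := measurable_box b.
have mE1 : measurable (E1 b : set (PT R)) by apply: measurableD => //; exact: measurable_rect.
have AB : A `<=` Ball r by move=> x [_ /RB].
have m1 := measurableI _ _ mEC mB; have m2 := measurableI _ _ mEC mBC.
have m3 := measurableI _ _ mE1 mB.
have EU : E0 = E1 b `|` A.
  apply/seteqP; split=> x; last by move=> [[]|[]].
  by move=> Ex; have [Rx|nRx] := pselect (rect (- pi) pi (- b) b x); [right|left].
have d1 : [disjoint E1 b & A] by apply/eqP/seteqP; split=> // x [[_ nR] [_ Rx]].
have EB : E0 `&` Ball r = (E1 b `&` Ball r) `|` A by rewrite {1}EU setIUl (setIidl AB).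
have d2 : [disjoint E1 b `&` Ball r & A] by apply/eqP/seteqP; split=> // x [[[_ nR] _] [_ Rx]].
have C1 : ~` E1 b `&` Ball r = (~` E0 `&` Ball r) `|` A.
  apply/seteqP; split=> x.
    move=> [nE Bx]; have [Ex|nEx] := pselect (E0 x); last by left.
    by right; split => //; apply: contrapT => nR; apply: nE.
  by move=> [[nE Bx]|[Ex Rx]]; [split=> // -[]|split; [case|exact: RB]].
have d3 : [disjoint ~` E0 `&` Ball r & A] by apply/eqP/seteqP; split=> // x [[nE _] [Ex _]].
have C2 : ~` E1 b `&` ~` Ball r = ~` E0 `&` ~` Ball r.
  apply/seteqP; split=> x [nE nB]; split=> //; last by case.
  by move=> Ex; apply: nE; split=> // /RB.
have U3 : ~` E0 = (~` E0 `&` Ball r) `|` (~` E0 `&` ~` Ball r) by rewrite -setIUr setUv setIT.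
have d4 : [disjoint ~` E0 `&` Ball r & ~` E0 `&` ~` Ball r] by apply/eqP/seteqP; split=> // x [[_ ?] [_ ?]].
rewrite EU in f1; rewrite EB in f2.
have s1E := I2_setUl s mE1 mA m1 d1; have s2E := I2_setUl s m3 mA m2 d2.
have s3E := I2_setUr s mE1 m1 mA d3; have s4E := I2_sym s mE1 mA.
have s5E := I2_setUr s mA m1 m2 d4; rewrite -U3 in s5E.
rewrite -EU in s1E f1; rewrite s1E in f1; rewrite s2E in f2.
rewrite !perfrac_I2 C1 C2 s3E EB s1E s2E s4E.
move: f1 f2 core; rewrite s5E.
have g1 := I2_ge0 s (E1 b) (~` E0 `&` Ball r); have g2 := I2_ge0 s (E1 b `&` Ball r) (~` E0 `&` ~` Ball r).
have g3 := I2_ge0 s A (~` E0 `&` Ball r); have g4 := I2_ge0 s A (~` E0 `&` ~` Ball r).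
have g5 := I2_ge0 s A (E1 b).
move: g1 g2 g3 g4 g5; clear -s0 s1.
move: (I2 s (E1 b) _) (I2 s (E1 b `&` Ball r) _) (I2 s A (~` E0 `&` Ball r)) (I2 s A (~` E0 `&` ~` Ball r)) (I2 s A (E1 b)).
move=> x1 x2 z1 z2 y g1 g2 g3 g4 g5 f1 f2 core; apply: perim_arith => //.
by rewrite mulr_gt0// subr_gt0.
Qed.

End fractional_perimeter.

(** * Lower bound for the fractional perimeter in a large ball *)

Section fractional_lower.
Context {R : realType}.
Local Notation lam := (@leb2 R).

Lemma cos_quarter_gt0 : 0 < cos (pi / 4 : R).
Proof. by have p0 := pi_gt0 R; apply: cos_gt0_pihalf; apply/andP; split; lra. Qed.

Lemma cos_quarter (t : R) : `|t| <= pi / 4 -> cos (pi / 4) <= cos t.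
Proof.
move=> h; have p0 := pi_gt0 R; have n0 := normr_ge0 t; rewrite -[leRHS]cos_norm.
move: h; rewrite le_eqVlt => /predU1P[->//|h].
by rewrite ltW// ltr_cos ?in_itv//=; apply/andP; split; lra.
Qed.

Lemma cos_3quarter (t : R) : 3 * pi / 4 <= t <= 5 * pi / 4 -> cos t <= - cos (pi / 4).
Proof.
move=> /andP[h1 h2]; have -> : t = (t - pi) + pi by lra.
by rewrite cosDpi lerN2; apply: cos_quarter; rewrite ler_norml; apply/andP; split; lra.
Qed.

Lemma chebyshev (B : set (PT R)) (w : pt R -> R) (tau : R) : measurable B -> 0 < tau ->
  measurable_fun B w -> ok B (fun x => w x ^+ 2) ->
  measurable (B `&` [set x | tau <= `|w x|] : set (PT R)) /\
  (lam (B `&` [set x : pt R | (tau <= `|w x|)%R]) <= (I B (fun x => w x ^+ 2) / tau ^+ 2)%:E)%E.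
Proof.
move=> mB t0 mw ow.
have mn : measurable_fun B (fun x => `|w x|) by exact: measurableT_comp.
have mS : measurable (B `&` [set x | tau <= `|w x|] : set (PT R)).
  have := mn mB _ (measurable_itv `[tau, +oo[).
  by rewrite (_ : _ @^-1` _ = [set x | tau <= `|w x|])//; apply/seteqP; split=> x /=; rewrite in_itv/= andbT.
split=> //; set S := B `&` _ in mS *.
have t2 : 0 < tau ^+ 2 by rewrite exprn_gt0.
have H : ((tau ^+ 2)%:E * lam S <= (I B (fun x => w x ^+ 2))%:E)%E.
  rewrite -(EFin_I mB ow).
  have := @int_gain _ (PT R) R lam B S (fun=> 0%E) (fun x => (w x ^+ 2)%:E) (tau ^+ 2)%:E mB mS.
  rewrite integral0 add0e; apply.
  - by move=> x [].
  - by rewrite lee_fin ltW.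
  - by [].
  - exact: measurable_cst.
  - by apply/measurable_EFinP; exact: measurable_funX.
  - move=> x Bx; rewrite add0e patchE; case: ifPn => xS; last by rewrite lee_fin sqr_ge0.
    have [_ /= h] := set_mem xS; rewrite lee_fin -(real_normK (num_real (w x))).
    by rewrite ler_sqr ?nnegrE// ltW.
by rewrite EFinM muleC lee_pdivlMl.
Qed.

(** At least half a unit of area of the window remains in Y after the exceptional set is discarded,
    and the kernel is at least D^(-2-s) there. *)
Lemma I2_window (s : R) (Y W H : set (PT R)) (x : PT R) (D : R) : 0 < s -> 0 < D ->
  measurable Y -> measurable W -> measurable H ->
  (forall y, W y -> Defs.edist x y <= D /\ 0 < Defs.edist x y) ->
  W `<=` Y `|` H -> (1%:E <= lam W)%E -> (lam H <= (1 / 2)%:E)%E ->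
  ((D `^ (- (2 + s)) / 2)%:E <= \int[lam]_(y in Y) ker s (x, y))%E.
Proof.
move=> s0 D0 mY mW mH hW sub lW lH; have mI := measurableI _ _ mW mY.
have lI : ((1 / 2)%:E <= lam (W `&` Y))%E.
  have h : (lam W <= lam (W `&` Y) + lam H)%E.
    apply: (@le_trans _ _ (lam ((W `&` Y) `|` H))); last exact: measureU2.
    apply: le_measure; rewrite ?inE//; first exact: measurableU.
    by move=> y Wy; have [Yy|Hy] := sub y Wy; [left|right].
  have : (1%:E <= lam (W `&` Y) + (1 / 2)%:E)%E.
    by apply: le_trans lW _; apply: le_trans h _; exact: leeD2l.
  by rewrite -leeBlDr// -EFinB; apply: le_trans; rewrite lee_fin; lra.
have k0 : 0 <= D `^ (- (2 + s)) := powR_ge0 _ _.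
apply: (@le_trans _ _ (\int[lam]_(y in W `&` Y) ker s (x, y))%E); last first.
  by apply: ge0_subset_integral => //; [exact: measurable_ker1|move=> y _; exact: ker_ge0].
have := @int_gain _ (PT R) R lam (W `&` Y) (W `&` Y) (fun=> 0%E) (fun y => ker s (x, y)) (D `^ (- (2 + s)))%:E mI mI.
rewrite integral0 add0e => H1; apply: le_trans (H1 _ _ _ _ _ _).
- have -> : (D `^ (- (2 + s)) / 2)%:E = ((D `^ (- (2 + s)))%:E * (1 / 2)%:E)%E by rewrite -EFinM div1r.
  by apply: lee_wpmul2l => //; rewrite lee_fin.
- by [].
- by rewrite lee_fin.
- by [].
- exact: measurable_cst.
- exact: measurable_ker1.
move=> y Iy; rewrite add0e patchE mem_set//=; have [h1 h2] := hW y Iy.1.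
rewrite lee_fin; have -> : - 2 - s = - (2 + s) by lra.
by apply: powR_anti => //; lra.
Qed.

(** A piece of a positive strip of length m at height h faces negative windows within bounded
    distance. Nearly every point of it stays positive and nearly every window stays negative, so the
    interaction grows linearly in m. *)
Lemma perfrac_lower (s p M rmin : R) : 0 < s < 1 -> 0 <= M -> exists2 r, rmin < r & 0 < r /\
  forall w : pt R -> R, measurable_fun (Ball r : set (PT R)) w -> ok (Ball r) (fun x => w x ^+ 2) ->
    I (Ball r) (fun x => w x ^+ 2) <= 16 * r ^+ 2 * M ->
    (forall x, ~ Ball r x -> w x = 0) ->
    (p%:E < perfrac s [set x : pt R | (0 < u0 x + w x)%R] (Ball r))%E.
Proof.
move=> hs M0; have /andP[s0 s1] := hs; have p0 := pi_gt0 R; have p4 := pi_lt4 (R := R).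
have p2 := pi_ge2 R.
have [c4 c4E] : exists c : R, c = cos (pi / 4) by eexists.
have c40 : 0 < c4 by rewrite c4E; exact: cos_quarter_gt0.
(* The distance bound is 7 = 6 + 1: the abscissas differ by at most 3 pi/2 < 6, the ordinates by at
   most 1. *)
have [k kE] : exists k : R, k = 7 `^ (- (2 + s)) / 2 by eexists.
have k0 : 0 < k by rewrite kE divr_gt0// powR_gt0.
have cs0 : 0 < s * (1 - s) by rewrite mulr_gt0// subr_gt0.
have ck0 : 0 < s * (1 - s) * k by rewrite mulr_gt0.
(* Chosen so that s (1 - s) k (m - 1) = |p| + s (1 - s) k > p. *)
have [m mE] : exists m : R, m = `|p| / (s * (1 - s) * k) + 2 by eexists.
have m0 : 0 <= `|p| / (s * (1 - s) * k) by rewrite divr_ge0// ltW.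
have m2 : 2 <= m by rewrite mE lerDr.
have d0 : 0 <= m + 10 by clear -m2; lra.
have b0 : 0 <= 16 * M by clear -M0; lra.
have e0 : 0 < c4 ^+ 2 / 2 by rewrite divr_gt0// exprn_gt0.
have [h [h1 h0 hh]] := exp_beats_sqr rmin (lexx 0) b0 d0 e0.
have [r rE] : exists r : R, r = h + (m + 10) by eexists.
have r0 : 0 < r by rewrite rE; clear -h0 m2; lra.
exists r; first by rewrite rE; clear -h1 m2; lra.
split=> // w mw ow Iw woff.
have mB := measurable_Ball (ltW r0).
have [E' E'E] : exists A : set (PT R), A = [set x : pt R | 0 < u0 x + w x] by eexists.
rewrite -E'E.
have mE' : measurable E'.
  have mu : measurable_fun (Ball r : set (PT R)) (fun x => u0 x + w x).
    apply: measurable_funD => //; apply: measurable_funTS; apply: continuous_measurable_pt.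
    exact: Cinf_continuous (@Cinf_u0 R).
  (* The perturbation is known to be measurable only in the ball; outside it vanishes, and the set
     is that of u0. *)
  have -> : E' = ([set x | 0 < u0 x + w x] `&` Ball r) `|` (E0 `&` ~` Ball r).
    rewrite E'E; apply/seteqP; split=> x.
      move=> /= hx; have [Bx|nB] := pselect (Ball r x); [by left|right; split=> //].
      by move: hx; rewrite (woff x nB) addr0.
    by move=> [[]//|[Ex nB]]; rewrite /= (woff x nB) addr0.
  apply: measurableU; first exact: measurable_gt0_on.
  by apply: measurableI; [exact: measurable_E0|exact: measurableC].
have [tau tauE] : exists t : R, t = c4 * expR h by eexists.
have tau0 : 0 < tau by rewrite tauE mulr_gt0// expR_gt0.
have [mH lH] := chebyshev mB tau0 mw ow.
move: mH lH; set H := Ball r `&` _ => mH lH.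
(* On the quarter-strips at heights at least h, |u0| >= [tau], so a wrong sign forces |w| >= [tau].
   Chebyshev divides by exp(2h), of which one factor exp h already beats the L^2 bound. *)
have {}lH : (lam H <= (1 / 2)%:E)%E.
  apply: le_trans lH _; rewrite lee_fin ler_pdivrMr ?exprn_gt0//.
  apply: le_trans Iw _; rewrite tauE exprMn.
  have x1 : 1 <= expR h by rewrite -expR0 ler_expR.
  move: hh; rewrite expRN mulrC ler_pdivrMr ?expR_gt0// add0r -rE => hh.
  have -> : 16 * r ^+ 2 * M = 16 * M * r ^+ 2 by rewrite mulrAC.
  apply: le_trans hh _.
  have : expR h <= expR h ^+ 2 by rewrite expr2 ler_peMr// expR_ge0.
  have : 0 < c4 ^+ 2 by rewrite exprn_gt0.
  clear; move: (c4 ^+ 2) (expR h ^+ 2) (expR h) => a b c; nra.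
have inB (x : pt R) : - 5 <= x.1 <= 5 -> h <= x.2 <= h + m + 1 -> Ball r x.
  move=> /andP[a1 a2] /andP[a3 a4]; rewrite BallE ?ltW//= /q2 rE.
  have q1 : x.1 ^+ 2 <= 25 by clear -a1 a2; nra.
  have q3 : x.2 ^+ 2 <= (h + m + 1) ^+ 2 by rewrite ler_sqr ?nnegrE; clear -a3 a4 h0 m2; lra.
  clear -q1 q3 h0 m2; nra.
pose P0 : set (PT R) := rect (- (pi / 4)) (pi / 4) h (h + m).
have mP0 : measurable P0 := measurable_rect _ _ _ _.
have P0H x : P0 x -> ~ E' x -> H x.
  move=> [/= x1 x2]; move: x1 x2; rewrite !in_itv/= => /andP[a1 a2] /andP[a3 a4] nE.
  split; first by apply: inB; apply/andP; split; clear -a1 a2 a3 a4 p0 p4 m2; lra.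
  have q1 : c4 <= cos x.1 by rewrite c4E; apply: cos_quarter; rewrite ler_norml a1 a2.
  have q3 : expR h <= expR x.2 by rewrite ler_expR.
  have q5 : tau <= u0 x by rewrite tauE /u0; apply: ler_pM => //; exact: ltW.
  have q6 : u0 x + w x <= 0 by rewrite leNgt; apply/negP => hx; apply: nE; rewrite E'E.
  by rewrite /= -normrN; apply: le_trans (ler_norm _); clear -q5 q6; lra.
have lP0 : lam P0 = (pi / 2 * m)%:E.
  by rewrite /P0 leb2_rect; [congr (_%:E); clear; field|clear -p0; lra|clear -m2; lra].
pose P : set (PT R) := P0 `&` E'.
have mP : measurable P := measurableI _ _ mP0 mE'.
(* The area of [P0] is pi m / 2 >= m, and at most 1/2 is lost to the exceptional set. *)
have lP : ((m - 1)%:E <= lam P)%E.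
  have h3 : (lam P0 <= lam P + lam H)%E.
    apply: (@le_trans _ _ (lam (P `|` H))); last exact: measureU2.
    apply: le_measure; rewrite ?inE//; first exact: measurableU.
    by move=> x Px; have [Ex|nEx] := pselect (E' x); [left|right; exact: P0H].
  have : ((pi / 2 * m)%:E <= lam P + (1 / 2)%:E)%E.
    by rewrite -lP0; apply: le_trans h3 _; exact: leeD2l.
  by rewrite -leeBlDr// -EFinB; apply: le_trans; rewrite lee_fin; clear -p2 m2; nra.
have mY := measurableI _ _ (measurableC mE') mB.
have inner x : P x -> (k%:E <= \int[lam]_(y in ~` E' `&` Ball r) ker s (x, y))%E.
  move=> [[/= x1 x2] Ex]; move: x1 x2; rewrite !in_itv/= => /andP[a1 a2] /andP[a3 a4].
  pose W : set (PT R) := rect (3 * pi / 4) (5 * pi / 4) x.2 (x.2 + 1).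
  have mW : measurable W := measurable_rect _ _ _ _.
  rewrite kE; apply: (@I2_window s _ W H x 7) => //.
  - move=> y [/= y1 y2]; move: y1 y2; rewrite !in_itv/= => /andP[a5 a6] /andP[a7 a8].
    split.
      rewrite /Defs.edist; apply: le_trans (enorm_le_sum _) _ => /=.
      have -> : 7 = 6 + 1 :> R by clear; lra.
      by apply: lerD; rewrite ler_norml; apply/andP; split; clear -a1 a2 a5 a6 a7 a8 p4; lra.
    by rewrite /Defs.edist; apply: lt_le_trans (enorm_ge1 _); rewrite normr_gt0 /= subr_eq0; apply/eqP; clear -a2 a5 p0; lra.
  - move=> y [/= y1 y2]; move: y1 y2; rewrite !in_itv/= => /andP[a5 a6] /andP[a7 a8].
    have By : Ball r y by apply: inB; apply/andP; split; clear -a3 a4 a5 a6 a7 a8 p0 p4; lra.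
    have [Ey|nEy] := pselect (E' y); last by left.
    right; split=> //=.
    have q1 : cos y.1 <= - c4 by rewrite c4E; apply: cos_3quarter; rewrite a5.
    have q3 : expR h <= expR y.2 by rewrite ler_expR (le_trans a3).
    have q5 : tau <= - u0 y.
      rewrite tauE /u0 -mulNr; apply: ler_pM => //; first exact: ltW.
      by clear -q1; lra.
    move: Ey; rewrite E'E /= => Ey; apply: le_trans (ler_norm _); clear -q5 Ey; lra.
  - by rewrite /W leb2_rect; [rewrite lee_fin|..]; clear -p2; lra.
have ke : (0 <= k%:E)%E by rewrite lee_fin ltW.
have G := I2_ge mE' mY mP (@subIsetr _ _ _) ke inner.
rewrite perfrac_I2; apply: (@lt_le_trans _ _ ((s * (1 - s))%:E * I2 s E' (~` E' `&` Ball r))%E); last first.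
  by rewrite leeDl// mule_ge0 ?I2_ge0// lee_fin ltW.
apply: (@lt_le_trans _ _ ((s * (1 - s))%:E * (k%:E * (m - 1)%:E))%E); last first.
  apply: lee_wpmul2l; first by rewrite lee_fin ltW.
  by apply: le_trans G; apply: lee_wpmul2l => //; rewrite lee_fin ltW.
rewrite -!EFinM lte_fin mulrA mE.
have -> : s * (1 - s) * k * (`|p| / (s * (1 - s) * k) + 2 - 1) = `|p| + s * (1 - s) * k.
  by rewrite -addrA mulrDr [X in X + _]mulrC divfK ?gt_eqF//; congr (_ + _); lra.
by apply: le_lt_trans (ler_norm p) _; rewrite ltrDl.
Qed.

End fractional_lower.

(** * The counterexample *)

Section main.
Context {R : realType}.

Lemma per1_ge0 (E Om : set (pt R)) : (0 <= per1 E Om)%E.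
Proof.
apply: ereal_sup_ubound; exists (fun=> 0), (fun=> 0); split; first exact: testfun0.
split; first exact: testfun0.
split; first by move=> x; rewrite expr0n/= addr0.
apply/esym/integral0_eq => x _.
by rewrite !DpE !Dp_cst addr0.
Qed.

Lemma Per_ge0 (s : R) (E Om : set (pt R)) : 0 < s <= 1 -> (0 <= Per s E Om)%E.
Proof.
move=> /andP[s0 s1]; rewrite /Per; case: ifP => _; first exact: per1_ge0.
have c0 : (0 <= (s * (1 - s))%:E)%E by rewrite lee_fin mulr_ge0 ?subr_ge0// ltW.
by rewrite perfrac_I2; apply: adde_ge0; apply: mule_ge0 => //; exact: I2_ge0.
Qed.

Lemma sigma_cases (s : R) : 0 < s <= 1 -> s = 1 \/ (0 < s < 1 /\ (s == 1) = false).
Proof.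
move=> /andP[s0]; rewrite le_eqVlt => /predU1P[->|s1]; [by left|right].
by rewrite s0 s1 lt_eqF.
Qed.

Lemma Per_E0_finite (s r : R) : 0 < s <= 1 -> 0 < r -> (Per s E0 (Ball r) < +oo)%E.
Proof.
move=> /sigma_cases[->|[hs e]] r0; rewrite /Per ?eqxx ?e.
  exact: per1_E0_finite.
exact: perfrac_E0_finite.
Qed.

Lemma Per_drop (s : R) : 0 < s <= 1 -> exists2 b, 5 <= b & forall r, 0 < r ->
  rect (- pi) pi (- b) b `<=` Ball r -> (Per s (E1 b) (Ball r) < Per s E0 (Ball r))%E.
Proof.
move=> /sigma_cases[->|[hs e]]; rewrite /Per ?eqxx ?e; last exact: perfrac_drop.
exists 5 => // r r0 RB; apply: lt_le_trans (per1_drop (lexx 5) r0 RB).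
have h0 := per1_ge0 (E1 (5 : R)) (Ball r).
have f : (per1 (E1 5) (Ball r) < +oo)%E.
  apply: le_lt_trans (per1_E0_finite r0); apply: le_trans (per1_drop (lexx 5) r0 RB).
  by rewrite leeDl.
by rewrite lteDl// ?lte01// ge0_fin_numE.
Qed.

Lemma Per_lower (s p M rmin : R) : 0 < s <= 1 -> 0 <= M -> exists2 r, rmin < r & 0 < r /\
  forall w : pt R -> R, measurable_fun (Ball r : set (PT R)) w -> ok (Ball r) (fun x => w x ^+ 2) ->
    I (Ball r) (fun x => w x ^+ 2) <= 16 * r ^+ 2 * M ->
    (s < 1 -> forall x, ~ Ball r x -> w x = 0) ->
    (p%:E < Per s [set x : pt R | (0 < u0 x + w x)%R] (Ball r))%E.
Proof.
move=> /sigma_cases[->|[hs e]] M0; rewrite /Per ?eqxx ?e.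
  have [r h1 [h2 h3]] := per1_lower p rmin M0.
  by exists r => //; split=> // w mw ow Iw _; exact: h3.
have [r h1 [h2 h3]] := perfrac_lower p rmin hs M0.
exists r => //; split=> // w mw ow Iw hw; apply: h3 => //; apply: hw.
by case/andP: hs.
Qed.

(* The linear part only serves to make the potential unbounded; it starts at the
   perimeter Q of u0 in the large ball, so that u0 pays exactly M there. *)
Definition step_pot (p M Q t : R) : R := if t <= p then 0 else M + Num.max 0 (t - Q).

Lemma step_pot_ge0 (p M Q t : R) : 0 <= M -> 0 <= step_pot p M Q t.
Proof. by move=> M0; rewrite /step_pot; case: ifP => // _; rewrite addr_ge0// le_max lexx. Qed.

Lemma step_pot_gt (p M Q t : R) : p < t -> M <= step_pot p M Q t.
Proof. by move=> h; rewrite /step_pot [t <= p]leNgt h /= lerDl le_max lexx. Qed.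

Lemma admissible_step_pot (p M Q : R) : 0 <= M -> admissible_Phi (step_pot p M Q).
Proof.
move=> M0; split; first by move=> t _; exact: step_pot_ge0.
split.
  move=> s t _ st; rewrite {1}/step_pot; case: (leP s p) => sp; first exact: step_pot_ge0.
  rewrite /step_pot [t <= p]leNgt (lt_le_trans sp st)/= lerD2l ge_max le_max lexx /= le_max.
  by apply/orP; right; rewrite lerD2r.
split.
  move=> t _ a; rewrite {1}/step_pot; case: (leP t p) => tp ha.
    by exists 1 => [|s _ _] /=; [exact: ltr01|apply: lt_le_trans ha _; exact: step_pot_ge0].
  (* Beyond p the potential is 1-Lipschitz, so the slack itself is an admissible radius; t - p keeps
     s beyond the jump, whose lower value is taken at p. *)
  exists (Num.min (t - p) (M + Num.max 0 (t - Q) - a)) => /=; first by rewrite lt_min !subr_gt0 tp ha.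
  move=> s /=; rewrite lt_min => /andP[h1 h2] _.
  have ps : p < s by apply: contraTT h1; rewrite -!leNgt => sp; apply: le_trans (ler_norm _); lra.
  rewrite /step_pot [s <= p]leNgt ps /=.
  have h3 : t - s < M + Num.max 0 (t - Q) - a := le_lt_trans (ler_norm _) h2.
  have h4 : 0 <= `|t - s| := normr_ge0 _.
  have h5 : s - Q <= Num.max 0 (s - Q) by rewrite le_max lexx orbT.
  have h6 : 0 <= Num.max 0 (s - Q) by rewrite le_max lexx.
  move: h2 h3; case: (leP 0 (t - Q)) => h7 h2 h3; lra.
apply/cvgryPge => A; near=> x.
have px : p < x by near: x; apply: nbhs_pinfty_gt; rewrite num_real.
have ax : A + Q <= x by near: x; apply: nbhs_pinfty_ge; rewrite num_real.
rewrite /step_pot [x <= p]leNgt px /=; have : x - Q <= Num.max 0 (x - Q) by rewrite le_max lexx orbT.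
lra.
Unshelve. all: by end_near. Qed.

Lemma Phi_ext_gt (p M Q : R) (e : \bar R) : (p%:E < e)%E -> (M%:E <= Phi_ext (step_pot p M Q) e)%E.
Proof. by case: e => [t||]//=; rewrite ?leey// lte_fin lee_fin; exact: step_pot_gt. Qed.

Lemma Phi_ext_ge0 (p M Q : R) (e : \bar R) : 0 <= M -> (0 <= e)%E -> (0 <= Phi_ext (step_pot p M Q) e)%E.
Proof. by move=> M0; case: e => [t||]//= _; rewrite lee_fin step_pot_ge0. Qed.

Lemma dirichlet_ge0 (Om : set (pt R)) v : (0 <= dirichlet Om v)%E.
Proof.
apply: le_ereal_inf_tmp => _ [g1 [g2 [_ ->]]]; apply: integral_ge0 => x _.
by rewrite lee_fin addr_ge0 ?sqr_ge0.
Qed.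

(* u0 + w = (1 - kp) u0, with a cutoff kp equal to 1 exactly on the box. *)
Lemma competitor (b : R) : 5 <= b -> exists w : pt R -> R,
  [/\ testfun (Ball (b + 10)) w, [set x | 0 < u0 x + w x] = E1 b &
    forall x, ~ Ball (b + 10) x -> w x = 0].
Proof.
move=> b5; have p0 := pi_gt0 R; have p4 := pi_lt4 (R := R).
have b0 : 0 <= b by lra.
have bb : b < b + 1 by lra.
have [k1 k1E] : exists f, f = cutx 0 pi (4 : R) by eexists.
have [k2 k2E] : exists f, f = cutx 0 b (b + 1) by eexists.
have s1 : Cinf1 k1 by rewrite k1E; apply: Cinf1_cutx => //; exact: ltW.
have s2 : Cinf1 k2 by rewrite k2E; exact: Cinf1_cutx.
have h1 t : 0 <= k1 t <= 1 by rewrite k1E; apply: cutx01 => //; exact: ltW.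
have h2 t : 0 <= k2 t <= 1 by rewrite k2E; exact: cutx01.
pose kp (x : pt R) := k1 x.1 * k2 x.2.
have skp : Cinf (@dir R) kp by exact: Cinf_prod.
(* The cutoff in x1 falls from 1 at pi to 0 at 4, and 4^2 + (b + 1)^2 < (b + 10)^2. *)
have RB : rect (- 4) 4 (- (b + 1)) (b + 1) `<=` Ball (b + 10).
  by apply: rect_Ball; [lra|lra|lra|nra].
have off x : ~ rect (- 4) 4 (- (b + 1)) (b + 1) x -> kp x = 0.
  move=> nR; have [h|h] := leP 4 `|x.1|; first by rewrite /kp k1E cutx0 ?subr0// mul0r.
  have [h'|h'] := leP (b + 1) `|x.2|.
    by rewrite /kp k2E (@cutx0 _ 0 _ (b + 1)) ?subr0 ?mulr0//; lra.
  by exfalso; apply: nR; split; rewrite /= in_itv/= -ler_norml ltW.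
exists (fun x => - kp x * u0 x); split.
- apply: (testfun_compact _ (@compact_rect _ (- 4) 4 (- (b + 1)) (b + 1)) RB).
    by apply: CinfM; [exact: CinfN|exact: Cinf_u0].
  by move=> x /off ->; rewrite oppr0 mul0r.
- apply/seteqP; split=> x /=.
    have -> : u0 x + - kp x * u0 x = (1 - kp x) * u0 x by lra.
    have := h1 x.1; have := h2 x.2 => /andP[a1 a2] /andP[a3 a4] hx.
    have kx : kp x <= 1 by exact: mulr_ile1.
    have k1' : kp x < 1.
      rewrite lt_neqAle kx andbT; apply/eqP => e; move: hx; rewrite e subrr mul0r ltxx//.
    split; first by move: hx; rewrite pmulr_rgt0 ?subr_gt0.
    move=> [/= x1 x2]; move: k1'; rewrite /kp k1E k2E !cutx1 ?subr0 ?mulr1 ?ltxx//.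
    + by move: x2; rewrite in_itv/= -ler_norml.
    + exact: ltW.
    + by move: x1; rewrite in_itv/= -ler_norml.
  move=> [Ex nR]; have -> : u0 x + - kp x * u0 x = (1 - kp x) * u0 x by lra.
  apply: mulr_gt0 => //; rewrite subr_gt0.
  have /andP[a1 a2] := h1 x.1; have /andP[a3 a4] := h2 x.2.
  have [hx|hx] := ltP pi `|x.1|.
    apply: (@le_lt_trans _ _ (k1 x.1)); first by rewrite /kp ler_piMr.
    by rewrite k1E; apply: cutx_lt1; rewrite ?subr0// ltW.
  apply: (@le_lt_trans _ _ (k2 x.2)); first by rewrite /kp ler_piMl.
  rewrite k2E; apply: cutx_lt1; rewrite ?subr0// ltNge; apply/negP => hx2.
  by apply: nR; split; rewrite /= in_itv/= -ler_norml.
- by move=> x nB; rewrite off ?oppr0 ?mul0r// => /RB.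
Qed.

End main.

Opaque Per.
Unset Implicit Arguments.

(* n = 2, sigma in (0,1] *)
Theorem theorem4p1 (R : realType) (sigma : R) :
  0 < sigma <= 1 ->
  exists (Phi0 : R -> R) (R0 r0 : R),
    admissible_Phi Phi0 /\ 0 < r0 /\ r0 < R0 /\
    exists u : pt R -> R,
      minimizer sigma Phi0 (Ball R0) u /\
      ~ minimizer sigma Phi0 (Ball r0) u.
Proof.
move=> hs; have [b b5 drop] := Per_drop hs.
have [w [tw wE woff]] := competitor b5.
have sw := testfun_Cinf tw; have su := @Cinf_u0 R.
have r0 : 0 < b + 10 by lra.
have p0 := pi_gt0 R; have p4 := @pi_lt4 R.
have RB : rect (- pi) pi (- b) b `<=` Ball (b + 10).
  by apply: rect_Ball; [lra|lra|lra|nra].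
have {drop}dr := drop _ r0 RB.
have Pf := Per_E0_finite hs r0.
have P0 := Per_ge0 (E1 b) (Ball (b + 10)) hs.
have Pn : Per sigma (E1 b) (Ball (b + 10)) \is a fin_num.
  by rewrite (ge0_fin_numE P0); exact: lt_trans dr Pf.
have [p pE] : exists p : R, Per sigma (E1 b) (Ball (b + 10)) = p%:E.
  by exists (fine (Per sigma (E1 b) (Ball (b + 10)))); rewrite fineK.
pose v x := u0 x + w x.
have sv : Cinf (@dir R) v by exact: CinfD.
have dv := dirichlet_Cinf (ltW r0) sv.
(* The jump exceeds the whole Dirichlet energy of the cut function, so in the small ball the energy
   of u0 need not be known; the + 1 makes this strict. *)
have [M ME] : exists M : R, M = I (Ball (b + 10)) (grad2 v) + 1 by eexists.
have M1 : I (Ball (b + 10)) (grad2 v) < M by rewrite ME ltrDl.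
have M0 : 0 <= M.
  by apply: le_trans (ltW M1); apply: I_ge0 => x _; rewrite addr_ge0 ?sqr_ge0.
have [R0 rR [R00 low]] := Per_lower p (b + 10) hs M0.
have Qf : Per sigma E0 (Ball R0) \is a fin_num.
  by rewrite (ge0_fin_numE (Per_ge0 _ _ hs)); exact: Per_E0_finite.
have [Q QE] : exists Q : R, Per sigma E0 (Ball R0) = Q%:E by exists (fine (Per sigma E0 (Ball R0))); rewrite fineK.
have uE : [set x : pt R | 0 < u0 x] = E0 by [].
have pQ : (p%:E < Per sigma E0 (Ball R0))%E.
  have mB := measurable_Ball (ltW R00).
  have z : (fun x : pt R => (fun=> 0 : R) x ^+ 2) = fun=> 0 by apply/funext => x; rewrite expr0n.
  have o0 : ok (Ball R0) (fun x : pt R => (fun=> 0 : R) x ^+ 2) by rewrite z; exact: ok0.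
  have i0 : I (Ball R0) (fun x : pt R => (fun=> 0 : R) x ^+ 2) <= 16 * R0 ^+ 2 * M.
    have -> : I (Ball R0) (fun x : pt R => (fun=> 0 : R) x ^+ 2) = 0.
      rewrite -[RHS](mul0r (I (Ball R0) (fun x : pt R => (fun=> 0 : R) x ^+ 2))) -(IZ mB _ o0); apply: eq_I => x _.
      by rewrite mul0r expr0n.
    by rewrite mulr_ge0 ?mulr_ge0 ?exprn_ge0// ltW.
  have := low (fun=> 0) (measurable_cst _) o0 i0 (fun _ _ _ => erefl).
  by rewrite (_ : [set x | _] = E0)//; apply/seteqP; split=> x /=; rewrite addr0.
exists (step_pot p M Q), R0, (b + 10); split; first exact: admissible_step_pot.
split => //; split => //; exists u0; split.
  have du := dirichlet_Cinf (ltW R00) su.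
  have eu : (energy sigma (step_pot p M Q) (Ball R0) u0 <= (I (Ball R0) (grad2 u0) + M)%:E)%E.
    rewrite /energy uE QE EFinD; apply: leeD; first exact: du.
    rewrite /=.
    rewrite lee_fin /step_pot; case: ifP => // _.
    by rewrite subrr maxxx addr0.
  split; first by apply: continuous_measurable_pt; exact: Cinf_continuous su.
  split; first by apply: le_lt_trans eu (ltry _).
  move=> v' Hv voff; apply: le_trans eu _.
  have [c1 c2] := competitor_L2 M R00 su u0_harmonic Hv.
  (* Either the Dirichlet term alone already costs as much as u0 does, or it is small enough for the
     L^2 bound, and then the perimeter exceeds p. *)
  have [h|h] := leP (I (Ball R0) (grad2 u0) + M)%:E (dirichlet (Ball R0) v').
    have q := Phi_ext_ge0 p Q M0 (Per_ge0 [set x | 0 < v' x] (Ball R0) hs).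
    by have := leeD h q; rewrite adde0.
  have [m1 m2 m3] := c2 h.
  have off : sigma < 1 -> forall x, ~ Ball R0 x -> (v' - u0) x = 0.
    by move=> s1 x nB; rewrite fctE voff// subrr.
  have := low _ m1 m2 m3 off; rewrite (_ : [set x | _] = [set x | 0 < v' x]); last first.
    by apply/funext => x; rewrite /= (_ : u0 x + (v' - u0) x = v' x)// -[RHS](subrK (u0 x)) addrC.
  by move=> /(Phi_ext_gt M Q) q; have := leeD c1 q.
move=> [_ [_ /(_ v)]].
have vw : v - u0 = w by apply/funext => x; rewrite fctE /v addrAC subrr add0r.
rewrite vw => /(_ (H10_testfun (ltW r0) tw)) H.
have {H} : (energy sigma (step_pot p M Q) (Ball (b + 10)) u0 <= energy sigma (step_pot p M Q) (Ball (b + 10)) v)%E.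
  by apply: H => _ x /woff; rewrite /v => ->; rewrite addr0.
rewrite /energy wE pE uE => H.
have H1 : (M%:E <= dirichlet (Ball (b + 10)) v)%E.
  have q : (M%:E <= Phi_ext (step_pot p M Q) (Per sigma E0 (Ball (b + 10))))%E.
    by apply: Phi_ext_gt; rewrite -pE.
  have := le_trans (leeD (dirichlet_ge0 (Ball (b + 10)) u0) q) H.
  by rewrite add0e /= /step_pot lexx adde0.
by have := le_trans H1 dv; rewrite lee_fin leNgt M1.
Qed.
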